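(* Let $n\ge 1$ be an integer, $\tau\in\mathbb{C}$ with $\mathrm{Im}\,\tau>0$, and $\kappa\in\mathbb{C}$ with $\kappa\notin\mathbb{Z}+\tau\mathbb{Z}$. Let $$V^e_n=\{f \text{ holomorphic on }\mathbb{C}\mid f(z+1)=(-1)^{n-1}f(z),\ f(z+\tau)=e^{-\pi i n\tau-2\pi i nz}f(z)\}.$$ Then $V^e_n\otimes V^e_n$ is a finite dimensional representation of the twisted elliptic Shibukawa-Ueno operator $\mathcal{R}^e_{1/2n,\kappa/2n}(\lambda)$ (i.e. it is invariant under this operator for all $\lambda\in\mathbb{C}\setminus(\mathbb{Z}+\tau\mathbb{Z})$), on which $\mathcal{R}^e_{1/2n,\kappa/2n}(\lambda)$ is equivalent to a Belavin $R$-matrix. The matrix coefficients of $\mathcal{R}^e_{1/2n,\kappa/2n}(\lambda)|_{V^e_n\otimes V^e_n}$ with respect to the basis $\{\psi_a\otimes\psi_b\}$ are $$R(\lambda)_{ij}^{kl}=\delta_{i+j,k+l\,(n)}\ \frac{\theta_{\frac12,\frac12}'(0,n\tau)\ \theta_{\frac{i-j}{n}+\frac12,\frac12}(\lambda-\kappa,n\tau)}{\theta_{\frac{i-k}{n}+\frac12,\frac12}(-\kappa,n\tau)\ \theta_{\frac{k-j}{n}+\frac12,\frac12}(\lambda,n\tau)},$$ where $\delta_{i+j,k+l\,(n)}$ is $1$ if $i+j\equiv k+l \pmod n$ and $0$ otherwise.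
   Context: Theta functions: for $a,b\in\mathbb{Q}$, $\theta_{a,b}(z,\tau)=\sum_{m\in\mathbb{Z}}\exp\{\pi i(m+a)^2\tau+2\pi i(m+a)(z+b)\}$, and $'$ denotes derivative in $z$. Jacobi's first theta function is $\vartheta_1(z,\tau)=-\theta_{\frac12,\frac12}(z,\tau)$. Put $\theta(z)=\vartheta_1(z,\tau)$ and $G(z,\lambda)=\dfrac{\theta'(0)\theta(z+\lambda)}{\theta(z)\theta(\lambda)}$. Twisted elliptic Shibukawa-Ueno operator: for $\alpha,\beta\in\mathbb{C}$ and $\lambda\notin\mathbb{Z}+\tau\mathbb{Z}$, $\mathcal{R}^e_{\alpha,\beta}(\lambda)$ acts on meromorphic functions $f$ on $\mathbb{C}^2$ by $$\mathcal{R}^e_{\alpha,\beta}(\lambda)\cdot f(z_1,z_2)=G(z_1-z_2-2(\alpha\lambda+\beta),\lambda)\,f(z_2+2\alpha\lambda,z_1-2\alpha\lambda)-G(z_1-z_2-2(\alpha\lambda+\beta),\kappa)\,f(z_1-2\beta,z_2+2\beta).$$ Here $1/2n$ means $1/(2n)$ and $\kappa/2n$ means $\kappa/(2n)$. The space $V^e_n$ has basis $\{\psi_a\mid a\in\mathbb{Z}_n\}$, where $\psi_a(z)=\sum_{m\in\mathbb{Z},\,m\equiv a\,(n)}e^{\pi i(m-\frac{n-1}{2})^2\tau/n+2\pi i(m-\frac{n-1}{2})z}$. The tensor product $V^e_n\otimes V^e_n$ is identified with the span of the functions $\psi_a(z_1)\psi_b(z_2)$. Matrix coefficients are defined by $R(\lambda)(\psi_i\otimes\psi_j)=\sum_{k,l}R(\lambda)_{ij}^{kl}\,\psi_k\otimes\psi_l$,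 indices in $\mathbb{Z}_n$. Belavin $R$-matrix: let $\omega=e^{2\pi i/n}$, and let $S,T$ act on $\mathbb{C}^n$ with basis $\{e_a\}_{a\in\mathbb{Z}_n}$ by $Se_a=\omega^ae_a$, $Te_a=e_{a-1}$; put $I_\alpha=S^{\alpha_1}T^{\alpha_2}$ for $\alpha=(\alpha_1,\alpha_2)\in\mathbb{Z}_n\times\mathbb{Z}_n$. A Belavin $R$-matrix is an operator on $\mathbb{C}^n\otimes\mathbb{C}^n$ of the form $$R_B(\lambda)=\sum_{\alpha\in\mathbb{Z}_n\times\mathbb{Z}_n}w_\alpha(\lambda)\,I_\alpha\otimes I_\alpha^{-1},\qquad w_\alpha(\lambda)=\frac{\theta_{\frac12+\frac{\alpha_2}{n},\frac12-\frac{\alpha_1}{n}}(\lambda+\eta,\tau)}{n\,\theta_{\frac12+\frac{\alpha_2}{n},\frac12-\frac{\alpha_1}{n}}(\eta,\tau)},$$ for some parameter $\eta\in\mathbb{C}$ for which the denominators are nonzero. Two such operator-valued functions on $V\otimes V$ and $W\otimes W$ are called equivalent if, after multiplication by a nonzero scalar function of $\lambda$, they are intertwined by $g\otimes g$ for a linear isomorphism $g:V\to W$. *)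

(* Defs.v *)
From Stdlib Require Import Reals ZArith.
From Coquelicot Require Import Coquelicot.
From mathcomp Require Import ssreflect ssrfun ssrbool eqtype ssrnat seq div.
From mathcomp Require Import fintype bigop.

Set Implicit Arguments.
Unset Strict Implicit.
Unset Printing Implicit Defensive.

Local Open Scope C_scope.

Definition Cexp (z : C) : C :=
  exp (Re z) * (cos (Im z) + Ci * sin (Im z)).

Definition Cseries (u : nat -> C) : C :=
  Series (fun k => Re (u k)) + Ci * Series (fun k => Im (u k)).

(* Every two-sided series below converges absolutely as soon as [0 < Im tau],
   so cutting the sum at 0 is harmless. *)
Definition Zseries (u : Z -> C) : C :=
  Cseries (fun k => u (Z.of_nat k)) + Cseries (fun k => u (- Z.of_nat k - 1)%Z).

Definition Csum (I : finType) (F : I -> C) : C :=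
  \big[Cplus/RtoC 0]_(i : I) F i.

Definition lattice (tau z : C) : Prop :=
  exists p q : Z, z = IZR p + IZR q * tau.

Definition theta (a b : R) (z tau : C) : C :=
  Zseries (fun m : Z => let x := (IZR m + a)%R in
    Cexp (PI * Ci * (x ^ 2)%R * tau + 2%R * PI * Ci * x * (z + b))).

Definition vartheta1 (tau z : C) : C := - theta (1 / 2) (1 / 2) z tau.

Definition G (tau z lambda : C) : C :=
  C_derive (vartheta1 tau) 0 * vartheta1 tau (z + lambda)
  / (vartheta1 tau z * vartheta1 tau lambda).

(* The twisted elliptic Shibukawa-Ueno operator. *)
Definition SU (tau kappa alpha beta lambda : C) (f : C * C -> C) : C * C -> C :=
  fun z =>
    let w := z.1 - z.2 - 2%R * (alpha * lambda + beta) in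
    G tau w lambda * f (z.2 + 2%R * alpha * lambda, z.1 - 2%R * alpha * lambda)
    - G tau w kappa * f (z.1 - 2%R * beta, z.2 + 2%R * beta).

(* The image of an entire [f] under the operator is meromorphic, with possible
   poles only where the first argument of [G] lies in the period lattice; there
   the formula [SU] only has a junk value, because [/ 0 = 0].  Hence "the
   operator maps f to h" is equality outside this nowhere dense set; it
   determines [h] among continuous functions. *)
Definition SU_maps (tau kappa alpha beta lambda : C) (f h : C * C -> C) : Prop :=
  forall z : C * C,
    ~ lattice tau (z.1 - z.2 - 2%R * (alpha * lambda + beta)) ->
    SU tau kappa alpha beta lambda f z = h z.

Definition is_basis (X : Type) (I : finType) (W : (X -> C) -> Prop)
    (b : I -> X -> C) : Prop :=
  [/\ forall i, W (b i),
      forall f, W f ->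
        exists c : I -> C, forall x, f x = Csum (fun i => c i * b i x)
    & forall c : I -> C,
        (forall x, Csum (fun i => c i * b i x) = 0) -> forall i, c i = 0].

Definition tensor (f g : C -> C) : C * C -> C := fun z => f z.1 * g z.2.

(* The tensor square of a space of functions on C, as a space of functions on
   C^2: the span of the products f(z_1) g(z_2). *)
Definition tensor_square (W : (C -> C) -> Prop) (F : C * C -> C) : Prop :=
  exists (m : nat) (f g : 'I_m -> C -> C),
    (forall k, W (f k) /\ W (g k)) /\
    forall z, F z = Csum (fun k => tensor (f k) (g k) z).

Definition Ve (n : nat) (tau : C) (f : C -> C) : Prop :=
  [/\ forall z : C, ex_derive f z,
      forall z : C, f (z + 1%R) = Cpow (- 1%R) n.-1 * f z
    & forall z : C, f (z + tau) =
        Cexp (- (PI * Ci * INR n * tau) - 2%R * PI * Ci * INR n * z) * f z].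

(* The integers congruent to [a] modulo [n] are enumerated as [a + n * k]. *)
Definition psi (n : nat) (tau : C) (a : 'I_n) (z : C) : C :=
  Zseries (fun k : Z =>
    let x := (IZR (Z.of_nat a + Z.of_nat n * k) - (INR n - 1) / 2)%R in
    Cexp (PI * Ci * (x ^ 2)%R * tau / INR n + 2%R * PI * Ci * x * z)).

(* The class of [a] in Z_n is represented by [a : 'I_n],
    a vector of C^n by its coordinates, and a tensor in the tensor square of
    C^n by its coordinates in the basis (e_a (x) e_b). *)

Definition vec (n : nat) : Type := 'I_n -> C.
Definition vec2 (n : nat) : Type := 'I_n -> 'I_n -> C.

Definition e_ (n : nat) (a : 'I_n) : vec n :=
  fun c => if c == a then RtoC 1 else RtoC 0.

Definition omega (n : nat) : C := Cexp (2%R * PI * Ci / INR n).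

(* On coordinates, [T e_a = e_(a-1)] becomes [(T u)_a = u_(a+1)]; [ordS] and
   [ord_pred] are cyclic. *)
Definition S_op (n : nat) (u : vec n) : vec n := fun a => Cpow (omega n) a * u a.
Definition S_inv (n : nat) (u : vec n) : vec n := fun a => / Cpow (omega n) a * u a.
Definition T_op (n : nat) (u : vec n) : vec n := fun a => u (ordS a).
Definition T_inv (n : nat) (u : vec n) : vec n := fun a => u (ord_pred a).

Definition I_op (n : nat) (al : 'I_n * 'I_n) (u : vec n) : vec n :=
  iter al.1 (@S_op n) (iter al.2 (@T_op n) u).
Definition I_inv (n : nat) (al : 'I_n * 'I_n) (u : vec n) : vec n :=
  iter al.2 (@T_inv n) (iter al.1 (@S_inv n) u).

(* [A (x) B] for linear [A] and [B]: [B] acts on the second index, then [A] on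
   the first one. *)
Definition op_tensor (n : nat) (A B : vec n -> vec n) (w : vec2 n) : vec2 n :=
  fun c d => A (fun a => B (w a) d) c.

Definition belavin_theta (n : nat) (tau : C) (al : 'I_n * 'I_n) (z : C) : C :=
  theta (1 / 2 + INR al.2 / INR n) (1 / 2 - INR al.1 / INR n) z tau.

Definition belavin_weight (n : nat) (tau eta : C) (al : 'I_n * 'I_n)
    (lambda : C) : C :=
  belavin_theta tau al (lambda + eta) / (INR n * belavin_theta tau al eta).

Definition belavin_admissible (n : nat) (tau eta : C) : Prop :=
  forall al : 'I_n * 'I_n, belavin_theta tau al eta <> 0.

Definition belavin (n : nat) (tau eta lambda : C) (w : vec2 n) : vec2 n :=
  fun c d => Csum (fun al : 'I_n * 'I_n =>
    belavin_weight tau eta al lambda * op_tensor (I_op al) (I_inv al) w c d).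

Definition linear_iso (n : nat) (W : (C -> C) -> Prop) (g : vec n -> C -> C) :
    Prop :=
  [/\ forall u v z, g (fun a => u a + v a) z = g u z + g v z,
      forall c u z, g (fun a => c * u a) z = c * g u z,
      forall u, W (g u),
      forall u, (forall z, g u z = 0) -> forall a, u a = 0
    & forall f, W f -> exists u, forall z, g u z = f z].

(* [g (x) g] for linear [g], through the images of the basis tensors. *)
Definition map_tensor (n : nat) (g : vec n -> C -> C) (w : vec2 n) : C * C -> C :=
  fun z => Csum (fun ab : 'I_n * 'I_n =>
    w ab.1 ab.2 * tensor (g (e_ ab.1)) (g (e_ ab.2)) z).

(* [rho lambda F H] reads: the operator rho(lambda) on the tensor square of [W]
   maps [F] to [H]; [dom] is the common domain of definition in [lambda]. *)
Definition equivalent (n : nat) (dom : C -> Prop) (W : (C -> C) -> Prop)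
    (rho : C -> (C * C -> C) -> (C * C -> C) -> Prop)
    (B : C -> vec2 n -> vec2 n) : Prop :=
  exists (g : vec n -> C -> C) (s : C -> C),
    [/\ linear_iso W g,
        forall lambda, dom lambda -> s lambda <> 0
      & forall lambda, dom lambda -> forall w : vec2 n,
          rho lambda (map_tensor g w)
            (fun z => s lambda * map_tensor g (B lambda w) z)].

(* Main.v *)
From HB Require Import structures.
Require Import Defs.
From Stdlib Require Import Reals ZArith Lra Lia ClassicalEpsilon.
From Coquelicot Require Import Coquelicot.
From mathcomp Require Import ssreflect ssrfun ssrbool eqtype ssrnat seq div.
From mathcomp Require Import fintype bigop.
From mathcomp Require Import zify ssrZ.

(** Put [T z = theta_(1/2,1/2)(z, tau)], [E z = exp(2 pi i z)] and
    [F(x, y) = T'(0) T(x + y) / (T x T y)].  Everything rests on Kronecker's expansion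
      [F(x, y) = - 2 pi i sum_(a, b) ([a >= s] - [b < r]) E(a b tau + a x + b y)],
    valid when [Im y / Im tau] is in ]-s, 1-s[ and [Im x / Im tau] in ]-r, 1-r[.
    Summing over [a] and multiplying by [T y], the coefficient of [E(N y)] obeys a
    first-order recursion in [N] because [T tau = 0]; hence the product is a
    multiple of [T (x + y)].  The same identity shows that a zero of [T] off the
    lattice would spread to a whole horizontal line.

    The operator and both families of coefficients (those of the statement, at level
    [n tau], and the Belavin weights with [eta = - kappa / n], averaged over roots of
    unity) are values of [F], at [tau] or at [n tau].  For generic imaginary parts the
    identities between them compare absolutely convergent series over [Z^4] or [Z^2]
    term by term; both sides are continuous, so they hold for all parameters off the
    lattice.  The matching scalar is [T'(0) / T lambda].

    That the [psi_a] span the space of theta functions follows from Goursat's theorem,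
    which makes the Fourier coefficients of an entire function independent of the
    horizontal line, and from pointwise Fourier inversion. *)

Set Implicit Arguments.
Unset Strict Implicit.
Unset Printing Implicit Defensive.

Local Open Scope C_scope.

(** * Unordered sums *)

(** The obstacle is division: at the start the zeros of [T] are unknown, and Kronecker's identity is
    itself what locates them. It is therefore first proved multiplied out, with an undetermined
    factor depending on [x] alone; symmetry in [x] and [y] determines that factor up to a constant,
    and the behaviour at 0 gives the constant. The form of the signs is what makes the operator
    computable. In front of one and the same exponential its two terms carry [[a >= s1] - [b < r]]
    and [[- d >= s2] - [b < r]]; the part governed by [z1 - z2] cancels, and the difference
    [[a >= s1] - [d < 1 - s2]] is the sign of an expansion at level [n tau], split into residue
    classes of [a] and [d] modulo [n]. The Belavin side reaches the same series from level [tau]: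
    roots of unity select the class of [a], the characteristic [al2] gives that of [d], and the term
    [- a kappa / n] of the exponent dictates [eta]. Signs jump when an imaginary part crosses a
    multiple of [Im tau]; hence the open strips, and the passage to the limit along rays. *)

HB.instance Definition _ :=
  Monoid.isComLaw.Build C (RtoC 0) Cplus Cplus_assoc Cplus_comm Cplus_0_l.

Lemma Rplus_associative : associative Rplus.
Proof. by move=> x y z; rewrite Rplus_assoc. Qed.

HB.instance Definition _ :=
  Monoid.isComLaw.Build R 0%R Rplus Rplus_associative Rplus_comm Rplus_0_l.

Definition psum (T : eqType) (u : T -> C) (s : seq T) : C :=
  \big[Cplus/RtoC 0]_(i <- s) u i.

Definition nsum (T : eqType) (u : T -> C) (s : seq T) : R :=
  \big[Rplus/0%R]_(i <- s) Cmod (u i).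

(** Convergence along the net of finite subsets, listed without repetition, so that reindexing and
    summation by blocks cost nothing. Summability, a bound on the sums of norms, is kept apart and
    serves to produce limits. *)
Definition has_sum (T : eqType) (u : T -> C) (l : C) :=
  forall eps : R, (0 < eps)%R -> exists s0 : seq T, forall s, uniq s ->
    {subset s0 <= s} -> (Cmod (psum u s - l) < eps)%R.

Definition summable (T : eqType) (u : T -> C) :=
  exists M : R, forall s, uniq s -> (nsum u s <= M)%R.

Section Sums.
Variable T : eqType.
Implicit Types (u v : T -> C) (s : seq T).

Lemma psum_plus u v s : psum (fun i => u i + v i) s = psum u s + psum v s.
Proof. exact: big_split. Qed.

Lemma psum_scal c u s : psum (fun i => c * u i) s = c * psum u s.
Proof.
rewrite /psum; symmetry; apply: (big_morph (Cmult c)).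
  exact: Cmult_plus_distr_l.
exact: Cmult_0_r.
Qed.

Lemma Cmod_psum u s : (Cmod (psum u s) <= nsum u s)%R.
Proof.
rewrite /psum /nsum; elim: s => [|i s IH]; first by rewrite !big_nil Cmod_0; lra.
rewrite !big_cons; apply: Rle_trans (Cmod_triangle _ _) _; lra.
Qed.

Lemma nsum_ge0 u s : (0 <= nsum u s)%R.
Proof. exact: Rle_trans (Cmod_ge_0 _) (Cmod_psum u s). Qed.

Lemma perm_sub s s0 : uniq s -> uniq s0 -> {subset s0 <= s} ->
  perm_eq s (s0 ++ [seq i <- s | i \notin s0]).
Proof.
move=> us u0 sub; apply: uniq_perm => // [|i].
  rewrite cat_uniq u0 filter_uniq // andbT; apply/hasPn => i.
  by rewrite mem_filter => /andP[].
by rewrite mem_cat mem_filter; case: (boolP (i \in s0)) => //= /sub ->.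
Qed.

Lemma psum_sub u s s0 : uniq s -> uniq s0 -> {subset s0 <= s} ->
  psum u s = psum u s0 + psum u [seq i <- s | i \notin s0].
Proof. by move=> us u0 sub; rewrite /psum (perm_big _ (perm_sub us u0 sub)) big_cat. Qed.

Lemma nsum_sub u s s0 : uniq s -> uniq s0 -> {subset s0 <= s} ->
  nsum u s = (nsum u s0 + nsum u [seq i <- s | i \notin s0])%R.
Proof. by move=> us u0 sub; rewrite /nsum (perm_big _ (perm_sub us u0 sub)) big_cat. Qed.

Lemma has_sum_ext u v l : (forall i, u i = v i) -> has_sum u l -> has_sum v l.
Proof.
move=> e h eps he; have [s0 h0] := h eps he; exists s0 => s us sub.
rewrite -(_ : psum u s = psum v s); first exact: h0.
by apply: eq_bigr.
Qed.

Lemma has_sum_unique u l m : has_sum u l -> has_sum u m -> l = m.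
Proof.
move=> hl hm; apply/Ceq_minus/Cmod_eq_0.
apply: Rle_antisym; last exact: Cmod_ge_0.
apply: le_epsilon => eps he; rewrite Rplus_0_l.
have [s1 h1] := hl (eps / 2)%R ltac:(lra).
have [s2 h2] := hm (eps / 2)%R ltac:(lra).
pose s := undup (s1 ++ s2).
have us : uniq s := undup_uniq _.
have sub1 : {subset s1 <= s} by move=> i hi; rewrite mem_undup mem_cat hi.
have sub2 : {subset s2 <= s} by move=> i hi; rewrite mem_undup mem_cat hi orbT.
have := h1 s us sub1; have := h2 s us sub2.
rewrite -Cmod_opp.
have -> : l - m = - (psum u s - l) + (psum u s - m) by ring.
move=> a b; have := Cmod_triangle (- (psum u s - l)) (psum u s - m).
rewrite Cmod_opp => c; rewrite Cmod_opp in a.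
by have := Cmod_opp (psum u s - m); lra.
Qed.

Lemma has_sum_plus u v l m : has_sum u l -> has_sum v m ->
  has_sum (fun i => u i + v i) (l + m).
Proof.
move=> hl hm eps he.
have [s1 h1] := hl (eps / 2)%R ltac:(lra).
have [s2 h2] := hm (eps / 2)%R ltac:(lra).
exists (s1 ++ s2) => s us sub.
have sub1 : {subset s1 <= s} by move=> i hi; apply: sub; rewrite mem_cat hi.
have sub2 : {subset s2 <= s} by move=> i hi; apply: sub; rewrite mem_cat hi orbT.
have := h1 s us sub1; have := h2 s us sub2; rewrite psum_plus.
have -> : psum u s + psum v s - (l + m) = (psum u s - l) + (psum v s - m) by ring.
move=> a b; have := Cmod_triangle (psum u s - l) (psum v s - m); lra.
Qed.

Lemma has_sum_scal c u l : has_sum u l -> has_sum (fun i => c * u i) (c * l).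
Proof.
move=> hl eps he; have p : (0 < Cmod c + 1)%R by have := Cmod_ge_0 c; lra.
have [s1 h1] := hl (eps / (Cmod c + 1))%R (Rdiv_lt_0_compat _ _ he p).
exists s1 => s us sub; rewrite psum_scal.
have -> : c * psum u s - c * l = c * (psum u s - l) by ring.
rewrite Cmod_mult; have := h1 s us sub; have := Cmod_ge_0 (psum u s - l).
move: (Cmod _) => x; have := Cmod_ge_0 c; move: (Cmod c) p => k p k0 x0 hx.
apply: (Rle_lt_trans _ ((k + 1) * x)); first nra.
have -> : eps = ((k + 1) * (eps / (k + 1)))%R by field; lra.
exact: Rmult_lt_compat_l.
Qed.

Lemma has_sum_scalr c u l : has_sum u l -> has_sum (fun i => u i * c) (l * c).
Proof.
move=> h; rewrite Cmult_comm; apply: has_sum_ext (has_sum_scal c h) => i.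
exact: Cmult_comm.
Qed.

Lemma summable_le (S : eqType) (v : S -> C) u K : summable v ->
  forall f : T -> S, injective f -> (0 <= K)%R ->
  (forall i, Cmod (u i) <= K * Cmod (v (f i)))%R -> summable u.
Proof.
move=> [M hM] f inj hK hle; exists (K * M)%R => s us.
apply: Rle_trans (Rmult_le_compat_l _ _ _ hK (hM (map f s) _)); last by rewrite map_inj_uniq.
rewrite /nsum big_map; elim: s {us} => [|i s IH]; first by rewrite !big_nil; lra.
by rewrite !big_cons; have := hle i; lra.
Qed.

Lemma summable_ext u v : (forall i, u i = v i) -> summable u -> summable v.
Proof.
move=> e h; apply: (summable_le (K := 1%R) h (f := id)) => //; first lra.
by move=> i; rewrite e; lra.
Qed.

Lemma summable_dom u v K : summable v -> (0 <= K)%R ->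
  (forall i, Cmod (u i) <= K * Cmod (v i))%R -> summable u.
Proof. by move=> h hK hle; apply: (summable_le h (f := id)) hle. Qed.

Lemma summable_scal c u : summable u -> summable (fun i => c * u i).
Proof.
move=> h; apply: (summable_dom h (Cmod_ge_0 c)) => i; rewrite Cmod_mult; lra.
Qed.

Lemma summable_sup u : summable u -> exists M : R,
  (forall s, uniq s -> (nsum u s <= M)%R) /\
  (forall eps, (0 < eps)%R -> exists2 s, uniq s & (M - eps < nsum u s)%R).
Proof.
move=> [M0 hM0].
pose A x := exists2 s, uniq s & x = nsum u s.
have bA : bound A by exists M0 => x [s us ->]; exact: hM0.
have nA : exists x, A x by exists (nsum u [::]); exists [::].
have [M [ub lub]] := completeness A bA nA.
exists M; split=> [s us|eps he]; first by apply: ub; exists s.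
apply: NNPP => hn.
have : (M <= M - eps)%R.
  apply: lub => x [s us ->]; case: (Rle_lt_dec (nsum u s) (M - eps)) => // h.
  by case: hn; exists s.
lra.
Qed.

Lemma summable_tail u eps : summable u -> (0 < eps)%R ->
  exists2 s0, uniq s0 & forall s, uniq s -> (forall i, i \in s -> i \notin s0) ->
    (nsum u s < eps)%R.
Proof.
move=> /summable_sup [M [h1 h2]] he.
have [s0 us0 hs0] := h2 eps he; exists s0 => // s us dis.
have := h1 (s0 ++ s); rewrite cat_uniq us0 us /= andbT => h.
have {h} := h _.
rewrite /nsum big_cat /= -/(nsum u s0) -/(nsum u s).
set b := ~~ _; have -> : b by apply/hasPn => i /dis.
by move=> /(_ isT); lra.
Qed.

(** The conditions of containing a given finite list generate a proper filter, along which the tail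
    bound makes partial sums Cauchy. Completeness of [R] is applied to the real and the imaginary
    part. *)
Lemma summable_has_sum u : summable u -> exists l, has_sum u l.
Proof.
move=> hs.
pose F (P : seq T -> Prop) := exists s0, forall s, uniq s -> {subset s0 <= s} -> P s.
have FF : ProperFilter F.
  split; last split.
  - move=> P [s0 h]; exists (undup s0); apply: h; first exact: undup_uniq.
    by move=> i; rewrite mem_undup.
  - by exists [::].
  - move=> P Q [s1 h1] [s2 h2]; exists (s1 ++ s2) => s us sub; split.
      by apply: h1 => // i hi; apply: sub; rewrite mem_cat hi.
    by apply: h2 => // i hi; apply: sub; rewrite mem_cat hi orbT.
  - by move=> P Q hPQ [s0 h]; exists s0 => s us sub; apply/hPQ/h.
have key (eps : posreal) : exists s0, forall s, uniq s -> {subset s0 <= s} ->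
    (Cmod (psum u s - psum u s0) < eps / 2)%R.
  have e2 : (0 < eps / 2)%R by have := cond_pos eps; lra.
  have [s0 us0 h0] := summable_tail hs e2; exists s0 => s us sub.
  rewrite (psum_sub _ us us0 sub).
  have -> : forall a b : C, a + b - a = b by move=> a b; ring.
  apply: Rle_lt_trans (Cmod_psum _ _) _; apply: h0; first exact: filter_uniq.
  by move=> i; rewrite mem_filter => /andP[].
have ex (p : C -> R) : (forall x y : C, p (x - y)%C = p x - p y)%R ->
    (forall x, Rabs (p x) <= Cmod x)%R ->
    exists l, filterlim (fun s => p (psum u s)) F (locally l).
  move=> hp hb; apply/(filterlim_locally_cauchy (fun s => p (psum u s))) => eps.
  have [s0 h0] := key eps.
  exists (fun s => uniq s /\ {subset s0 <= s}); split; first by exists s0.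
  move=> s s' [us sub] [us' sub'].
  rewrite /ball /= /AbsRing_ball /abs /minus /plus /opp /=.
  have -> : (p (psum u s') + - p (psum u s))%R
    = (p (psum u s' - psum u s0)%C - p (psum u s - psum u s0)%C)%R by rewrite !hp; lra.
  have := hb (psum u s' - psum u s0); have := hb (psum u s - psum u s0).
  have := h0 s us sub; have := h0 s' us' sub'.
  by split_Rabs; lra.
have [lr hr] := ex Re (fun x y => erefl) re_le_Cmod.
have [li hi] := ex Im (fun x y => erefl)
  (fun x => Rle_trans _ _ _ (Rmax_r _ _) (Rmax_Cmod x)).
exists (lr, li) => eps he.
have he2 : (0 < eps / 2)%R by lra.
have /= [s1 h1] := (proj1 (filterlim_locally _ _) hr (mkposreal _ he2)).
have /= [s2 h2] := (proj1 (filterlim_locally _ _) hi (mkposreal _ he2)).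
exists (s1 ++ s2) => s us sub.
have {}h1 : ball lr (eps / 2)%R (Re (psum u s)).
  by apply: h1 => // i h; apply: sub; rewrite mem_cat h.
have {}h2 : ball li (eps / 2)%R (Im (psum u s)).
  by apply: h2 => // i h; apply: sub; rewrite mem_cat h orbT.
move: h1 h2; rewrite /ball /= /AbsRing_ball /abs /minus /plus /opp /=.
move: (psum u s) => [a b] /= h1 h2.
apply: Rle_lt_trans (_ : _ <= Rabs (a + - lr) + Rabs (b + - li))%R _; last lra.
have -> : (a, b) - (lr, li) = RtoC (a + - lr)%R + Ci * RtoC (b + - li)%R.
  by rewrite /Cminus /Cplus /Cmult /Copp /Ci /RtoC /=; congr pair; ring.
apply: Rle_trans (Cmod_triangle _ _) _.
by rewrite Cmod_mult Cmod_Ci !Cmod_R Rmult_1_l; lra.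
Qed.

Lemma has_sum_bij (S : eqType) (f : S -> T) (g : T -> S) u l :
  cancel f g -> cancel g f -> has_sum u l -> has_sum (fun i => u (f i)) l.
Proof.
move=> fg gf h eps he; have [s0 h0] := h eps he.
exists (map g s0) => s us sub.
rewrite (_ : psum _ s = psum u (map f s)); last by rewrite /psum big_map.
apply: h0; first by rewrite map_inj_uniq //; apply: can_inj fg.
move=> i hi; rewrite -(gf i); apply: map_f; apply: sub; exact: map_f.
Qed.

Lemma has_sum_lim_le u l l' eps : has_sum u l -> (0 < eps)%R ->
  (exists s0, forall s, uniq s -> {subset s0 <= s} -> Cmod (psum u s - l') < eps)%R ->
  (Cmod (l - l') <= eps)%R.
Proof.
move=> h he [s1 h1]; apply: le_epsilon => d hd.
have [s2 h2] := h d hd.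
pose s := undup (s1 ++ s2).
have us : uniq s := undup_uniq _.
have sub1 : {subset s1 <= s} by move=> i hi; rewrite mem_undup mem_cat hi.
have sub2 : {subset s2 <= s} by move=> i hi; rewrite mem_undup mem_cat hi orbT.
have := h1 s us sub1; have := h2 s us sub2.
have -> : l - l' = - (psum u s - l) + (psum u s - l') by ring.
have := Cmod_triangle (- (psum u s - l)) (psum u s - l').
rewrite Cmod_opp; lra.
Qed.

Lemma has_sum_big (I : eqType) (r : seq I) (F : I -> T -> C) (L : I -> C) :
  (forall i, has_sum (F i) (L i)) ->
  has_sum (fun t => psum (F ^~ t) r) (psum L r).
Proof.
move=> h; elim: r => [|i r IH].
  move=> eps he; exists [::] => s _ _.
  have -> : psum (fun t => psum (F^~ t) [::]) s = 0.
    rewrite {1}/psum big1 //.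
    by move=> t _; rewrite /psum big_nil.
  by rewrite /psum big_nil; rewrite (_ : 0 - 0 = 0) ?Cmod_0 //; ring.
rewrite {2}/psum big_cons -/(psum L r).
apply: has_sum_ext (has_sum_plus (h i) IH) => t.
by rewrite [in RHS]/psum big_cons.
Qed.

Lemma has_sum_Cmod_le u l M : has_sum u l -> (forall s, uniq s -> (nsum u s <= M)%R) ->
  (Cmod l <= M)%R.
Proof.
move=> h hM; apply: le_epsilon => d hd.
have [s0 h0] := h d hd.
have us : uniq (undup s0) := undup_uniq _.
have := h0 (undup s0) us _; rewrite -Cmod_opp => {}h0.
have {}h0 : (Cmod (- (psum u (undup s0) - l)) < d)%R.
  by apply: h0 => i; rewrite mem_undup.
have := Cmod_triangle (psum u (undup s0)) (- (psum u (undup s0) - l)).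
have -> : psum u (undup s0) + - (psum u (undup s0) - l) = l by ring.
have := hM _ us; have := Cmod_psum u (undup s0); lra.
Qed.

End Sums.

(** Once [A] contains the first projections of [s0], the sum over [A] of the fibre sums is a limit
    of sums over rectangles [A x B], and these contain [s0] as soon as [B] contains its second
    projections. *)
Lemma has_sum_fubini (S T : eqType) (u : S * T -> C) (v : S -> C) l :
  has_sum u l -> (forall i, has_sum (fun j => u (i, j)) (v i)) -> has_sum v l.
Proof.
move=> h hv eps he; have e2 : (0 < eps / 2)%R by lra.
have [s0 h0] := h (eps / 2)%R e2.
exists (map fst s0) => A uA subA.
have hB := has_sum_big A hv.
apply: Rle_lt_trans (_ : _ <= eps / 2)%R _; last lra.
apply: (has_sum_lim_le hB e2); exists (map snd s0) => B uB subB.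
rewrite (_ : psum _ B = psum u [seq (i, j) | i <- A, j <- B]); last first.
  by rewrite /psum big_allpairs exchange_big.
apply: h0.
  by apply: allpairs_uniq => //; move=> [a b] [c d] _ _ /= [-> ->].
move=> [i j] hij; apply/allpairsP; exists (i, j); split=> //=.
  by apply: subA; apply/mapP; exists (i, j).
by apply: subB; apply/mapP; exists (i, j).
Qed.

Lemma has_sum_fin (I : finType) (u : I -> C) : has_sum u (Csum u).
Proof.
move=> eps he; exists (enum I) => s us sub.
have -> : psum u s = Csum u.
  rewrite /psum /Csum -[RHS]big_enum; apply: perm_big; apply: uniq_perm => //.
    exact: enum_uniq.
  by move=> i; rewrite mem_enum (sub i) ?mem_enum ?inE.
by rewrite (_ : _ - _ = 0) ?Cmod_0 //; ring.
Qed.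

Lemma summable_prod (S T : eqType) (u : S -> C) (v : T -> C) :
  summable u -> summable v -> summable (fun p : S * T => u p.1 * v p.2).
Proof.
move=> [M hM] [N hN]; exists (M * N)%R => s us.
set w := fun p : S * T => u p.1 * v p.2.
pose A := undup (map fst s); pose B := undup (map snd s).
have uA : uniq A := undup_uniq _. have uB : uniq B := undup_uniq _.
pose P := [seq (i, j) | i <- A, j <- B].
have uP : uniq P by apply: allpairs_uniq => //; move=> [a b] [c d] _ _ /= [-> ->].
have sub : {subset s <= P}.
  move=> [i j] hij; apply/allpairsP; exists (i, j); split=> //=; rewrite mem_undup.
    by apply/mapP; exists (i, j).
  by apply/mapP; exists (i, j).
apply: Rle_trans (_ : _ <= nsum w P)%R _.
  rewrite (nsum_sub _ uP us sub); have := nsum_ge0 w [seq i <- P | i \notin s].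
  lra.
have -> : nsum w P = (nsum u A * nsum v B)%R.
  rewrite /nsum big_allpairs /=.
  rewrite (big_morph (fun x => x * nsum v B)%R (id1 := 0%R) (op1 := Rplus)); first last.
  - by rewrite Rmult_0_l.
  - by move=> x y; rewrite Rmult_plus_distr_r.
  apply: eq_bigr => i _.
  rewrite /nsum (big_morph (Rmult (Cmod (u i))) (id1 := 0%R) (op1 := Rplus)); first last.
  - by rewrite Rmult_0_r.
  - by move=> x y; rewrite Rmult_plus_distr_l.
  by apply: eq_bigr => j _; rewrite Cmod_mult.
apply: Rmult_le_compat; [exact: nsum_ge0|exact: nsum_ge0|exact: hM|exact: hN].
Qed.

(** Summability of the product only yields some sum; computing it fibre by fibre identifies it with
    [l * m]. *)
Lemma has_sum_prod (S T : eqType) (u : S -> C) (v : T -> C) l m :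
  summable u -> summable v -> has_sum u l -> has_sum v m ->
  has_sum (fun p : S * T => u p.1 * v p.2) (l * m).
Proof.
move=> su sv hu hv; have [L hL] := summable_has_sum (summable_prod su sv).
have := has_sum_fubini hL (v := fun i => u i * m).
move=> /(_ (fun i => has_sum_scal (u i) hv)) h.
by rewrite (has_sum_unique (has_sum_scalr m hu) h).
Qed.

Lemma summable_comp (S T : eqType) (f : S -> T) (u : T -> C) :
  injective f -> summable u -> summable (fun i => u (f i)).
Proof.
move=> inj h; apply: (summable_le (K := 1%R) h inj); first lra.
by move=> i; lra.
Qed.

Lemma summable_fin (I : finType) (u : I -> C) : summable u.
Proof.
exists (nsum u (enum I)) => s us.
rewrite (nsum_sub u (enum_uniq I) us); last by move=> i _; rewrite mem_enum inE.
rewrite -[X in (X <= _)%R]Rplus_0_r; apply: Rplus_le_compat_l; exact: nsum_ge0.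
Qed.

(** * From unordered sums to one-sided and two-sided series *)

Lemma nat_has_sum_Cseries (u : nat -> C) l : has_sum u l -> Cseries u = l.
Proof.
move=> h.
have hs (p : C -> R) : (forall x y : C, p (x + y)%C = p x + p y)%R ->
    (forall x, Rabs (p x) <= Cmod x)%R -> p (RtoC 0) = 0%R ->
    Series (fun k => p (u k)) = p l.
  move=> hp hb p0; apply: is_series_unique; apply/filterlim_locally => eps.
  have [s0 h0] := h eps (cond_pos eps).
  exists (foldr maxn 0%N s0) => N hN.
  have -> : sum_n (fun k => p (u k)) N = p (psum u (iota 0 N.+1)).
    elim: N {hN} => [|N IH].
      by rewrite sum_O /psum /= big_cons big_nil Cplus_0_r.
    rewrite sum_Sn IH -[N.+2]addn1 iotaD /psum big_cat.
    by rewrite (_ : iota (0 + N.+1) 1 = [:: N.+1]) // big_seq1 hp.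
  rewrite /ball /= /AbsRing_ball /abs /minus /plus /opp /=.
  have e : (p (psum u (iota 0 N.+1)) + - p l)%R = p (psum u (iota 0 N.+1) - l).
    have := hp (psum u (iota 0 N.+1) - l) l.
    have -> : forall a b : C, a - b + b = a by move=> a b; ring.
    lra.
  rewrite -[X in Rabs (X + _)]/(p (psum u (iota 0 N.+1))) e.
  apply: Rle_lt_trans (hb _) _; apply: h0; first exact: iota_uniq.
  move=> i hi; rewrite mem_iota add0n ltnS.
  have : (i <= foldr maxn 0 s0)%N.
    elim: (s0) hi => //= a s IH; rewrite inE => /orP[/eqP->|/IH]; lia.
  lia.
rewrite /Cseries (hs Re) ?(hs Im) //.
- by case: (l) => a b; rewrite /Cplus /Cmult /Ci /RtoC /=; congr pair; ring.
- by move=> x; apply: Rle_trans (Rmax_r _ _) (Rmax_Cmod x).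
- exact: re_le_Cmod.
Qed.

(** Cuts [Z] at 0 exactly as [Zseries] does: [(true, k)] stands for [- k - 1]. *)
Definition Zfold (m : Z) : bool * nat :=
  if (0 <=? m)%Z then (false, Z.to_nat m) else (true, Z.to_nat (- m - 1)).
Definition Zunfold (p : bool * nat) : Z :=
  if p.1 then (- Z.of_nat p.2 - 1)%Z else Z.of_nat p.2.

Lemma ZfoldK : cancel Zfold Zunfold.
Proof. by move=> m; rewrite /Zfold /Zunfold; case: (Z.leb_spec 0 m) => h /=; lia. Qed.

Lemma ZunfoldK : cancel Zunfold Zfold.
Proof.
by move=> [[] k]; rewrite /Zfold /Zunfold /=; case: Z.leb_spec => h; congr pair; lia.
Qed.

Lemma Z_has_sum (u : Z -> C) l : summable u -> has_sum u l -> Zseries u = l.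
Proof.
move=> su hl; rewrite /Zseries.
have i1 : injective Z.of_nat by move=> a b; lia.
have i2 : injective (fun k => - Z.of_nat k - 1)%Z by move=> a b; lia.
have [l1 h1] := summable_has_sum (summable_comp i1 su).
have [l2 h2] := summable_has_sum (summable_comp i2 su).
rewrite (nat_has_sum_Cseries h1) (nat_has_sum_Cseries h2).
pose v (b : bool) := if b then l2 else l1.
have := has_sum_fubini (has_sum_bij ZunfoldK ZfoldK hl) (v := v) _.
move=> /(_ ltac:(by move=> [])) h.
rewrite (has_sum_unique h (has_sum_fin v)) /Csum.
by rewrite big_bool /= Cplus_comm.
Qed.

Lemma exp_le_mono x y : (x <= y -> exp x <= exp y)%R.
Proof.
by case=> [/exp_increasing|->]; [exact: Rlt_le|exact: Rle_refl].
Qed.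

Lemma summable_geom c : (0 < c)%R -> summable (fun k : nat => RtoC (exp (- (c * INR k)))).
Proof.
move=> hc; pose r := exp (- c).
have r0 : (0 < r)%R := exp_pos _.
have r1 : (r < 1)%R by rewrite /r -exp_0; apply: exp_increasing; lra.
have re k : Cmod (RtoC (exp (- (c * INR k)))) = (r ^ k)%R.
  rewrite Cmod_R Rabs_pos_eq; last exact/Rlt_le/exp_pos.
  elim: k => [|k IH]; first by rewrite /= Rmult_0_r Ropp_0 exp_0.
  by rewrite S_INR -tech_pow_Rmult -IH /r -exp_plus; congr exp; ring.
exists (/ (1 - r))%R => s us.
pose N := (foldr maxn 0%N s).+1.
have sub : {subset s <= iota 0 N}.
  move=> i hi; rewrite mem_iota add0n ltnS.
  by elim: (s) hi => //= a s' IH; rewrite inE => /orP[/eqP->|/IH]; lia.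
have := nsum_sub (fun k : nat => RtoC (exp (- (c * INR k)))) (iota_uniq 0 N) us sub.
have := nsum_ge0 (fun k : nat => RtoC (exp (- (c * INR k)))) [seq i <- iota 0 N | i \notin s].
suff : (nsum (fun k : nat => RtoC (exp (- (c * INR k)))) (iota 0 N) <= / (1 - r))%R by lra.
have -> : nsum (fun k : nat => RtoC (exp (- (c * INR k)))) (iota 0 N) = ((1 - r ^ N) / (1 - r))%R.
  elim: (N) => [|m IH]; first by rewrite /nsum big_nil /=; field; lra.
  rewrite -addn1 iotaD /nsum big_cat /= -/(nsum _ _) IH big_cons big_nil re add0n.
  by rewrite addn1 /=; field; lra.
rewrite /Rdiv -[X in (_ <= X)%R]Rmult_1_l; apply: Rmult_le_compat_r.
  by apply/Rlt_le/Rinv_0_lt_compat; lra.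
have := pow_le r N (Rlt_le _ _ r0); lra.
Qed.

Lemma summable_Zgeom c : (0 < c)%R ->
  summable (fun m : Z => RtoC (exp (- (c * Rabs (IZR m))))).
Proof.
move=> hc; have h := summable_prod (summable_fin (fun b : bool => RtoC 1)) (summable_geom hc).
have inj : injective Zfold := can_inj ZfoldK.
apply: (summable_le (K := 1%R) h inj); first lra.
move=> m; rewrite Cmult_1_l !Cmod_R !(Rabs_pos_eq (exp _)); try exact/Rlt_le/exp_pos.
rewrite Rmult_1_l; apply: exp_le_mono; rewrite INR_IZR_INZ /Zfold.
apply/Ropp_le_contravar/Rmult_le_compat_l; first lra.
case: Z.leb_spec => hm /=.
  rewrite Z2Nat.id; last lia.
  rewrite Rabs_pos_eq; first lra.
  by apply: IZR_le; lia.
rewrite Z2Nat.id; last lia.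
rewrite Rabs_left; last by apply: IZR_lt; lia.
by rewrite minus_IZR opp_IZR; lra.
Qed.

(** * Exponentials and complex differentiability *)

Lemma Cmod_Cexp z : Cmod (Cexp z) = exp (Re z).
Proof.
rewrite /Cexp Cmod_mult Cmod_R Rabs_pos_eq; last exact/Rlt_le/exp_pos.
suff -> : Cmod (cos (Im z) + Ci * sin (Im z)) = 1%R by rewrite Rmult_1_r.
rewrite /Cmod /Cplus /Cmult /Ci /RtoC /= -[RHS]sqrt_1; congr sqrt.
have := sin2_cos2 (Im z); rewrite /Rsqr; nra.
Qed.

Lemma Cexp_plus a b : Cexp (a + b) = Cexp a * Cexp b.
Proof.
rewrite /Cexp; case: a => a1 a2; case: b => b1 b2 /=.
rewrite exp_plus cos_plus sin_plus /Cmult /Cplus /Ci /RtoC /=.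
by congr pair; ring.
Qed.

Lemma Cexp_0 : Cexp 0 = 1.
Proof. by rewrite /Cexp /= exp_0 cos_0 sin_0; ring. Qed.

(** The exponential of period 1, locked so that simplification and [ring] treat it as an atom
    instead of unfolding it into real and imaginary parts. *)
HB.lock Definition E (z : C) : C := Cexp (2 * PI * Ci * z).

Lemma E_Cexp z : E z = Cexp (2 * PI * Ci * z).
Proof. by rewrite E.unlock. Qed.

Lemma Re_E_exponent z : Re (2 * PI * Ci * z) = (- (2 * PI * Im z))%R.
Proof. by case: z => a b; rewrite /Re /Im /Cmult /Ci /RtoC /=; ring. Qed.

Lemma Cmod_E z : Cmod (E z) = exp (- (2 * PI * Im z)).
Proof. by rewrite E_Cexp Cmod_Cexp Re_E_exponent. Qed.

Lemma E_plus a b : E (a + b) = E a * E b.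
Proof. by rewrite !E_Cexp Cmult_plus_distr_l Cexp_plus. Qed.

Lemma E_0 : E 0 = 1.
Proof. by rewrite E_Cexp Cmult_0_r Cexp_0. Qed.

Lemma E_neq0 z : E z <> 0.
Proof. by move=> h; have := Cmod_E z; rewrite h Cmod_0; have := exp_pos (- (2 * PI * Im z)); lra. Qed.

Lemma E_opp z : E (- z) = / E z.
Proof.
have h : E (- z) * E z = 1 by rewrite -E_plus -E_0; congr E; ring.
rewrite -[RHS]Cmult_1_l -h -Cmult_assoc Cinv_r ?Cmult_1_r //; exact: E_neq0.
Qed.

Lemma E_real (x : R) : E x = (cos (2 * PI * x), sin (2 * PI * x)).
Proof.
rewrite E_Cexp /Cexp.
have -> : 2 * PI * Ci * x = (0, 2 * PI * x)%R.
  by rewrite /Cmult /Ci /RtoC /=; congr pair; ring.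
by rewrite /= exp_0 /Cmult /Cplus /Ci /RtoC /=; congr pair; ring.
Qed.

Lemma E_1 : E 1 = 1.
Proof.
by rewrite E_real Rmult_1_r cos_2PI sin_2PI.
Qed.

Lemma E_half : E (1 / 2) = - (1).
Proof.
have -> : 1 / 2 = RtoC (1 / 2) by rewrite RtoC_div //; lra.
rewrite E_real (_ : 2 * PI * (1 / 2) = PI)%R; last by field.
by rewrite cos_PI sin_PI /Copp /RtoC /= Ropp_0.
Qed.

Lemma E_Z (k : Z) : E (IZR k) = 1.
Proof.
elim/Z.peano_ind: k => [|k IH|k IH]; first exact: E_0.
  by rewrite succ_IZR RtoC_plus E_plus IH E_1 Cmult_1_l.
rewrite -Z.sub_1_r minus_IZR RtoC_minus /Cminus E_plus E_opp IH E_1.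
by field.
Qed.

Lemma E_periodic z (k : Z) : E (z + IZR k) = E z.
Proof. by rewrite E_plus E_Z Cmult_1_r. Qed.

Lemma E_eq1 z : E z = 1 -> exists k : Z, z = IZR k.
Proof.
move=> h.
have iz : Im z = 0%R.
  have := Cmod_E z; rewrite h Cmod_1 -exp_0 => /exp_inv e.
  have := PI_RGT_0 => p; nra.
have ez : z = RtoC (Re z) by case: z iz {h} => a b /= ->.
move: h; rewrite ez E_real; move: (Re z) => x.
rewrite /RtoC => -[c s].
have : sin (PI * x) = 0%R.
  have := cos_2a_sin (PI * x).
  have -> : (2 * (PI * x) = 2 * PI * x)%R by ring.
  by rewrite c => h; nra.
move=> /sin_eq_0_0 [k hk]; exists k; congr RtoC.
apply: (Rmult_eq_reg_l PI); last by have := PI_RGT_0; lra.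
by rewrite hk; ring.
Qed.

Lemma Cmod_components z : (Cmod z <= Rabs (Re z) + Rabs (Im z))%R.
Proof.
have {1}-> : z = RtoC (Re z) + Ci * RtoC (Im z).
  by case: z => a b; rewrite /Cplus /Cmult /Ci /RtoC /=; congr pair; ring.
apply: Rle_trans (Cmod_triangle _ _) _.
by rewrite Cmod_mult Cmod_Ci !Cmod_R; lra.
Qed.

Lemma im_le_Cmod z : (Rabs (Im z) <= Cmod z)%R.
Proof. by apply: Rle_trans (Rmax_r _ _) (Rmax_Cmod z). Qed.

Lemma MVT_bound (f df : R -> R) M :
  (forall t, (0 <= t <= 1)%R -> is_derive f t (df t) /\ (Rabs (df t) <= M)%R) ->
  (Rabs (f 1 - f 0) <= M)%R.
Proof.
move=> h.
have [||c [hc ->]] := MVT_gen f 0 1 df.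
- move=> t; rewrite Rmin_left ?Rmax_right; try lra; move=> ht.
  by apply: (proj1 (h t _)); lra.
- move=> t; rewrite Rmin_left ?Rmax_right; try lra; move=> ht.
  apply: derivable_continuous_pt; exists (df t).
  by apply/is_derive_Reals/(proj1 (h t _)).
- move: hc; rewrite Rmin_left ?Rmax_right; try lra; move=> hc.
  by rewrite Rminus_0_r Rmult_1_r; apply: (proj2 (h c _)).
Qed.

(** Mean value theorem along [t |-> Cexp (t * w)], for the real and the imaginary part in turn;
    adding the two bounds gives the factor 2. *)
Lemma Cexp_sub1 w : (Cmod (Cexp w - 1) <= 2 * Cmod w * exp (Cmod w))%R.
Proof.
apply: Rle_trans (Cmod_components _) _.
have key (p : C -> R) : (forall x, Rabs (p x) <= Cmod x)%R ->
    (forall x y : C, p (x - y)%C = p x - p y)%R ->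
    (forall t : R, is_derive (fun t : R => p (Cexp (t * w))) t (p (w * Cexp (t * w)))) ->
    (Rabs (p (Cexp w - 1)%C) <= Cmod w * exp (Cmod w))%R.
  move=> hp hm hd.
  have := MVT_bound (f := fun t : R => p (Cexp (t * w))) (df := fun t : R => p (w * Cexp (t * w)))
    (M := (Cmod w * exp (Cmod w))%R).
  rewrite Cmult_1_l Cmult_0_l Cexp_0 -hm; apply=> t ht; split; first exact: hd.
  apply: Rle_trans (hp _) _; rewrite Cmod_mult Cmod_Cexp.
  apply: Rmult_le_compat_l; first exact: Cmod_ge_0.
  apply: exp_le_mono; rewrite re_scal_l.
  have := re_le_Cmod w; have := Cmod_ge_0 w; split_Rabs; nra.
have h1 := key Re re_le_Cmod (fun x y => erefl) _.
have h2 := key Im im_le_Cmod (fun x y => erefl) _.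
have {}h1 : (Rabs (Re (Cexp w - 1)) <= Cmod w * exp (Cmod w))%R.
  apply: h1 => t; case: (w) => a b; rewrite /Re /Im /Cexp /Cmult /Cplus /Ci /RtoC /=.
  by auto_derive => //; rewrite /Rminus !(Rmult_0_l, Rmult_0_r, Ropp_0, Rplus_0_r); ring.
have {}h2 : (Rabs (Im (Cexp w - 1)) <= Cmod w * exp (Cmod w))%R.
  apply: h2 => t; case: (w) => a b; rewrite /Re /Im /Cexp /Cmult /Cplus /Ci /RtoC /=.
  by auto_derive => //; rewrite /Rminus !(Rmult_0_l, Rmult_0_r, Ropp_0, Rplus_0_r); ring.
lra.
Qed.

(** The derivative of [Cexp (t * w) - t * w] in [t] is [w * (Cexp (t * w) - 1)], which the
    first-order estimate controls; adding the two components brings a second factor 2. *)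
Lemma Cexp_sub1_lin w :
  (Cmod (Cexp w - 1 - w) <= 4 * (Cmod w * Cmod w) * exp (Cmod w))%R.
Proof.
apply: Rle_trans (Cmod_components _) _.
have key (p : C -> R) : (forall x, Rabs (p x) <= Cmod x)%R ->
    (forall x y : C, p (x - y)%C = p x - p y)%R ->
    (forall t : R, is_derive (fun t : R => p (Cexp (t * w) - t * w)) t
       (p (w * (Cexp (t * w) - 1)))) ->
    (Rabs (p (Cexp w - 1 - w)%C) <= 2 * (Cmod w * Cmod w) * exp (Cmod w))%R.
  move=> hp hm hd.
  have := MVT_bound (f := fun t : R => p (Cexp (t * w) - t * w))
    (df := fun t : R => p (w * (Cexp (t * w) - 1)))
    (M := (2 * (Cmod w * Cmod w) * exp (Cmod w))%R).
  rewrite Cmult_1_l Cmult_0_l Cexp_0 -hm.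
  have -> : Cexp w - w - (1 - 0) = Cexp w - 1 - w by ring.
  apply=> t ht; split; first exact: hd.
  apply: Rle_trans (hp _) _; rewrite Cmod_mult.
  have := Cexp_sub1 (t * w); rewrite Cmod_mult Cmod_R Rabs_pos_eq; last lra.
  move=> h; have w0 := Cmod_ge_0 w.
  have : (2 * (t * Cmod w) * exp (t * Cmod w) <= 2 * Cmod w * exp (Cmod w))%R.
    apply: Rmult_le_compat; try nra; first exact/Rlt_le/exp_pos.
    by apply: exp_le_mono; nra.
  nra.
have h1 := key Re re_le_Cmod (fun x y => erefl) _.
have h2 := key Im im_le_Cmod (fun x y => erefl) _.
have {}h1 : (Rabs (Re (Cexp w - 1 - w)) <= 2 * (Cmod w * Cmod w) * exp (Cmod w))%R.
  apply: h1 => t; case: (w) => a b; rewrite /Re /Im /Cexp /Cminus /Copp /Cmult /Cplus /Ci /RtoC /=.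
  by auto_derive => //; rewrite /Rminus !(Rmult_0_l, Rmult_0_r, Ropp_0, Rplus_0_r); ring.
have {}h2 : (Rabs (Im (Cexp w - 1 - w)) <= 2 * (Cmod w * Cmod w) * exp (Cmod w))%R.
  apply: h2 => t; case: (w) => a b; rewrite /Re /Im /Cexp /Cminus /Copp /Cmult /Cplus /Ci /RtoC /=.
  by auto_derive => //; rewrite /Rminus !(Rmult_0_l, Rmult_0_r, Ropp_0, Rplus_0_r); ring.
lra.
Qed.

(** * Complex derivatives in epsilon form and termwise differentiation *)

Definition cderiv (f : C -> C) (z l : C) :=
  forall eps : R, (0 < eps)%R -> exists2 d : R, (0 < d)%R &
    forall h, (Cmod h < d)%R -> (Cmod (f (z + h) - f z - h * l)%C <= eps * Cmod h)%R.

Definition ccont (f : C -> C) (z : C) :=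
  forall eps : R, (0 < eps)%R -> exists2 d : R, (0 < d)%R &
    forall h, (Cmod h < d)%R -> (Cmod (f (z + h) - f z)%C < eps)%R.

Lemma cderiv_is_derive f z l : cderiv f z l -> is_derive f z l.
Proof.
move=> hf; split; first exact: is_linear_scal_l.
move=> x hx eps; have -> : x = z.
  by symmetry; exact: (is_filter_lim_locally_unique _ _ hx).
have [d hd h] := hf eps (cond_pos eps).
exists (mkposreal d hd) => y hy.
have := h (y - z) hy.
have -> : z + (y - z) = y by ring.
by [].
Qed.

Lemma is_derive_cderiv f z l : is_derive f z l -> cderiv f z l.
Proof.
move=> [_ hf] eps he.
have [d h] := hf z (fun P hP => hP) (mkposreal eps he).
exists d; first exact: cond_pos.
move=> k hk; have := h (z + k).
rewrite /ball /= /AbsRing_ball /norm /= /abs /= /minus /plus /opp /scal /= /mult /=.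
have -> : z + k + - z = k by ring.
by apply.
Qed.

Lemma cderiv_ccont f z l : cderiv f z l -> ccont f z.
Proof.
move=> h eps he; have [d hd hh] := h 1%R Rlt_0_1.
have p : (0 < Cmod l + 2)%R by have := Cmod_ge_0 l; lra.
exists (Rmin d (eps / (Cmod l + 2)))%R.
  by apply: Rmin_pos => //; apply: Rdiv_lt_0_compat.
move=> k hk; have k1 := Rlt_le_trans _ _ _ hk (Rmin_l _ _).
have k2 := Rlt_le_trans _ _ _ hk (Rmin_r _ _).
have a := hh k k1.
have -> : f (z + k) - f z = (f (z + k) - f z - k * l) + k * l by ring.
apply: Rle_lt_trans (Cmod_triangle _ _) _; rewrite Cmod_mult.
have : (Cmod k * (Cmod l + 2) < eps)%R.
  by apply Rlt_div_r; lra.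
have := Cmod_ge_0 k; nra.
Qed.

Lemma cderiv_Cderive f z l : cderiv f z l -> C_derive f z = l.
Proof. by move=> /cderiv_is_derive /is_C_derive_unique. Qed.

Lemma nsum_le (T : eqType) (u v : T -> C) k s :
  (forall i, Cmod (u i) <= k * Cmod (v i))%R -> (nsum u s <= k * nsum v s)%R.
Proof.
move=> h; rewrite /nsum; elim: s => [|i s IH]; first by rewrite !big_nil; lra.
by rewrite !big_cons; have := h i; lra.
Qed.

Lemma le_exp x : (x <= exp x)%R.
Proof. by have := exp_ineq1_le x; lra. Qed.

(** The coefficients beat every exponential of [al m], so the remainders of the single terms add up
    to at most a constant times the square of [Cmod h]. *)
Lemma has_sum_cderiv (I : eqType) (c : I -> C) (al : I -> R) (F : C -> C) :
  (forall B : R, summable (fun m => c m * RtoC (exp (B * Rabs (al m))))) ->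
  (forall z, has_sum (fun m => c m * E (al m * z)) (F z)) ->
  forall z, exists l, cderiv F z l.
Proof.
move=> hs hF z.
have [w ew] : exists w : I -> C, forall m, w m = 2 * PI * Ci * al m by eexists.
have Cw m : (Cmod (w m) = 2 * PI * Rabs (al m))%R.
  rewrite ew !Cmod_mult !Cmod_R Cmod_Ci Rmult_1_r.
  rewrite (Rabs_pos_eq 2); last lra.
  by rewrite (Rabs_pos_eq PI); last have := PI_RGT_0; lra.
have CE m h : (Cmod (E (al m * h)) <= exp (Cmod (w m) * Cmod h))%R.
  rewrite Cmod_E; apply: exp_le_mono; rewrite Cw im_scal_l.
  have := im_le_Cmod h; have := PI_RGT_0; have := Rabs_pos (al m).
  have : (Rabs (al m * Im h) = Rabs (al m) * Rabs (Im h))%R by exact: Rabs_mult.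
  move: (Rabs (al m)) => A e A0 p hh.
  have : (- (al m * Im h) <= A * Cmod h)%R.
    have : (- (al m * Im h) <= A * Rabs (Im h))%R by rewrite -e; split_Rabs; lra.
    nra.
  nra.
(* The exponent pays [Cmod z] for the growth of [E (al m * z)] and 3 for the second-order remainder:
   with [W = Cmod (w m)] and [Cmod h < 1], the quantity [W * W * exp (Cmod h * W)] is at most
   [exp (3 * W)]. *)
pose g m := c m * RtoC (exp ((2 * PI * (3 + Cmod z)) * Rabs (al m))).
have qsign : summable g := hs _.
have gE m : (Cmod (g m) = Cmod (c m) * exp (Cmod (w m) * (3 + Cmod z)))%R.
  rewrite /g Cmod_mult Cmod_R Rabs_pos_eq; last exact/Rlt_le/exp_pos.
  by congr (_ * exp _)%R; rewrite Cw; ring.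
have [M hM] := qsign.
have M0 : (0 <= M)%R by apply: Rle_trans (hM [::] isT); exact: nsum_ge0.
pose D m := c m * (w m * E (al m * z)).
have sD : summable D.
  apply: (summable_dom (K := 1%R) qsign); first lra.
  move=> m; rewrite gE /D !Cmod_mult Rmult_1_l.
  apply: Rmult_le_compat_l; first exact: Cmod_ge_0.
  have := Cmod_ge_0 z; have := Cmod_ge_0 (w m); move=> w0 z0.
  apply: Rle_trans (_ : _ <= exp (Cmod (w m)) * exp (Cmod (w m) * Cmod z))%R _.
    by apply: Rmult_le_compat => //; first [exact: Cmod_ge_0 | exact: le_exp | exact: CE].
  by rewrite -exp_plus; apply: exp_le_mono; nra.
have [l hl] := summable_has_sum sD.
exists l => eps he.
have p : (0 < eps / (4 * M + 1))%R by apply: Rdiv_lt_0_compat; lra.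
exists (Rmin 1 (eps / (4 * M + 1)))%R; first by apply: Rmin_pos => //; lra.
move=> h hh; have h1 := Rlt_le_trans _ _ _ hh (Rmin_l _ _).
have h2 := Rlt_le_trans _ _ _ hh (Rmin_r _ _).
have h0 := Cmod_ge_0 h.
apply: Rle_trans (_ : _ <= 4 * (Cmod h * Cmod h) * M)%R _; last first.
  have : (Cmod h * (4 * M + 1) <= eps)%R.
    by apply Rle_div_r; lra.
  nra.
have := has_sum_plus (has_sum_plus (hF (z + h)) (has_sum_scal (- (1)) (hF z)))
  (has_sum_scal (- h) hl).
set u := fun i => _ => hu.
have -> : F (z + h) - F z - h * l = F (z + h) + - (1) * F z + - h * l by ring.
apply: (has_sum_Cmod_le hu) => s us.
apply: Rle_trans (_ : _ <= 4 * (Cmod h * Cmod h) * nsum g s)%R _; last first.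
  by apply: Rmult_le_compat_l; [nra|exact: hM].
apply: nsum_le => m; rewrite gE.
have -> : u m = c m * (E (al m * z) * (Cexp (h * w m) - 1 - h * w m)).
  rewrite /u /D Cmult_plus_distr_l E_plus.
  have -> : E (al m * h) = Cexp (h * w m) by rewrite E_Cexp ew; congr Cexp; ring.
  by ring.
rewrite Cmod_mult.
have := Cexp_sub1_lin (h * w m); have := CE m z.
rewrite !Cmod_mult; have := Cmod_ge_0 (w m).
have := Cmod_ge_0 (E (al m * z)); have := Cmod_ge_0 (Cexp (h * w m) - 1 - h * w m).
have := Cmod_ge_0 z; have := Cmod_ge_0 (c m).
move: (Cmod (Cexp _ - _ - _)) (Cmod (E _)) (Cmod (w m)) (Cmod z) (Cmod (c m)) h0 h1
  => X Y W Z0 K k0 k1 K0 Z00 X0 Y0 W0 hY hX.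
rewrite (_ : 4 * (Cmod h * Cmod h) * (K * exp (W * (3 + Z0)))
   = K * (exp (W * Z0) * (4 * (Cmod h * Cmod h) * exp (3 * W))))%R; last first.
  have -> : (W * (3 + Z0) = W * Z0 + 3 * W)%R by ring.
  by rewrite exp_plus; ring.
apply: Rmult_le_compat_l => //.
apply: Rmult_le_compat => //.
apply: Rle_trans hX _.
have e1 : (exp (Cmod h * W) <= exp W)%R by apply: exp_le_mono; nra.
have e2 := le_exp W; have e3 := exp_pos W.
have -> : (3 * W = W + W + W)%R by ring.
rewrite !exp_plus.
have e4 := exp_pos (Cmod h * W).
have : (W * W * exp (Cmod h * W) <= exp W * exp W * exp W)%R.
  apply: Rmult_le_compat; try nra.
move=> e5.
have -> : (4 * (Cmod h * W * (Cmod h * W)) * exp (Cmod h * W)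
  = 4 * (Cmod h * Cmod h) * (W * W * exp (Cmod h * W)))%R by ring.
by apply: Rmult_le_compat_l => //; nra.
Qed.

(** Completing the square in [A * x ^ 2 - (B + 1) * x], where [x = Rabs (IZR m + a)]: the unit added
    to [B] leaves a spare factor [exp (- x)], which is comparable with a geometric term in [m]. *)
Lemma summable_gauss (A a B : R) : (0 < A)%R -> summable (fun m : Z =>
  RtoC (exp (- (A * (IZR m + a) ^ 2) + B * Rabs (IZR m + a)))).
Proof.
move=> hA; pose D := ((B + 1) ^ 2 / (4 * A) + Rabs a)%R.
apply: (summable_dom (K := exp D) (summable_Zgeom Rlt_0_1)); first exact/Rlt_le/exp_pos.
move=> m; rewrite !Cmod_R !(Rabs_pos_eq (exp _)); try exact/Rlt_le/exp_pos.
rewrite -exp_plus; apply: exp_le_mono; rewrite /D Rmult_1_l.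
have : (Rabs (IZR m) <= Rabs (IZR m + a) + Rabs a)%R by split_Rabs; lra.
have -> : ((IZR m + a) ^ 2 = Rabs (IZR m + a) ^ 2)%R by rewrite pow2_abs.
move: (Rabs (IZR m + a)) => x hx.
have : (0 <= A * (x - (B + 1) / (2 * A)) ^ 2)%R by have := pow2_ge_0 (x - (B + 1) / (2 * A)); nra.
have -> : (A * (x - (B + 1) / (2 * A)) ^ 2 = A * x ^ 2 - (B + 1) * x + (B + 1) ^ 2 / (4 * A))%R.
  by field; lra.
lra.
Qed.

(** * Theta series *)

Lemma RtoC_half : RtoC (1 / 2)%R = 1 / 2.
Proof. by rewrite RtoC_div //; lra. Qed.

Ltac Cpush := repeat match goal with
  | |- context [RtoC (Rplus ?a ?b)] => rewrite (RtoC_plus a b)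
  | |- context [RtoC (Rminus ?a ?b)] => rewrite (RtoC_minus a b)
  | |- context [RtoC (Rmult ?a ?b)] => rewrite (RtoC_mult a b)
  | |- context [RtoC (Ropp ?a)] => rewrite (RtoC_opp a)
  | |- context [RtoC (Rdiv 1 2)] => rewrite RtoC_half
  | |- context [IZR (Z.add ?a ?b)] => rewrite (plus_IZR a b)
  | |- context [IZR (Z.sub ?a ?b)] => rewrite (minus_IZR a b)
  | |- context [IZR (Z.mul ?a ?b)] => rewrite (mult_IZR a b)
  | |- context [IZR (Z.opp ?a)] => rewrite (opp_IZR a)
  end.

Definition theta_term (a b : R) (z tau : C) (m : Z) : C :=
  let x := RtoC (IZR m + a)%R in E (x * x * tau / 2 + x * (z + b)).

Lemma Cmod_theta_term (a b : R) (z tau : C) m : (Cmod (theta_term a b z tau m) =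
  exp (- (PI * Im tau * (IZR m + a) ^ 2) - 2 * PI * Im z * (IZR m + a)))%R.
Proof.
rewrite /theta_term Cmod_E; congr exp; move: (IZR m + a)%R => x.
have -> : x * x * tau / 2 = RtoC (x * x / 2) * tau.
  by rewrite RtoC_div ?RtoC_mult; [field|lra].
case: tau => t1 t2; case: z => z1 z2.
by rewrite /Im /Cplus /Cmult /RtoC /=; field.
Qed.

Lemma theta_term_Cexp (a b : R) (z tau : C) m : let x := (IZR m + a)%R in
  Cexp (PI * Ci * (x ^ 2)%R * tau + 2%R * PI * Ci * x * (z + b)) = theta_term a b z tau m.
Proof.
rewrite /theta_term E_Cexp /=; congr Cexp; rewrite Rmult_1_r; Cpush.
by field.
Qed.

Section Theta.
Variable tau : C.
Hypothesis htau : (0 < Im tau)%R.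

Lemma summable_theta_term a b z : summable (theta_term a b z tau).
Proof.
have hA : (0 < PI * Im tau)%R by have := PI_RGT_0; nra.
apply: (summable_dom (K := 1%R) (summable_gauss a (2 * PI * Rabs (Im z)) hA)); first lra.
move=> m; rewrite Cmod_theta_term Cmod_R Rabs_pos_eq; last exact/Rlt_le/exp_pos.
rewrite Rmult_1_l; apply: exp_le_mono.
have : (- (Im z * (IZR m + a)) <= Rabs (Im z) * Rabs (IZR m + a))%R.
  by rewrite -Rabs_mult; split_Rabs; lra.
have := PI_RGT_0; nra.
Qed.

Lemma theta_eq a b z l : has_sum (theta_term a b z tau) l -> theta a b z tau = l.
Proof.
move=> h; have s := summable_theta_term a b z.
rewrite /theta; apply: Z_has_sum; first by apply: summable_ext s => m; rewrite theta_term_Cexp.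
by apply: has_sum_ext h => m; rewrite theta_term_Cexp.
Qed.

Lemma theta_has_sum a b z : has_sum (theta_term a b z tau) (theta a b z tau).
Proof.
have [l hl] := summable_has_sum (summable_theta_term a b z).
by rewrite (theta_eq hl).
Qed.

Lemma theta_cderiv a b z : exists l, cderiv (fun z => theta a b z tau) z l.
Proof.
pose c m := theta_term a b 0 tau m.
apply: (@has_sum_cderiv _ c (fun m => IZR m + a)%R).
  move=> B; have hA : (0 < PI * Im tau)%R by have := PI_RGT_0; nra.
  apply: (summable_dom (K := 1%R) (summable_gauss a B hA)); first lra.
  move=> m; rewrite /c Cmod_mult Cmod_theta_term !Cmod_R !(Rabs_pos_eq (exp _)); try exact/Rlt_le/exp_pos.
  rewrite Rmult_1_l -exp_plus; apply: exp_le_mono => /=; lra.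
move=> w; apply: has_sum_ext (theta_has_sum a b w) => m.
by rewrite /c /theta_term -E_plus; congr E; field.
Qed.

Lemma theta_ccont a b z : ccont (fun z => theta a b z tau) z.
Proof. by have [l /cderiv_ccont] := theta_cderiv a b z. Qed.

(** Expanding the square around [m + a] turns a change of characteristics into a translation of [z].
    In this way every theta function of the proof is reduced to the odd one. *)
Lemma theta_char a c b b' z : theta (a + c) b z tau =
  E (c * c * tau / 2 + c * (z + b)) * theta a b' (z + c * tau + (b - b')) tau.
Proof.
apply: theta_eq; apply: has_sum_ext (has_sum_scal _ (theta_has_sum a b' _)) => m.
by rewrite /theta_term -E_plus; congr E; Cpush; field.
Qed.

Lemma theta_shift a b z (k : Z) : theta (a + IZR k) b z tau = theta a b z tau.
Proof.
apply: theta_eq.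
have h := has_sum_bij (f := fun m => (m + k)%Z) (g := fun m => (m - k)%Z) _ _ (theta_has_sum a b z).
apply: has_sum_ext (h _ _); try by move=> m; lia.
by move=> m; rewrite /theta_term; congr E; Cpush; field.
Qed.

Lemma theta_Z a b z (k : Z) :
  theta a b (z + IZR k) tau = E (a * IZR k) * theta a b z tau.
Proof.
apply: theta_eq; apply: has_sum_ext (has_sum_scal _ (theta_has_sum a b z)) => m.
rewrite /theta_term -E_plus -(E_periodic (_ + _) (m * k)); congr E; Cpush; field.
Qed.

Notation T z := (theta (1 / 2) (1 / 2) z tau).

(** The reindexing [m |-> - 1 - m] negates [m + 1 / 2], and the sign is [E (1 / 2)]. *)
Lemma theta_half_odd z : T (- z) = - T z.
Proof.
apply: theta_eq.
pose f m := (- 1 - m)%Z.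
have h := has_sum_bij (f := f) (g := f) _ _ (theta_has_sum (1 / 2) (1 / 2) z).
have {h} h := h ltac:(by move=> m; rewrite /f; lia) ltac:(by move=> m; rewrite /f; lia).
have -> : - T z = - (1) * T z by ring.
apply: has_sum_ext (has_sum_scal _ h) => m.
rewrite -E_half /theta_term /f -E_plus -(E_periodic _ m); congr E; Cpush; field.
Qed.

Lemma theta_half_0 : T 0 = 0.
Proof.
have := theta_half_odd 0; have -> : - 0 = 0 :> C by ring.
move: (theta _ _ _ _) => x h.
have -> : x = (x - - x) / 2 by field.
by rewrite -h; field.
Qed.

Lemma theta_half_Ztau z (q : Z) :
  T (z + IZR q * tau) = E (- (IZR q * IZR q * tau / 2 + IZR q * (z + 1 / 2))) * T z.
Proof.
have := theta_char (1 / 2) (IZR q) (1 / 2) (1 / 2) z; rewrite theta_shift => ->.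
rewrite Cmult_assoc -E_plus.
have -> : - (IZR q * IZR q * tau / 2 + IZR q * (z + 1 / 2)) +
  (IZR q * IZR q * tau / 2 + IZR q * (z + (1 / 2)%R)) = 0 by Cpush; field.
have -> : z + IZR q * tau + ((1 / 2)%R - (1 / 2)%R) = z + IZR q * tau by ring.
by rewrite E_0 Cmult_1_l.
Qed.

Lemma theta_half_lattice z (p q : Z) : exists2 u : C, u <> 0 & T (z + (IZR p + IZR q * tau)) = u * T z.
Proof.
have -> : z + (IZR p + IZR q * tau) = z + IZR q * tau + IZR p by ring.
rewrite theta_Z theta_half_Ztau Cmult_assoc.
exists (E ((1 / 2)%R * IZR p) * E (- (IZR q * IZR q * tau / 2 + IZR q * (z + 1 / 2)))) => //.
by apply: Cmult_neq_0; exact: E_neq0.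
Qed.

Lemma theta_to_half (c e : R) z : theta (1 / 2 + c) (1 / 2 - e) z tau =
  E (c * c * tau / 2 + c * (z + 1 / 2 - e)) * T (z + c * tau - e).
Proof.
rewrite (theta_char _ _ _ (1 / 2)); congr (E _ * theta _ _ _ _); Cpush; ring.
Qed.

End Theta.

(** * Orthogonality of roots of unity *)

Lemma E_pow z (j : nat) : E (INR j * z) = Cpow (E z) j.
Proof.
elim: j => [|j IH]; first by rewrite /= Cmult_0_l E_0.
by rewrite S_INR RtoC_plus Cmult_plus_distr_r E_plus IH Cmult_1_l /= Cmult_comm.
Qed.

Lemma Cpow_geom z N : (z - 1) * (\big[Cplus/RtoC 0]_(j < N) Cpow z j) = Cpow z N - 1.
Proof.
elim: N => [|N IH]; first by rewrite big_ord0 /=; ring.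
by rewrite big_ord_recr /= Cmult_plus_distr_l IH /=; ring.
Qed.

Lemma INR_neq0 n : (0 < n)%N -> INR n <> 0%R.
Proof. by move=> h; apply: not_0_INR; lia. Qed.

Lemma RtoC_neq0 x : x <> 0%R -> RtoC x <> 0.
Proof. by move=> h /RtoC_inj. Qed.

Lemma CINR_neq0 n : (0 < n)%N -> RtoC (INR n) <> 0.
Proof. by move=> h; apply/RtoC_neq0/INR_neq0. Qed.

Lemma Csum_const (I : finType) (c : C) : Csum (fun _ : I => c) = INR #|I| * c.
Proof.
rewrite /Csum big_const; elim: #|I| => [|k IH]; first by rewrite /= Cmult_0_l.
by rewrite iterS IH S_INR RtoC_plus; ring.
Qed.

(** A geometric sum whose ratio is a root of unity. This projection onto one class modulo [N] later
    isolates a term of theta, a class of Kronecker indices and a coefficient in the span of the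
    [psi]. *)
Lemma unity_sum N (m : Z) : (0 < N)%N ->
  Csum (fun j : 'I_N => E (INR j * (IZR m / INR N))) =
  if (m mod Z.of_nat N =? 0)%Z then RtoC (INR N) else 0.
Proof.
move=> hN; have nz := CINR_neq0 hN.
set w := IZR m / INR N.
have -> : Csum (fun j : 'I_N => E (INR j * w)) = \big[Cplus/RtoC 0]_(j < N) Cpow (E w) j.
  by apply: eq_bigr => j _; rewrite E_pow.
case: Z.eqb_spec => hm.
  have -> : E w = 1.
    have [k hk] : exists k, m = (k * Z.of_nat N)%Z by apply/Z.mod_divide; lia.
    rewrite /w hk mult_IZR RtoC_mult -INR_IZR_INZ.
    have -> : IZR k * INR N / INR N = IZR k by field.
    exact: E_Z.
  have := Csum_const 'I_N 1; rewrite card_ord Cmult_1_r /Csum => <-.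
  by apply: eq_bigr => j _; rewrite Cpow_1_l.
have := Cpow_geom (E w) N.
have -> : Cpow (E w) N = 1.
  rewrite -E_pow /w; have -> : INR N * (IZR m / INR N) = IZR m by field.
  exact: E_Z.
move=> h; have {}h : (E w - 1) * \big[Cplus/RtoC 0]_(j < N) Cpow (E w) j = 0 by rewrite h; ring.
have nz1 : E w - 1 <> 0.
  move=> h1; have [k hk] := E_eq1 (proj2 (Ceq_minus _ _) h1); apply: hm; apply/Z.mod_divide; first lia.
  exists k; apply: eq_IZR; rewrite mult_IZR -INR_IZR_INZ; apply: RtoC_inj.
  by rewrite RtoC_mult -hk /w; field.
rewrite -[LHS]Cmult_1_l -(Cinv_l _ nz1) -Cmult_assoc h; ring.
Qed.

Lemma has_sum_single (T : eqType) (i0 : T) (c : C) :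
  has_sum (fun i => if i == i0 then c else 0) c.
Proof.
move=> eps he; exists [:: i0] => s us sub.
have hi : i0 \in s by apply: sub; rewrite inE.
rewrite /psum (bigD1_seq i0) //= eqxx big1.
  by rewrite (_ : _ - _ = 0) ?Cmod_0 //; ring.
by move=> i /negPf ->.
Qed.

(** * Theta does not vanish on a whole horizontal line *)

Section NonVanishing.
Variable tau : C.
Hypothesis htau : (0 < Im tau)%R.
Notation T z := (theta (1 / 2) (1 / 2) z tau).

(* Averaging over the [N]-th parts of a period isolates the terms whose index
   is divisible by [N], among which only the term of index 0 is not small. *)
Lemma theta_half_line_neq0 (x0 : C) : ~ (forall t : R, T (x0 + t) = 0).
Proof.
move=> hT; pose t m := theta_term (1 / 2) (1 / 2) x0 tau m.
have st : summable t := summable_theta_term htau _ _ _.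
have t0 : (0 < Cmod (t 0%Z))%R by apply/Cmod_gt_0; exact: E_neq0.
have [s0 us0 hs0] := summable_tail st (eps := (Cmod (t 0%Z) / 2)%R) ltac:(lra).
(* [N] exceeds the absolute value of every index in [s0], so that nonzero multiples of [N] fall into
   the tail. *)
pose N := (foldr maxn 0%N (map Z.abs_nat s0)).+1.
have hN : (0 < N)%N by [].
have nz := CINR_neq0 hN.
have big m : m <> 0%Z -> (m mod Z.of_nat N = 0)%Z -> m \notin s0.
  move=> m0 /Z.mod_divide hm; apply/negP => hin.
  have [k hk] := hm ltac:(lia).
  have : (Z.abs_nat m < N)%N.
    rewrite /N ltnS; elim: (s0) hin => //= a s IH; rewrite inE => /orP[/eqP->|/IH]; lia.
  have : (1 <= Z.abs k)%Z by nia.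
  nia.
pose u m := if (m mod Z.of_nat N =? 0)%Z then t m else 0.
have hu : has_sum u 0.
  (* Compensates the phase that the half-integer characteristic produces under translation by
     [j / N]; only [E (j m / N)] remains. *)
  pose c (j : 'I_N) := E (- (INR j * (1 / 2 / INR N))).
  pose F (j : 'I_N) m := c j * theta_term (1 / 2) (1 / 2) (x0 + (INR j / INR N)%R) tau m.
  have hF j : has_sum (F j) 0.
    have := has_sum_scal (c j) (theta_has_sum htau (1 / 2) (1 / 2) (x0 + (INR j / INR N)%R)).
    by rewrite hT Cmult_0_r.
  have h := has_sum_big (index_enum 'I_N) hF.
  have {h} h := has_sum_scal (/ INR N) h.
  have e : / INR N * psum (fun=> 0) (index_enum 'I_N) = 0.
    by rewrite /psum big1 //; ring.
  rewrite e in h.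
  apply: has_sum_ext h => m.
  have -> : psum (F^~ m) (index_enum 'I_N)
     = t m * Csum (fun j : 'I_N => E (INR j * (IZR m / INR N))).
    rewrite /Csum (big_morph (Cmult (t m)) (Cmult_plus_distr_l _) (Cmult_0_r _)).
    apply: eq_bigr => j _; rewrite /F /c /t /theta_term -!E_plus; congr E.
    have nz' : INR N <> 0%R by exact: INR_neq0.
    rewrite RtoC_div //; Cpush; field; exact: nz.
  rewrite unity_sum // /u; case: Z.eqb_spec => _; [by field|ring].
pose v m := u m + - (1) * (if m == 0%Z then t 0%Z else 0).
have hv : has_sum v (0 + - (1) * t 0%Z).
  by apply: has_sum_plus hu _; apply: has_sum_scal; exact: has_sum_single.
have : (Cmod (0 + - (1) * t 0%Z) <= Cmod (t 0%Z) / 2)%R.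
  apply: (has_sum_Cmod_le hv) => s us.
  have -> : nsum v s = nsum t [seq m <- s | (m != 0%Z) && (m mod Z.of_nat N =? 0)%Z].
    rewrite /nsum big_filter [RHS]big_mkcond; apply: eq_bigr => m _.
    rewrite /v /u; case: eqP => [->|_].
      by rewrite Zmod_0_l /= -Cmod_0; move: (t _) => y; congr Cmod; ring.
    rewrite /=.
    move: (t m) (t _) => y y0; case: ifP => _; last rewrite -Cmod_0; congr Cmod; ring.
  apply/Rlt_le/hs0; first exact: filter_uniq.
  move=> m; rewrite mem_filter => /andP[/andP[/eqP m0 /Z.eqb_eq hm] _]; exact: big.
have -> : 0 + - (1) * t 0%Z = - t 0%Z by ring.
by rewrite Cmod_opp; lra.
Qed.

End NonVanishing.

(** * Limits at 0+ *)

(** One-sided limits are enough: the identities to be extended hold for small [s > 0] on a ray that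
    leaves the given point. *)
Definition lim0 (f : R -> C) (l : C) :=
  forall eps : R, (0 < eps)%R -> exists2 d : R, (0 < d)%R &
    forall s, (0 < s < d)%R -> (Cmod (f s - l) < eps)%R.

Lemma lim0_unique f l m : lim0 f l -> lim0 f m -> l = m.
Proof.
move=> hl hm; apply/Ceq_minus/Cmod_eq_0.
apply: Rle_antisym; last exact: Cmod_ge_0.
apply: le_epsilon => eps he; rewrite Rplus_0_l.
have [d1 p1 h1] := hl (eps / 2)%R ltac:(lra).
have [d2 p2 h2] := hm (eps / 2)%R ltac:(lra).
pose s := (Rmin d1 d2 / 2)%R.
have hs : (0 < s /\ s < d1 /\ s < d2)%R.
  have := Rmin_pos _ _ p1 p2; have := Rmin_l d1 d2; have := Rmin_r d1 d2; rewrite /s; lra.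
have := h1 s ltac:(lra); have := h2 s ltac:(lra) => a b.
have -> : l - m = - (f s - l) + (f s - m) by ring.
apply: Rle_trans (Cmod_triangle _ _) _; rewrite Cmod_opp; lra.
Qed.

Lemma lim0_ext f g l d : (0 < d)%R -> (forall s, (0 < s < d)%R -> f s = g s) ->
  lim0 f l -> lim0 g l.
Proof.
move=> hd e h eps he; have [d1 p1 h1] := h eps he.
exists (Rmin d d1); first exact: Rmin_pos.
move=> s hs; have := Rmin_l d d1; have := Rmin_r d d1 => a b.
by rewrite -e; [apply: h1|]; lra.
Qed.

Lemma lim0_const c : lim0 (fun _ => c) c.
Proof.
by move=> eps he; exists 1%R; [lra|move=> s _; rewrite (_ : c - c = 0) ?Cmod_0 //; ring].
Qed.

Lemma lim0_comp g f l : ccont g l -> lim0 f l -> lim0 (fun s => g (f s)) (g l).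
Proof.
move=> hg hf eps he; have [d p hd] := hg eps he; have [d1 p1 h1] := hf d p.
exists d1 => // s /h1 /hd; by have -> : l + (f s - l) = f s by ring.
Qed.

Lemma lim0_plus f g l m : lim0 f l -> lim0 g m -> lim0 (fun s => f s + g s) (l + m).
Proof.
move=> hl hm eps he.
have [d1 p1 h1] := hl (eps / 2)%R ltac:(lra).
have [d2 p2 h2] := hm (eps / 2)%R ltac:(lra).
exists (Rmin d1 d2); first exact: Rmin_pos.
move=> s hs; have := Rmin_l d1 d2; have := Rmin_r d1 d2 => a b.
have := h1 s ltac:(lra); have := h2 s ltac:(lra) => u v.
have -> : f s + g s - (l + m) = (f s - l) + (g s - m) by ring.
apply: Rle_lt_trans (Cmod_triangle _ _) _; lra.
Qed.

Lemma lim0_bounded_mult f g B d : (0 < d)%R -> lim0 f 0 ->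
  (forall s, (0 < s < d)%R -> (Cmod (g s) <= B)%R) -> lim0 (fun s => f s * g s) 0.
Proof.
move=> hd hf hg eps he.
have B0 : (0 <= B)%R.
  by apply: Rle_trans (Cmod_ge_0 _) (hg (d / 2)%R _); lra.
have [d1 p1 h1] := hf (eps / (B + 1))%R ltac:(apply: Rdiv_lt_0_compat; lra).
exists (Rmin d d1); first exact: Rmin_pos.
move=> s hs; have := Rmin_l d d1; have := Rmin_r d d1 => a b.
have := h1 s ltac:(lra); have := hg s ltac:(lra).
have -> : f s - 0 = f s by ring.
have -> : f s * g s - 0 = f s * g s by ring.
rewrite Cmod_mult => u v; have := Cmod_ge_0 (g s); have := Cmod_ge_0 (f s) => w w'.
apply: Rle_lt_trans (_ : _ <= Cmod (f s) * (B + 1))%R _; first nra.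
by apply Rlt_div_r; lra.
Qed.

Lemma lim0_mult f g l m : lim0 f l -> lim0 g m -> lim0 (fun s => f s * g s) (l * m).
Proof.
move=> hl hm.
have f0 : lim0 (fun s => f s - l) 0.
  have := lim0_plus hl (lim0_const (- l)); rewrite (_ : l + - l = 0) //; ring.
have g0 : lim0 (fun s => g s - m) 0.
  have := lim0_plus hm (lim0_const (- m)); rewrite (_ : m + - m = 0) //; ring.
have [d p hd] := g0 1%R Rlt_0_1.
have h1 := lim0_bounded_mult p f0 (g := fun s => g s - m) (B := 1%R).
have {h1} h1 := h1 _; have {h1} h1 : lim0 (fun s => (f s - l) * (g s - m)) 0.
  apply: h1 => s /hd; have -> : g s - m - 0 = g s - m by ring.
  exact: Rlt_le.
have h2 := lim0_bounded_mult (B := Cmod m) p f0 (fun s _ => Rle_refl (Cmod m)).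
have h3 := lim0_bounded_mult (B := Cmod l) p g0 (fun s _ => Rle_refl (Cmod l)).
have := lim0_plus (lim0_plus (lim0_plus h1 h2) h3) (lim0_const (l * m)).
rewrite (_ : 0 + 0 + 0 + l * m = l * m); last by ring.
by apply: (lim0_ext Rlt_0_1) => s _; ring.
Qed.

Lemma lim0_opp f l : lim0 f l -> lim0 (fun s => - f s) (- l).
Proof.
move=> h; have := lim0_mult (lim0_const (- (1))) h; rewrite (_ : - (1) * l = - l); last by ring.
by apply: (lim0_ext Rlt_0_1) => s _; ring.
Qed.

Lemma lim0_minus f g l m : lim0 f l -> lim0 g m -> lim0 (fun s => f s - g s) (l - m).
Proof. by move=> hl hm; apply: lim0_plus => //; exact: lim0_opp. Qed.

Lemma Cinv_ccont (z : C) : z <> 0 -> ccont Cinv z.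
Proof.
move=> nz eps he; have z0 := proj1 (Cmod_gt_0 z) nz.
exists (Rmin (Cmod z / 2) (eps * (Cmod z * (Cmod z / 2))))%R.
  by apply: Rmin_pos; [lra|apply: Rmult_lt_0_compat => //; nra].
move=> h hh; have a := Rlt_le_trans _ _ _ hh (Rmin_l _ _).
have b := Rlt_le_trans _ _ _ hh (Rmin_r _ _).
have c : (Cmod z / 2 < Cmod (z + h))%R.
  have := Cmod_triangle (z + h) (- h); rewrite Cmod_opp.
  have -> : z + h + - h = z by ring.
  lra.
have nz1 : z + h <> 0 by apply/Cmod_gt_0; lra.
have -> : / (z + h) - / z = - (h * / (z * (z + h))) by field.
rewrite Cmod_opp Cmod_mult Cmod_inv; last exact: Cmult_neq_0.
rewrite Cmod_mult.
apply: (Rmult_lt_reg_r (Cmod z * Cmod (z + h))); first nra.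
rewrite Rmult_assoc Rinv_l; last nra.
rewrite Rmult_1_r; apply: Rlt_le_trans b _.
apply: Rmult_le_compat_l; first lra.
apply: Rmult_le_compat_l; lra.
Qed.

Lemma lim0_inv f (l : C) : l <> 0 -> lim0 f l -> lim0 (fun s => / f s) (/ l).
Proof. by move=> nz; apply: lim0_comp; exact: Cinv_ccont. Qed.

Lemma lim0_div f g (l m : C) : m <> 0 -> lim0 f l -> lim0 g m -> lim0 (fun s => f s / g s) (l / m).
Proof. by move=> nz hl hm; apply: lim0_mult => //; exact: lim0_inv. Qed.

Lemma lim0_line (z v : C) : lim0 (fun s => z + s * v) z.
Proof.
move=> eps he; have p : (0 < Cmod v + 1)%R by have := Cmod_ge_0 v; lra.
exists (eps / (Cmod v + 1))%R; first exact: Rdiv_lt_0_compat.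
move=> s hs; have -> : z + s * v - z = s * v by ring.
rewrite Cmod_mult Cmod_R Rabs_pos_eq; last lra.
apply: Rle_lt_trans (_ : _ <= s * (Cmod v + 1))%R _; first by have := Cmod_ge_0 v; nra.
by apply Rlt_div_r; lra.
Qed.

Lemma lim0_Csum (I : finType) (F : I -> R -> C) (L : I -> C) :
  (forall i, lim0 (F i) (L i)) -> lim0 (fun s => Csum (fun i => F i s)) (Csum L).
Proof.
move=> h; rewrite /Csum; elim: (index_enum I) => [|i r IH].
  rewrite big_nil; apply: (lim0_ext Rlt_0_1 _ (lim0_const 0)) => s _.
  by rewrite big_nil.
rewrite big_cons; apply: (lim0_ext Rlt_0_1 _ (lim0_plus (h i) IH)) => s _.
by rewrite big_cons.
Qed.

Lemma lim0_cderiv (f : C -> C) (z l v : C) : cderiv f z l ->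
  lim0 (fun s => (f (z + s * v) - f z) / s) (l * v).
Proof.
move=> h eps he; have p : (0 < Cmod v + 1)%R by have := Cmod_ge_0 v; lra.
have e1 : (0 < eps / (Cmod v + 1))%R by exact: Rdiv_lt_0_compat.
have [d hd hh] := h _ e1.
exists (d / (Cmod v + 1))%R; first exact: Rdiv_lt_0_compat.
move=> s hs; have s0 : RtoC s <> 0 by apply: RtoC_neq0; lra.
have hm : (Cmod (s * v) = s * Cmod v)%R by rewrite Cmod_mult Cmod_R Rabs_pos_eq //; lra.
have small : (s * (Cmod v + 1) < d)%R.
  by apply Rlt_div_r; lra.
have := hh (s * v); rewrite hm => /(_ ltac:(nra)) b.
have -> : (f (z + s * v) - f z) / s - l * v = / s * (f (z + s * v) - f z - s * v * l) by field.
rewrite Cmod_mult Cmod_inv // Cmod_R Rabs_pos_eq; last lra.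
apply: (Rmult_lt_reg_l s); first lra.
rewrite -Rmult_assoc Rinv_r ?Rmult_1_l; last lra.
apply: Rle_lt_trans b _.
have -> : (eps / (Cmod v + 1) * (s * Cmod v) = s * (eps / (Cmod v + 1) * Cmod v))%R by ring.
apply: Rmult_lt_compat_l; first lra.
apply: Rlt_le_trans (_ : _ < eps / (Cmod v + 1) * (Cmod v + 1))%R _.
  apply: Rmult_lt_compat_l; lra.
by right; field; lra.
Qed.

Lemma E_cderiv z : cderiv E z (E z * (2 * PI * Ci)).
Proof.
move=> eps he; have PI0 := PI_RGT_0.
pose q := (2 * PI)%R.
have Cq h : (Cmod (2 * PI * Ci * h) = q * Cmod h)%R.
  rewrite !Cmod_mult !Cmod_R Cmod_Ci Rmult_1_r.
  by rewrite (Rabs_pos_eq 2) ?(Rabs_pos_eq PI) //; lra.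
pose M := (Cmod (E z) * (4 * (q * q) * exp q))%R.
have M0 : (0 <= M)%R.
  apply: Rmult_le_pos; first exact: Cmod_ge_0.
  have := exp_pos q; rewrite /q; have : (0 < 4 * (2 * PI * (2 * PI)))%R by nra.
  nra.
exists (Rmin 1 (eps / (M + 1)))%R.
  by apply: Rmin_pos; [lra|apply: Rdiv_lt_0_compat; lra].
move=> h hh; have h1 := Rlt_le_trans _ _ _ hh (Rmin_l _ _).
have h2 := Rlt_le_trans _ _ _ hh (Rmin_r _ _); have h0 := Cmod_ge_0 h.
have -> : E (z + h) - E z - h * (E z * (2 * PI * Ci))
  = E z * (Cexp (2 * PI * Ci * h) - 1 - 2 * PI * Ci * h).
  by rewrite E_plus (E_Cexp h); ring.
rewrite Cmod_mult; have := Cexp_sub1_lin (2 * PI * Ci * h); rewrite Cq => b.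
apply: Rle_trans (_ : _ <= Cmod h * (M * Cmod h))%R _.
  have -> : (Cmod h * (M * Cmod h) = Cmod (E z) * (4 * (q * Cmod h * (q * Cmod h)) * exp q))%R.
    by rewrite /M; ring.
  apply: Rmult_le_compat_l; first exact: Cmod_ge_0.
  apply: Rle_trans b _; apply: Rmult_le_compat_l; first nra.
  apply: exp_le_mono; rewrite /q; nra.
rewrite Rmult_comm; apply: Rmult_le_compat_r => //.
apply: Rle_trans (_ : _ <= (M + 1) * Cmod h)%R _; first nra.
have -> : eps = ((M + 1) * (eps / (M + 1)))%R by field; lra.
apply: Rmult_le_compat_l; lra.
Qed.

Lemma E_ccont z : ccont E z.
Proof. exact: cderiv_ccont (E_cderiv z). Qed.

(** * Kronecker's expansion *)

(* [+1] on the quadrant [s <= a, r <= b], [-1] on the opposite one, [0] elsewhere;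
   in this form its dependence on [a] does not involve [b]. *)
Definition qsign (s r a b : Z) : C :=
  (if (s <=? a)%Z then RtoC 1 else 0) - (if (b <? r)%Z then RtoC 1 else 0).

Definition kron_term (tau : C) (s r : Z) (x y : C) (p : Z * Z) : C :=
  qsign s r p.1 p.2 * E (IZR p.1 * IZR p.2 * tau + IZR p.1 * x + IZR p.2 * y).

Lemma has_sum_Zshift (u : Z -> C) l (k : Z) : has_sum u l -> has_sum (fun m => u (m + k)%Z) l.
Proof.
move=> h; apply: (has_sum_bij (f := fun m => (m + k)%Z) (g := fun m => (m - k)%Z) _ _ h);
  move=> m; lia.
Qed.

Lemma Im_plus (a b : C) : Im (a + b) = (Im a + Im b)%R.
Proof. by []. Qed.

Section Kronecker.
Variable tau : C.
Hypothesis htau : (0 < Im tau)%R.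
Notation A := (Im tau).
Notation T z := (theta (1 / 2) (1 / 2) z tau).
Notation strip x := (0 < Im x < A)%R.

(** Where the sign is nonzero, [a] and [b] are both nonnegative or both negative. In the first case
    [a b A >= 0]; in the second [a b >= - a - b - 1], which replaces [Im x], [Im y] by their
    distances to the upper edge and costs the constant [exp (2 * PI * A)]. The rate [m] is the least
    distance to an edge. *)
Lemma summable_kron_term x y : strip x -> strip y -> summable (kron_term tau 0 0 x y).
Proof.
move=> hx hy; pose m := Rmin (Rmin (Im x) (A - Im x)) (Rmin (Im y) (A - Im y)).
have [m0 [mx [mx' [my my']]]] : (0 < m /\ m <= Im x /\ m <= A - Im x /\ m <= Im y /\ m <= A - Im y)%R.
  rewrite /m; split; first by repeat apply: Rmin_pos; lra.
  have := Rmin_l (Rmin (Im x) (A - Im x)) (Rmin (Im y) (A - Im y)).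
  have := Rmin_r (Rmin (Im x) (A - Im x)) (Rmin (Im y) (A - Im y)).
  have := Rmin_l (Im x) (A - Im x); have := Rmin_r (Im x) (A - Im x).
  have := Rmin_l (Im y) (A - Im y); have := Rmin_r (Im y) (A - Im y); lra.
have PI0 := PI_RGT_0.
have c0 : (0 < 2 * PI * m)%R by nra.
apply: (summable_dom (K := exp (2 * PI * A)) (summable_prod (summable_Zgeom c0) (summable_Zgeom c0))).
  exact/Rlt_le/exp_pos.
move=> [a b]; rewrite /kron_term /= !Cmod_mult !Cmod_R !(Rabs_pos_eq (exp _)); try exact/Rlt_le/exp_pos.
rewrite -!exp_plus /qsign.
have key : (((0 <= a)%Z /\ (0 <= b)%Z) \/ ((a < 0)%Z /\ (b < 0)%Z) ->
   1 * Cmod (E (IZR a * IZR b * tau + IZR a * x + IZR b * y)) <=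
   exp (2 * PI * A + (- (2 * PI * m * Rabs (IZR a)) + - (2 * PI * m * Rabs (IZR b)))))%R.
  rewrite Rmult_1_l Cmod_E !Im_plus -RtoC_mult !im_scal_l => hab.
  apply: exp_le_mono.
  suff : (m * Rabs (IZR a) + m * Rabs (IZR b) - A <= IZR a * IZR b * A + IZR a * Im x + IZR b * Im y)%R by nra.
  case: hab => [[/IZR_le a0 /IZR_le b0]|[a0 b0]].
    rewrite !Rabs_pos_eq //.
    have : (0 <= IZR a * IZR b)%R by nra.
    nra.
  have {}a0 : (IZR a <= -1)%R by apply: IZR_le; lia.
  have {}b0 : (IZR b <= -1)%R by apply: IZR_le; lia.
  rewrite !Rabs_left; try lra.
  have : (0 <= (- IZR a - 1) * (- IZR b - 1))%R by nra.
  have : (m * - IZR a <= (A - Im x) * - IZR a)%R by apply: Rmult_le_compat_r; lra.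
  have : (m * - IZR b <= (A - Im y) * - IZR b)%R by apply: Rmult_le_compat_r; lra.
  nra.
have z0 : (0 * Cmod (E (IZR a * IZR b * tau + IZR a * x + IZR b * y)) <=
   exp (2 * PI * A + (- (2 * PI * m * Rabs (IZR a)) + - (2 * PI * m * Rabs (IZR b)))))%R.
  by rewrite Rmult_0_l; exact/Rlt_le/exp_pos.
case: Z.leb_spec => ha; case: Z.ltb_spec => hb.
- by rewrite (_ : 1 - 1 = 0) ?Cmod_0 //; ring.
- by rewrite (_ : 1 - 0 = 1) ?Cmod_1; [apply: key; lia|ring].
- by rewrite (_ : 0 - 1 = - (1)) ?Cmod_m1; [apply: key; lia|ring].
- by rewrite (_ : 0 - 0 = 0) ?Cmod_0 //; ring.
Qed.

Lemma kron_term_sym x y a b : kron_term tau 0 0 x y (a, b) = kron_term tau 0 0 y x (b, a).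
Proof.
rewrite /kron_term /=; congr Cmult; last by congr E; ring.
rewrite /qsign; case: (Z.leb_spec 0 a); case: (Z.ltb_spec b 0); case: (Z.leb_spec 0 b);
  case: (Z.ltb_spec a 0); try lia; move=> *; ring.
Qed.

Lemma one_minus_E_neq0 x (b : Z) : Im x <> (- IZR b * A)%R -> 1 - E (x + IZR b * tau) <> 0.
Proof.
move=> h e; apply: h; have e1 : E (x + IZR b * tau) = 1.
  by have -> : E (x + IZR b * tau) = 1 - (1 - E (x + IZR b * tau)); [ring|rewrite e; ring].
have [k hk] := E_eq1 e1.
have := f_equal Im hk; rewrite Im_plus im_scal_l im_RtoC; lra.
Qed.

Lemma strip_mult x (b : Z) : strip x -> Im x <> (- IZR b * A)%R.
Proof.
move=> hx; case: (Z.le_gt_cases 0 b) => [/IZR_le|] hb; first nra.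
have : (IZR b <= -1)%R by apply: IZR_le; lia.
nra.
Qed.

(** Shifting [a] by one multiplies the exponential by [E w] and alters the sign at [a = 0] only, so
    the sum satisfies [l = E w * l + e]. This treats at once the geometric series over [a >= 0] (for
    [b >= 0]) and the one over [a < 0] (for [b < 0]). *)
Lemma kron_term_fiber x y (b : Z) : strip x -> strip y ->
  has_sum (fun a => kron_term tau 0 0 x y (a, b)) (E (IZR b * y) / (1 - E (x + IZR b * tau))).
Proof.
move=> hx hy; set w := x + IZR b * tau.
have nz : 1 - E w <> 0 by apply/one_minus_E_neq0/strip_mult.
have inj : injective (fun a : Z => (a, b)) by move=> a a' [].
have [l hl] := summable_has_sum (summable_comp inj (summable_kron_term hx hy)).
pose e := E (IZR b * y).
have := has_sum_plus (has_sum_scal (E w) (has_sum_Zshift (- (1)) hl)) (has_sum_single 0%Z e).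
set v := (X in has_sum X _) => hv.
have eq : l = E w * l + e.
  apply: (has_sum_unique hl); apply: has_sum_ext hv => a.
  rewrite /v /kron_term /=.
  have -> : E (IZR a * IZR b * tau + IZR a * x + IZR b * y) = E (IZR a * w) * e.
    by rewrite -E_plus; congr E; rewrite /w; ring.
  have -> : E (IZR (a + - (1)) * IZR b * tau + IZR (a + - (1)) * x + IZR b * y) = E (IZR a * w) / E w * e.
    rewrite /Cdiv -E_opp -!E_plus; congr E; rewrite /w; Cpush; ring.
  have wz := @E_neq0 w.
  case: eqP => [->|a0].
    rewrite Cmult_0_l E_0 /qsign /=; case: Z.ltb_spec => _; field; exact: wz.
  rewrite /qsign; case: Z.leb_spec => h1; case: Z.leb_spec => h2; try lia; field; exact: wz.
have -> : E (IZR b * y) / (1 - E w) = l => //.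
rewrite -/e; have -> : e = l - E w * l by rewrite {1}eq; ring.
by field.
Qed.

(** * Theta times the Kronecker series: Appell-Lerch sums *)

Definition theta_coef (m : Z) : C := theta_term (1 / 2) (1 / 2) 0 tau m.

(** Summed over [b], this is the coefficient of [E ((N + 1 / 2) y)] in the product of [T y] with the
    Kronecker series: an Appell-Lerch sum. *)
Definition appell_term (x : C) (N b : Z) : C := theta_coef (N - b) / (1 - E (x + IZR b * tau)).

(** The exponential has modulus at most [rho] or at least [1 / rho], and [1 / rho - 1 >= 1 - rho]
    lets one bound serve both cases. *)
Lemma one_minus_E_lower x (b : Z) d : (0 < d)%R -> (d <= Rabs (Im x + IZR b * A))%R ->
  (Cmod (/ (1 - E (x + IZR b * tau))) <= / (1 - exp (- (2 * PI * d))))%R.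
Proof.
move=> d0 hd; have PI0 := PI_RGT_0.
set rho := exp (- (2 * PI * d)).
have rho1 : (rho < 1)%R by rewrite /rho -exp_0; apply: exp_increasing; nra.
have rho0 : (0 < rho)%R := exp_pos _.
have e : (Im (x + IZR b * tau) = Im x + IZR b * A)%R by rewrite Im_plus im_scal_l.
have low : (1 - rho <= Cmod (1 - E (x + IZR b * tau)))%R.
  case: (Rle_lt_dec 0 (Im x + IZR b * A)) => h.
    rewrite Rabs_pos_eq // in hd.
    have : (Cmod (E (x + IZR b * tau)) <= rho)%R.
      by rewrite Cmod_E e; apply: exp_le_mono; nra.
    have := Cmod_triangle (1 - E (x + IZR b * tau)) (E (x + IZR b * tau)).
    rewrite (_ : 1 - _ + _ = 1); last by ring.
    rewrite Cmod_1; lra.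
  rewrite Rabs_left // in hd.
  have : (/ rho <= Cmod (E (x + IZR b * tau)))%R.
    by rewrite Cmod_E e /rho -exp_Ropp; apply: exp_le_mono; nra.
  have := Cmod_triangle (E (x + IZR b * tau) - 1) 1.
  rewrite (_ : E _ - 1 + 1 = E (x + IZR b * tau)); last by ring.
  rewrite -(Cmod_opp (1 - _)) (_ : - (1 - E (x + IZR b * tau)) = E (x + IZR b * tau) - 1); last by ring.
  rewrite Cmod_1.
  have : (1 + (1 - rho) <= / rho)%R.
    apply: (Rmult_le_reg_l rho) => //; rewrite Rinv_r; nra.
  lra.
rewrite Cmod_inv; first by apply: Rinv_le_contravar; lra.
by apply/Cmod_gt_0; lra.
Qed.

Lemma strip_away x (b : Z) : strip x -> (Rmin (Im x) (A - Im x) <= Rabs (Im x + IZR b * A))%R.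
Proof.
move=> hx; have := Rmin_l (Im x) (A - Im x); have := Rmin_r (Im x) (A - Im x) => h1 h2.
case: (Z.le_gt_cases 0 b) => [/IZR_le|] hb.
  by rewrite Rabs_pos_eq; nra.
have {}hb : (IZR b <= -1)%R by apply: IZR_le; lia.
rewrite Rabs_left; nra.
Qed.

Lemma summable_theta_coef_rev N : summable (fun b => theta_coef (N - b)).
Proof.
apply: summable_comp (summable_theta_term htau _ _ _) => a b; lia.
Qed.

Lemma summable_appell_term x N : strip x -> summable (appell_term x N).
Proof.
move=> hx; have d0 : (0 < Rmin (Im x) (A - Im x))%R by apply: Rmin_pos; lra.
have h b := one_minus_E_lower d0 (strip_away b hx).
apply: (summable_dom (summable_theta_coef_rev N)); last first.
  move=> b; rewrite /appell_term /Cdiv Cmod_mult Rmult_comm; apply: Rmult_le_compat_r (h b).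
  exact: Cmod_ge_0.
exact: Rle_trans (Cmod_ge_0 _) (h 0%Z).
Qed.

Lemma theta_coef_succ m : theta_coef (m + 1) = E ((IZR m + 1) * tau + 1 / 2) * theta_coef m.
Proof. by rewrite /theta_coef /theta_term -E_plus; congr E; Cpush; field. Qed.

Lemma theta_half_tau : T tau = 0.
Proof.
have := theta_half_Ztau htau 0 1; rewrite theta_half_0 // Cmult_0_r Cmult_1_l Cplus_0_l.
by [].
Qed.

(** Passing from [N] to [N + 1] multiplies the numerator by a constant times [1 / q], with
    [q = E (b tau)]. The partial fraction [1 / (q (1 - X q)) = 1 / q + X / (1 - X q)], [X = E x],
    splits off a sum proportional to [T tau = 0]. *)
Lemma appell_term_rec x N l : strip x -> has_sum (appell_term x N) l ->
  has_sum (appell_term x (N + 1)) (E (IZR (N + 1) * tau + 1 / 2 + x) * l).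
Proof.
move=> hx hl.
pose c := E (IZR (N + 1) * tau + 1 / 2).
have hT : has_sum (fun b => theta_coef (N - b) * E (- (IZR b * tau))) 0.
  have := theta_has_sum htau (1 / 2) (1 / 2) tau; rewrite theta_half_tau => h.
  have := has_sum_bij (f := fun b => (N - b)%Z) (g := fun b => (N - b)%Z) _ _ h.
  move=> /(_ ltac:(by move=> b; lia) ltac:(by move=> b; lia)) {}h.
  have := has_sum_scal (E (- (IZR N * tau) - tau / 2)) h; rewrite Cmult_0_r.
  apply: has_sum_ext => b; rewrite /theta_coef /theta_term -!E_plus; congr E; Cpush; field.
have := has_sum_scal c (has_sum_plus hT (has_sum_scal (E x) hl)).
rewrite Cplus_0_l Cmult_assoc -E_plus; apply: has_sum_ext => b.
rewrite /appell_term (_ : (N + 1 - b = N - b + 1)%Z); last by lia.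
rewrite theta_coef_succ; have nz := one_minus_E_neq0 (strip_mult (b := b) hx).
have e : E ((IZR (N - b) + 1) * tau + 1 / 2) = c * E (- (IZR b * tau)).
  by rewrite /c -E_plus; congr E; Cpush; ring.
rewrite e E_opp; rewrite E_plus in nz *; have nb := @E_neq0 (IZR b * tau); field; split; [exact: nb|exact: nz].
Qed.

Lemma appell_term_sum x l : strip x -> has_sum (appell_term x 0) l -> forall N : Z,
  has_sum (appell_term x N) (E (IZR N * (IZR N + 1) / 2 * tau + IZR N / 2 + IZR N * x) * l).
Proof.
move=> hx hl; elim/Z.peano_ind => [|N IH|N IH].
- rewrite (_ : _ + _ + _ = 0); last by field.
  by rewrite E_0 Cmult_1_l.
- have := appell_term_rec hx IH; rewrite -Z.add_1_r Cmult_assoc -E_plus.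
  by congr (has_sum _ (E _ * _)); Cpush; field.
- have [m hm] := summable_has_sum (summable_appell_term (Z.pred N) hx).
  have := appell_term_rec hx hm; rewrite Z.add_1_r Z.succ_pred => h.
  have e := has_sum_unique h IH.
  set M := Z.pred N; rewrite -/M in hm h e.
  have -> // : E (IZR M * (IZR M + 1) / 2 * tau + IZR M / 2 + IZR M * x) * l = m.
  have nz := @E_neq0 (IZR N * tau + 1 / 2 + x).
  have -> : m = / E (IZR N * tau + 1 / 2 + x) * (E (IZR N * tau + 1 / 2 + x) * m) by field.
  rewrite e -E_opp Cmult_assoc -E_plus /M -Z.sub_1_r; congr (E _ * _); Cpush; field.
Qed.

(** What remains when the square is completed in [N (N + 1) / 2] to recognise the series of
    [T (x + y)], centred at [N + 1 / 2]. *)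
Definition appell_factor (x : C) : C := E (- (tau / 8) - 1 / 4 - x / 2).

(** Kronecker's identity with the factor [D], the Appell-Lerch sum at [N = 0], still undetermined.
    It holds without division, so that it can be applied at a hypothetical zero of [T]. *)
Lemma kronecker_half x y k D : strip x -> strip y ->
  has_sum (kron_term tau 0 0 x y) k -> has_sum (appell_term x 0) D ->
  T y * k = appell_factor x * D * T (x + y).
Proof.
move=> hx hy hk hD.
have sy := summable_theta_term htau (1 / 2) (1 / 2) y.
have h1 := has_sum_prod sy (summable_kron_term hx hy) (theta_has_sum htau (1 / 2) (1 / 2) y) hk.
(* Sum over [a] first, then reindex by [N = m + b]. *)
pose f (q : (Z * Z) * Z) : Z * (Z * Z) := ((q.1.1 - q.1.2)%Z, (q.2, q.1.2)).
pose g (q : Z * (Z * Z)) : (Z * Z) * Z := (((q.1 + q.2.2)%Z, q.2.2), q.2.1).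
have fg : cancel f g by move=> [[N b] a]; rewrite /f /g /=; congr (_, _, _); lia.
have gf : cancel g f by move=> [m [a b]]; rewrite /f /g /=; congr (_, _); lia.
have h2 := has_sum_bij fg gf h1.
pose v (q : Z * Z) := theta_term (1 / 2) (1 / 2) y tau (q.1 - q.2) *
   (E (IZR q.2 * y) / (1 - E (x + IZR q.2 * tau))).
have h3 : has_sum v (T y * k).
  apply: (has_sum_fubini h2) => -[N b]; rewrite /v /f /=.
  exact: has_sum_scal (kron_term_fiber b hx hy).
pose e N := E (IZR N * y + y / 2) * (E (IZR N * (IZR N + 1) / 2 * tau + IZR N / 2 + IZR N * x) * D).
have h4 : has_sum e (T y * k).
  apply: (has_sum_fubini h3) => N.
  apply: has_sum_ext (has_sum_scal _ (appell_term_sum hx hD N)) => b.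
  rewrite /v /appell_term /theta_coef /= /Cdiv !Cmult_assoc; congr Cmult.
  by rewrite /theta_term -!E_plus; congr E; Cpush; field.
apply: (has_sum_unique h4).
apply: has_sum_ext (has_sum_scal (appell_factor x * D) (theta_has_sum htau (1 / 2) (1 / 2) (x + y))) => N.
rewrite /e /appell_factor (_ : forall a b c : C, a * b * c = a * c * b); last by move=> *; ring.
rewrite (_ : forall a b c : C, a * (b * c) = a * b * c); last by move=> *; ring.
rewrite /theta_term -!E_plus; congr (E _ * _); Cpush; field.
Qed.

End Kronecker.

(** * Zeros of theta and the constant in Kronecker's identity *)

Section KroneckerFull.
Variable tau : C.
Hypothesis htau : (0 < Im tau)%R.
Notation A := (Im tau).
Notation T z := (theta (1 / 2) (1 / 2) z tau).
Notation strip x := (0 < Im x < A)%R.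

Lemma appell_factor_0 : appell_factor tau 0 * theta_coef tau 0 = 1.
Proof.
rewrite /appell_factor /theta_coef /theta_term -E_plus -[RHS]E_0; congr E; Cpush; field.
Qed.

(** At [x = 0] only the term [b = 0] has a pole. For [b <> 0] the imaginary part of [x + b tau]
    stays at distance at least [A / 2] from 0, which bounds the rest uniformly; hence the
    restriction to [Im x <= A / 2]. *)
Lemma appell_near_0 : exists2 M : R, (0 <= M)%R & forall x D, (0 < Im x <= A / 2)%R ->
  has_sum (appell_term tau x 0) D ->
  (Cmod (D * (1 - E x) - theta_coef tau 0) <= M * Cmod (1 - E x))%R.
Proof.
have [M0 hM0] := summable_theta_coef_rev htau 0.
pose K := (/ (1 - exp (- (2 * PI * (A / 2)))))%R.
have d0 : (0 < A / 2)%R by lra.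
have PI0 := PI_RGT_0.
have K0 : (0 <= K)%R.
  apply/Rlt_le/Rinv_0_lt_compat.
  have : (exp (- (2 * PI * (A / 2))) < 1)%R by rewrite -exp_0; apply: exp_increasing; nra.
  lra.
have M00 : (0 <= M0)%R by apply: Rle_trans (hM0 [::] isT); exact: nsum_ge0.
exists (K * M0)%R; first exact: Rmult_le_pos.
move=> x D hx hD.
have hs : strip x by lra.
have nz : 1 - E x <> 0.
  have := one_minus_E_neq0 (strip_mult (b := 0) hs).
  by rewrite (_ : x + IZR 0 * tau = x) //; ring.
pose c := theta_coef tau 0 / (1 - E x).
have hv := has_sum_plus hD (has_sum_scal (- (1)) (has_sum_single 0%Z c)).
have -> : D * (1 - E x) - theta_coef tau 0 = (D + - (1) * c) * (1 - E x).
  by rewrite /c; field.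
rewrite Cmod_mult; apply: Rmult_le_compat_r; first exact: Cmod_ge_0.
apply: (has_sum_Cmod_le hv) => s us.
apply: Rle_trans (Rmult_le_compat_l _ _ _ K0 (hM0 s us)).
apply: nsum_le => b; case: eqP => [->|b0].
  rewrite (_ : _ + _ = 0); last first.
    by rewrite /c /appell_term Z.sub_diag (_ : x + IZR 0 * tau = x); [field|ring].
  by rewrite Cmod_0; apply: Rmult_le_pos => //; exact: Cmod_ge_0.
rewrite Cmult_0_r Cplus_0_r /appell_term /Cdiv Cmod_mult Rmult_comm.
apply: Rmult_le_compat_r; first exact: Cmod_ge_0.
apply: one_minus_E_lower => //.
case: (Z.le_gt_cases 0 b) => hb.
  have {}hb : (1 <= IZR b)%R by apply: IZR_le; lia.
  rewrite Rabs_pos_eq; nra.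
have {}hb : (IZR b <= -1)%R by apply: IZR_le; lia.
rewrite Rabs_left; nra.
Qed.

Lemma theta_coef_neq0 m : theta_coef tau m <> 0.
Proof. exact: E_neq0. Qed.

(** Near 0 the polar term [theta_coef tau 0 / (1 - E x)] dominates the bounded rest. *)
Lemma appell_nonzero : exists2 eps : R, (0 < eps < A / 2)%R & forall x D, (0 < Im x)%R ->
  (Cmod x < eps)%R -> has_sum (appell_term tau x 0) D -> D <> 0.
Proof.
have [M M0 hM] := appell_near_0.
have g0 : (0 < Cmod (theta_coef tau 0))%R by apply/Cmod_gt_0; exact: theta_coef_neq0.
have [d d0 hd] := @E_ccont 0 (Cmod (theta_coef tau 0) / (M + 1))%R ltac:(apply: Rdiv_lt_0_compat; lra).
exists (Rmin d (A / 4))%R.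
  by split; [apply: Rmin_pos; lra|have := Rmin_r d (A / 4); lra].
move=> x D hx xs hD D0.
have x1 := Rlt_le_trans _ _ _ xs (Rmin_l _ _).
have x2 := Rlt_le_trans _ _ _ xs (Rmin_r _ _).
have := im_le_Cmod x; rewrite Rabs_pos_eq => [hi|]; last lra.
have := hM x D ltac:(lra) hD; rewrite D0.
have -> : 0 * (1 - E x) - theta_coef tau 0 = - theta_coef tau 0 by ring.
rewrite Cmod_opp.
have := hd x x1; rewrite E_0 Cplus_0_l -Cmod_opp.
have -> : - (E x - 1) = 1 - E x by ring.
move=> a b; have := Cmod_ge_0 (1 - E x) => c.
have : ((M + 1) * Cmod (1 - E x) < Cmod (theta_coef tau 0))%R.
  have -> : Cmod (theta_coef tau 0) = ((M + 1) * (Cmod (theta_coef tau 0) / (M + 1)))%R by field; lra.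
  apply: Rmult_lt_compat_l; lra.
nra.
Qed.

(** If [T x = 0], then [kronecker_half] makes [appell_factor tau y * D * T (y + x)] vanish, and [D]
    is nonzero for small [y] above the real axis, so [T (y + x) = 0]. The real shift [t] is reached
    from above by continuity; [eps] does not depend on [x], which allows iteration. *)
Lemma theta_half_zero_spreads : exists2 eps : R, (0 < eps)%R & forall x, strip x -> T x = 0 ->
  forall t : R, (Rabs t < eps)%R -> T (x + t) = 0.
Proof.
have [eps heps hD] := appell_nonzero.
exists (eps / 2)%R; first lra.
move=> x hx Tx t ht; apply: NNPP => nz.
have p : (0 < Cmod (T (x + t)))%R by apply/Cmod_gt_0.
have [d d0 hd] := @theta_ccont tau htau (1 / 2) (1 / 2) (x + t) _ p.
pose s := (Rmin d eps / 2)%R.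
have hs : (0 < s /\ s < d /\ s <= eps / 2)%R.
  have := Rmin_pos _ _ d0 (proj1 heps); have := Rmin_l d eps; have := Rmin_r d eps.
  by rewrite /s; lra.
have hm : Cmod (s * Ci) = s by rewrite Cmod_mult Cmod_Ci Cmod_R Rabs_pos_eq; lra.
pose y := t + s * Ci.
have Iy : Im y = s by rewrite /y /Cplus /Cmult /Ci /RtoC /Im /=; ring.
have hy : strip y by rewrite Iy; lra.
have ny : (Cmod y < eps)%R.
  by apply: Rle_lt_trans (Cmod_triangle _ _) _; rewrite hm Cmod_R; lra.
have [k hk] := summable_has_sum (summable_kron_term hy hx).
have [D hDy] := summable_has_sum (summable_appell_term htau 0 hy).
have := kronecker_half htau hy hx hk hDy; rewrite Tx Cmult_0_l => e.
have T0 : T (y + x) = 0.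
  apply: NNPP => n0; have : appell_factor tau y * D * T (y + x) <> 0.
    apply: Cmult_neq_0 => //; apply: Cmult_neq_0; first exact: E_neq0.
    by apply: hD hDy => //; lra.
  by rewrite -e; apply.
have := hd (s * Ci); rewrite hm => /(_ ltac:(lra)).
have -> : x + t + s * Ci = y + x by rewrite /y; ring.
rewrite T0 (_ : 0 - _ = - T (x + t)); last by ring.
by rewrite Cmod_opp; lra.
Qed.

Lemma theta_half_neq0_strip x : strip x -> T x <> 0.
Proof.
move=> hx Tx; have [eps he h] := theta_half_zero_spreads.
have key (k : nat) : forall t : R, (Rabs t <= INR k * (eps / 2))%R -> T (x + t) = 0.
  elim: k => [|k IH] t ht.
    have -> : t = 0%R by rewrite /= Rmult_0_l in ht; split_Rabs; lra.
    by rewrite Cplus_0_r.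
  rewrite S_INR in ht; have k0 := pos_INR k.
  (* Splits [t] into a part within [k] steps of length [eps / 2] and a remainder within one such
     step. *)
  pose r := (INR k / (INR k + 1))%R.
  have r0 : (0 <= r)%R by apply: Rdiv_le_0_compat; lra.
  have e1 : (r * (INR k + 1) = INR k)%R by rewrite /r; field; lra.
  have r1 : (r <= 1)%R by nra.
  have -> : x + t = x + (t * r)%R + (t * (1 - r))%R.
    by rewrite -Cplus_assoc -RtoC_plus; congr (_ + RtoC _); ring.
  apply: h.
  - by rewrite Im_plus im_RtoC Rplus_0_r.
  - apply: IH; rewrite Rabs_mult (Rabs_pos_eq r) //.
    have : (Rabs t * r <= (INR k + 1) * (eps / 2) * r)%R by apply: Rmult_le_compat_r.
    nra.
  - rewrite Rabs_mult (Rabs_pos_eq (1 - r)); last lra.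
    have : (Rabs t * (1 - r) <= (INR k + 1) * (eps / 2) * (1 - r))%R by apply: Rmult_le_compat_r; lra.
    nra.
apply: (theta_half_line_neq0 htau (x0 := x)) => t.
have [k hk] := INR_unbounded (Rabs t / (eps / 2)).
apply: (key k).
have -> : Rabs t = (Rabs t / (eps / 2) * (eps / 2))%R by field; lra.
apply: Rmult_le_compat_r; lra.
Qed.

(** The Kronecker sum [k] is symmetric, so comparing [kronecker_half] for [(x, y)] and [(y, x)] and
    dividing by [T (x + y)] equates the expression at [x] and at [y]. This requires [x + y] in the
    strip; arbitrary points are compared through a third one, [w], of small height. *)
Lemma theta_appell_const : exists2 c : C, c <> 0 & forall x D, strip x -> has_sum (appell_term tau x 0) D ->
  T x * (appell_factor tau x * D) = c.
Proof.
have loc x y D D' : strip x -> strip y -> (Im x + Im y < A)%R -> has_sum (appell_term tau x 0) D ->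
    has_sum (appell_term tau y 0) D' -> T x * (appell_factor tau x * D) = T y * (appell_factor tau y * D').
  move=> hx hy hxy hD hD'.
  have [k hk] := summable_has_sum (summable_kron_term hx hy).
  have e1 := kronecker_half htau hx hy hk hD.
  have hk' : has_sum (kron_term tau 0 0 y x) k.
    pose sw (p : Z * Z) := (p.2, p.1).
    have := has_sum_bij (f := sw) (g := sw) _ _ hk.
    move=> /(_ ltac:(by case) ltac:(by case)).
    by apply: has_sum_ext => -[a b]; rewrite /sw /= kron_term_sym.
  have e2 := kronecker_half htau hy hx hk' hD'.
  have nz : T (x + y) <> 0 by apply: theta_half_neq0_strip; rewrite Im_plus; lra.
  have -> : T x * (appell_factor tau x * D) = T x * (appell_factor tau x * D * T (x + y)) / T (x + y) by field.
  rewrite -e1.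
  have -> : T y * (appell_factor tau y * D') = T y * (appell_factor tau y * D' * T (x + y)) / T (x + y) by field.
  by rewrite (Cplus_comm x y) -e2; congr (_ / _); ring.
have [eps heps hD] := appell_nonzero.
pose z : C := (eps / 2)%R * Ci.
have Iz : Im z = (eps / 2)%R by rewrite /z /Cmult /Ci /RtoC /Im /=; ring.
have hz : strip z by rewrite Iz; lra.
have [D0 hD0] := summable_has_sum (summable_appell_term htau 0 hz).
exists (T z * (appell_factor tau z * D0)).
  apply: Cmult_neq_0; first exact: theta_half_neq0_strip.
  apply: Cmult_neq_0; first exact: E_neq0.
  apply: hD hD0; first by rewrite Iz; lra.
  by rewrite /z Cmod_mult Cmod_Ci Cmod_R Rabs_pos_eq; lra.
move=> x D hx hDx.
pose w : C := (Rmin (A - Im x) (A - Im z) / 2)%R * Ci.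
have Iw : Im w = (Rmin (A - Im x) (A - Im z) / 2)%R by rewrite /w /Cmult /Ci /RtoC /Im /=; ring.
have hw : strip w /\ (Im x + Im w < A)%R /\ (Im z + Im w < A)%R.
  have := Rmin_l (A - Im x) (A - Im z); have := Rmin_r (A - Im x) (A - Im z).
  have : (0 < Rmin (A - Im x) (A - Im z))%R by apply: Rmin_pos; lra.
  by rewrite Iw; lra.
have [D1 hD1] := summable_has_sum (summable_appell_term htau 0 (proj1 hw)).
rewrite (loc x w D D1) ?(loc z w D0 D1) //; tauto.
Qed.

Section Constant.
Variable c : C.
Hypothesis c0 : c <> 0.
Hypothesis hc : forall x D, strip x -> has_sum (appell_term tau x 0) D -> T x * (appell_factor tau x * D) = c.

Lemma Im_ray (x : R) (s : R) : Im (x + s * Ci) = s.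
Proof. by rewrite /Cplus /Cmult /Ci /RtoC /Im /=; ring. Qed.

Lemma regular_part (x s : R) (M : R) : (0 < s <= A / 2)%R ->
  (forall x D, (0 < Im x <= A / 2)%R -> has_sum (appell_term tau x 0) D ->
     (Cmod (D * (1 - E x) - theta_coef tau 0) <= M * Cmod (1 - E x))%R) ->
  let z := x + s * Ci in
  (Cmod (c * (1 - E z) / (T z * appell_factor tau z) - theta_coef tau 0) <= M * Cmod (1 - E z))%R.
Proof.
move=> hs hM z; have Iz : Im z = s := Im_ray x s.
have hz : strip z by rewrite Iz; lra.
have [D hD] := summable_has_sum (summable_appell_term htau 0 hz).
have := hM z D ltac:(rewrite Iz; lra) hD.
rewrite -(hc hz hD).
have nz := theta_half_neq0_strip hz; have kz : appell_factor tau z <> 0 := @E_neq0 _.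
have -> : T z * (appell_factor tau z * D) * (1 - E z) / (T z * appell_factor tau z) = D * (1 - E z) by field.
by [].
Qed.

Lemma appell_factor_ccont z : ccont (appell_factor tau) z.
Proof.
move=> eps he; have [d d0 hd] := @E_ccont (- (tau / 8) - 1 / 4 - z / 2) eps he.
exists d => // h hh; have := hd (- (h / 2)).
rewrite /appell_factor.
have -> : - (tau / 8) - 1 / 4 - z / 2 + - (h / 2) = - (tau / 8) - 1 / 4 - (z + h) / 2 by field.
apply; rewrite Cmod_opp Cmod_div; last by apply: RtoC_neq0; lra.
rewrite Cmod_R Rabs_pos_eq; last lra.
have := Cmod_ge_0 h; lra.
Qed.

Lemma lim0_E_ray (x : R) : lim0 (fun s => 1 - E (x + s * Ci)) (1 - E x).
Proof.
apply: lim0_minus (lim0_const _) _.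
exact: lim0_comp (@E_ccont _) (lim0_line _ _).
Qed.

(** The strip excludes the real axis, which is approached along [x + s * Ci]. There the quotient of
    [c * (1 - E z)] by [T z * appell_factor tau z] stays bounded, so a zero of [T] at [x] would
    force [c * (1 - E x) = 0]. *)
Lemma theta_half_real_neq0 (x : R) : (forall k : Z, x <> IZR k) -> T x <> 0.
Proof.
move=> hx Tx; have [M M0 hM] := appell_near_0.
have nE : 1 - E x <> 0.
  move=> h; have [k hk] : exists k : Z, RtoC x = IZR k.
    by apply: E_eq1; symmetry; apply/Ceq_minus.
  exact: hx (RtoC_inj _ _ hk).
have lT : lim0 (fun s => T (x + s * Ci)) 0.
  by rewrite -Tx; apply: (lim0_comp (g := fun z => T z)); [exact: theta_ccont|exact: lim0_line].
have lk : lim0 (fun s => appell_factor tau (x + s * Ci)) (appell_factor tau x).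
  by apply: lim0_comp; [exact: appell_factor_ccont|exact: lim0_line].
have l1 := lim0_mult lT lk; rewrite Cmult_0_l in l1.
have d0 : (0 < A / 2)%R by lra.
have l2 := lim0_bounded_mult (B := (Cmod (theta_coef tau 0) + M * 2)%R) d0 l1
  (g := fun s => c * (1 - E (x + s * Ci)) / (T (x + s * Ci) * appell_factor tau (x + s * Ci))).
have {}l2 := l2 _.
have {}l2 : lim0 (fun s => c * (1 - E (x + s * Ci))) 0.
  apply: (lim0_ext d0 _ (l2 _)) => s hs.
    have nz : T (x + s * Ci) <> 0 by apply: theta_half_neq0_strip; rewrite Im_ray; lra.
    have kz : appell_factor tau (x + s * Ci) <> 0 := @E_neq0 _.
    by field.
  have := regular_part x (s := s) ltac:(lra) hM.
  set g := _ / _ => /= hg; rewrite -/g in hg.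
  have hE : (Cmod (1 - E (x + s * Ci)) <= 2)%R.
    apply: Rle_trans (Cmod_triangle _ _) _; rewrite Cmod_opp Cmod_1 Cmod_E Im_ray.
    have : (exp (- (2 * PI * s)) <= 1)%R.
      by rewrite -exp_0; apply: exp_le_mono; have := PI_RGT_0; nra.
    lra.
  have := Cmod_triangle (g - theta_coef tau 0) (theta_coef tau 0).
  have -> : g - theta_coef tau 0 + theta_coef tau 0 = g by ring.
  have := Rmult_le_compat_l _ _ _ M0 hE; lra.
have l3 := lim0_mult (lim0_const c) (lim0_E_ray x).
exact: (Cmult_neq_0 _ _ c0 nE (lim0_unique l3 l2)).
Qed.

(** Along [s * Ci] the quotient of [c * (1 - E z)] by [T z * appell_factor tau z] tends to
    [theta_coef tau 0], the inverse of [appell_factor tau 0]. Hence [T z] and [c * (1 - E z)] have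
    the same first-order term at 0. *)
Lemma theta_half_deriv_const : C_derive (fun z => T z) 0 = - (2 * PI * Ci) * c.
Proof.
have [l hl] := theta_cderiv htau (1 / 2) (1 / 2) 0.
rewrite (cderiv_Cderive hl).
have [M M0 hM] := appell_near_0.
have d0 : (0 < A / 2)%R by lra.
pose g s := c * (1 - E (0%R + s * Ci)) / (T (0%R + s * Ci) * appell_factor tau (0%R + s * Ci)).
have lg : lim0 g (theta_coef tau 0).
  have h := lim0_E_ray 0; rewrite E_0 (_ : 1 - 1 = 0) in h; last by ring.
  have {}h := lim0_mult (lim0_const M) h; rewrite Cmult_0_r in h.
  move=> eps he; have [d p hd] := h eps he.
  exists (Rmin d (A / 2)); first by apply: Rmin_pos; lra.
  move=> s hs; have := Rmin_l d (A / 2); have := Rmin_r d (A / 2) => a b.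
  apply: Rle_lt_trans (regular_part 0 (s := s) ltac:(lra) hM) _.
  have := hd s ltac:(lra).
  rewrite (_ : M * _ - 0 = M * (1 - E (0%R + s * Ci))); last by ring.
  by rewrite Cmod_mult Cmod_R (Rabs_pos_eq M).
have lk : lim0 (fun s => appell_factor tau (0%R + s * Ci)) (appell_factor tau 0).
  by apply: lim0_comp; [exact: appell_factor_ccont|exact: lim0_line].
have lT := lim0_cderiv Ci hl; rewrite theta_half_0 // in lT.
have lE := lim0_cderiv Ci (@E_cderiv 0); rewrite E_0 in lE.
have l1 := lim0_mult lT (lim0_mult lk lg); rewrite appell_factor_0 Cmult_1_r in l1.
have l2 := lim0_mult (lim0_const (- c)) lE.
have e : l * Ci = - c * (1 * (2 * PI * Ci) * Ci).
  apply: (lim0_unique l1); apply: (lim0_ext d0 _ l2) => s hs.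
  have nz : T (0%R + s * Ci) <> 0 by apply: theta_half_neq0_strip; rewrite Im_ray; lra.
  have kz : appell_factor tau (0%R + s * Ci) <> 0 := @E_neq0 _.
  have sz : RtoC s <> 0 by apply: RtoC_neq0; lra.
  by rewrite /g; field.
have -> : l = l * Ci / Ci by field; exact: Ci_nz.
by rewrite e; field; exact: Ci_nz.
Qed.

End Constant.

Lemma theta_zero_lattice z : T z = 0 -> lattice tau z.
Proof.
move=> Tz; have [c c0 hc] := theta_appell_const.
have [q hq] := floor_ex (Im z / A).
have [h1 h2] : (IZR q * A <= Im z < IZR q * A + A)%R.
  have e : Im z = (Im z / A * A)%R by field; lra.
  split; first by rewrite e; apply: Rmult_le_compat_r; lra.
  have := Rmult_lt_compat_r A _ _ htau (proj2 hq); lra.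
pose w := z + (IZR 0 + IZR (- q) * tau).
have Iw : Im w = (Im z - IZR q * A)%R.
  by rewrite /w !Im_plus im_RtoC im_scal_l opp_IZR; ring.
have [u _ hu] := theta_half_lattice htau z 0 (- q).
have Tw : T w = 0 by rewrite /w hu Tz Cmult_0_r.
have [s|e] : (0 < Im w)%R \/ Im w = 0%R by rewrite Iw; lra.
  by case: (@theta_half_neq0_strip w); rewrite // Iw; rewrite Iw in s; lra.
have ew : w = RtoC (Re w) by move: e; case: (w) => a b /= ->.
have [k hk] : exists k : Z, Re w = IZR k.
  apply: NNPP => hn; apply: (theta_half_real_neq0 c0 hc (x := Re w)); last by rewrite -ew.
  by move=> k hk; apply: hn; exists k.
exists k, q; have -> : z = w + IZR q * tau by rewrite /w opp_IZR RtoC_opp; ring.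
by rewrite ew hk.
Qed.

Definition kron_fun x y : C := C_derive (fun z => T z) 0 * T (x + y) / (T x * T y).

Lemma kron_fun_Ztau x y (r s : Z) : T x <> 0 -> T y <> 0 ->
  kron_fun (x + IZR r * tau) (y + IZR s * tau) =
  E (- (IZR r * IZR s * tau + IZR r * y + IZR s * x)) * kron_fun x y.
Proof.
move=> nx ny; rewrite /kron_fun.
have -> : x + IZR r * tau + (y + IZR s * tau) = (x + y) + IZR (r + s) * tau by Cpush; ring.
rewrite !theta_half_Ztau //.
set ex := E _; set ey := E (- (IZR r * _ * _ / _ + _)); set ez := E (- (IZR s * _ * _ / _ + _)).
set e := E _.
have -> : ex = e * ey * ez.
  by rewrite /ex /e /ey /ez -!E_plus; congr E; Cpush; field.
have ny0 : ey <> 0 := @E_neq0 _. have nz0 : ez <> 0 := @E_neq0 _.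
by field.
Qed.

Lemma theta_half_deriv_neq0 : C_derive (fun z => T z) 0 <> 0.
Proof.
have [c c0 hc] := theta_appell_const; rewrite (theta_half_deriv_const hc).
have p : RtoC PI <> 0 by apply: RtoC_neq0; have := PI_RGT_0; lra.
apply: Cmult_neq_0 => //.
have -> : - (2 * PI * Ci) = - (2) * (PI * Ci) by ring.
apply: Cmult_neq_0; first by rewrite -RtoC_opp; apply: RtoC_neq0; lra.
exact: Cmult_neq_0 p Ci_nz.
Qed.

(** The integers [r], [s] move [x], [y] into the basic strip. The quasi-periodicity factor of
    [kron_fun] is absorbed by the translation [(a, b) |-> (a - s, b - r)], so that only the
    thresholds of the sign change. *)
Lemma kronecker x y (s r : Z) : (0 < Im x + IZR r * A < A)%R -> (0 < Im y + IZR s * A < A)%R ->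
  summable (kron_term tau s r x y) /\
  has_sum (fun p => - (2 * PI * Ci) * kron_term tau s r x y p) (kron_fun x y).
Proof.
move=> hx hy; have [c c0 hc] := theta_appell_const.
pose x' := x + IZR r * tau; pose y' := y + IZR s * tau.
have hx' : strip x' by rewrite Im_plus im_scal_l.
have hy' : strip y' by rewrite Im_plus im_scal_l.
have sk := summable_kron_term hx' hy'.
have [k hk] := summable_has_sum sk.
have [D hD] := summable_has_sum (summable_appell_term htau 0 hx').
have nx' := theta_half_neq0_strip hx'. have ny' := theta_half_neq0_strip hy'.
have nx : T x <> 0 by move: nx'; rewrite /x' theta_half_Ztau // => h e; apply: h; rewrite e Cmult_0_r.
have ny : T y <> 0 by move: ny'; rewrite /y' theta_half_Ztau // => h e; apply: h; rewrite e Cmult_0_r.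
have e1 := kronecker_half htau hx' hy' hk hD.
have e2 := hc _ _ hx' hD.
have eG : kron_fun x' y' = - (2 * PI * Ci) * k.
  rewrite /kron_fun (theta_half_deriv_const hc) -e2.
  have -> : k = T y' * k / T y' by field.
  by rewrite e1; field.
pose f (p : Z * Z) := ((p.1 - s)%Z, (p.2 - r)%Z).
pose g (p : Z * Z) := ((p.1 + s)%Z, (p.2 + r)%Z).
have fg : cancel f g by move=> [a b]; rewrite /f /g /=; congr (_, _); lia.
have gf : cancel g f by move=> [a b]; rewrite /f /g /=; congr (_, _); lia.
pose e := E (IZR r * IZR s * tau + IZR r * y + IZR s * x).
have ek p : kron_term tau s r x y p = e * kron_term tau 0 0 x' y' (f p).
  case: p => a b; rewrite /kron_term /f /=.
  have -> : qsign s r a b = qsign 0 0 (a - s) (b - r).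
    rewrite /qsign; case: (Z.leb_spec s a); case: (Z.ltb_spec b r); case: (Z.leb_spec 0 (a - s));
      case: (Z.ltb_spec (b - r) 0) => ? ? ? ?; first [by [] | lia].
  rewrite (_ : forall u v w : C, u * (v * w) = v * (u * w)); last by move=> *; ring.
  by congr Cmult; rewrite /e -E_plus /x' /y'; congr E; Cpush; ring.
split.
  apply: summable_ext (summable_scal e (summable_comp (can_inj fg) sk)) => p.
  by rewrite ek.
have h := has_sum_scal (- (2 * PI * Ci) * e) (has_sum_bij fg gf hk).
have -> : kron_fun x y = - (2 * PI * Ci) * e * k.
  have := kron_fun_Ztau r s nx ny; rewrite -/x' -/y' eG E_opp -/e => eq.
  have ne : e <> 0 := @E_neq0 _.
  have -> : kron_fun x y = e * (/ e * kron_fun x y) by field.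
  by rewrite -eq; ring.
by apply: has_sum_ext h => p; rewrite ek Cmult_assoc.
Qed.

End KroneckerFull.

(** * The operator on products of theta functions *)

Lemma lattice_Im tau z : (0 < Im tau)%R -> lattice tau z ->
  exists q : Z, Im z = (IZR q * Im tau)%R.
Proof.
by move=> htau [p [q ->]]; exists q; rewrite Im_plus im_RtoC im_scal_l; ring.
Qed.

Lemma strip_not_lattice tau z (s : Z) : (0 < Im tau)%R ->
  (0 < Im z + IZR s * Im tau < Im tau)%R -> ~ lattice tau z.
Proof.
move=> htau hz /(lattice_Im htau) [q hq]; move: hz.
have -> : (Im z + IZR s * Im tau = IZR (q + s) * Im tau)%R by rewrite plus_IZR hq; ring.
case: (Z.le_gt_cases (q + s) 0) => [/IZR_le|] h; first nra.
have : (1 <= IZR (q + s))%R by apply: IZR_le; lia.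
nra.
Qed.

Lemma lattice_opp tau z : lattice tau z -> lattice tau (- z).
Proof.
by move=> [p [q ->]]; exists (- p)%Z, (- q)%Z; rewrite !opp_IZR !RtoC_opp; ring.
Qed.

(** * Theta functions and matrix entries at level n *)

Section Level.
Variables (n : nat) (tau : C).
Hypotheses (hn : (1 <= n)%N) (htau : (0 < Im tau)%R).
Notation N := (INR n).
Notation nZ := (Z.of_nat n).
Notation A := (Im tau).
Notation ntau := (INR n * tau).
Notation c0 := (- (2 * PI * Ci)).

Lemma N_ge1 : (1 <= N)%R.
Proof. by apply: (le_INR 1); lia. Qed.

Lemma CN_neq0 : RtoC N <> 0.
Proof. by apply: CINR_neq0. Qed.

Lemma N_IZR : N = IZR nZ.
Proof. exact: INR_IZR_INZ. Qed.

Lemma Im_ntau : Im ntau = (N * A)%R.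
Proof. exact: im_scal_l. Qed.

Lemma hntau : (0 < Im ntau)%R.
Proof. by rewrite Im_ntau; have := N_ge1; nra. Qed.

Definition psi_term (z : C) (m : Z) : C :=
  let x := RtoC (IZR m - (N - 1) / 2)%R in E (x * x * tau / N / 2 + x * z).

Lemma psi_term_theta_term z a k :
  psi_term z (a + nZ * k) = theta_term ((IZR a - (N - 1) / 2) / N) 0 (N * z) ntau k.
Proof.
have nz := CN_neq0; have nz' := INR_neq0 hn.
rewrite /psi_term /theta_term.
have -> : RtoC (IZR k + (IZR a - (N - 1) / 2) / N)%R = RtoC (IZR (a + nZ * k) - (N - 1) / 2)%R / N.
  by rewrite -RtoC_div //; congr RtoC; rewrite plus_IZR mult_IZR -N_IZR; field.
by congr E; field.
Qed.

Lemma summable_psi_term z a : summable (fun k => psi_term z (a + nZ * k)).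
Proof.
by apply: summable_ext (summable_theta_term hntau _ _ _) => k; rewrite psi_term_theta_term.
Qed.

Lemma psi_theta (a : 'I_n) z :
  psi tau a z = theta ((IZR (Z.of_nat a) - (N - 1) / 2) / N) 0 (N * z) ntau.
Proof.
rewrite /psi; apply: Z_has_sum; first apply: summable_ext (summable_psi_term z (Z.of_nat a)) => k; last first.
  apply: has_sum_ext (theta_has_sum hntau _ _ _) => k; rewrite -psi_term_theta_term.
  all: rewrite /psi_term E_Cexp; congr Cexp; rewrite /= Rmult_1_r RtoC_mult.
  all: field; exact: CN_neq0.
Qed.

Lemma psi_has_sum (a : 'I_n) z (m : Z) : ((m - Z.of_nat a) mod nZ = 0)%Z ->
  has_sum (fun k => psi_term z (m + nZ * k)) (psi tau a z).
Proof.
move=> hm; have [q hq] : exists q, (m - Z.of_nat a = q * nZ)%Z by apply/Z.mod_divide; lia.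
rewrite psi_theta.
apply: has_sum_ext (has_sum_Zshift q (theta_has_sum hntau _ _ _)) => k.
by rewrite -psi_term_theta_term; congr psi_term; lia.
Qed.

(* The entry of the R-matrix, with [x = i - j], [y = i - k], [z = k - j]. *)
Definition R_entry (kappa lambda : C) (x y z : R) : C :=
  C_derive (fun u => theta (1 / 2) (1 / 2) u ntau) 0
   * theta (x / N + 1 / 2) (1 / 2) (lambda - kappa) ntau
  / (theta (y / N + 1 / 2) (1 / 2) (- kappa) ntau
     * theta (z / N + 1 / 2) (1 / 2) lambda ntau).

Lemma theta_level_char (q : Z) z : theta (IZR q / N + 1 / 2) (1 / 2) z ntau =
  E (IZR q * IZR q * tau / N / 2 + IZR q / N * (z + 1 / 2))
   * theta (1 / 2) (1 / 2) (z + IZR q * tau) ntau.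
Proof.
have nz := CN_neq0; have nz' := INR_neq0 hn.
rewrite Rplus_comm (theta_char hntau _ _ _ (1 / 2)).
have -> : z + RtoC (IZR q / N) * ntau + ((1 / 2)%R - (1 / 2)%R) = z + IZR q * tau.
  by rewrite RtoC_div //; field.
by congr (E _ * _); rewrite RtoC_div //; Cpush; field.
Qed.

(** Zeros at level [n tau] lie in the sublattice [Z + n tau Z]; undoing the shift by [q * tau] lands
    in the lattice of [tau]. One hypothesis thus covers the denominators of all entries. *)
Lemma theta_level_neq0 (q : Z) z : ~ lattice tau z ->
  theta (IZR q / N + 1 / 2) (1 / 2) z ntau <> 0.
Proof.
move=> hz h; apply: hz; rewrite theta_level_char in h.
have {}h : theta (1 / 2) (1 / 2) (z + IZR q * tau) ntau = 0.
  by apply: NNPP => h'; case: (Cmult_neq_0 _ _ (@E_neq0 _) h' h).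
have [p [r e]] := theta_zero_lattice hntau h.
exists p, (r * nZ - q)%Z; have -> : z = z + IZR q * tau - IZR q * tau by ring.
by rewrite e; Cpush; rewrite -N_IZR; ring.
Qed.

(* The least [u] with [s <= p + n u]. *)
Definition ceil_div (s p : Z) : Z := (- ((p - s) / nZ))%Z.

Lemma ceil_divP s p : let c := ceil_div s p in (s <= p + nZ * c <= s + nZ - 1)%Z.
Proof.
rewrite /ceil_div /=; have h0 : (0 < nZ)%Z by lia.
have := Z.div_mod (p - s) nZ ltac:(lia); have := Z.mod_pos_bound (p - s) nZ h0; nia.
Qed.

Lemma ceil_div_le s p u : (s <=? p + nZ * u)%Z = (ceil_div s p <=? u)%Z.
Proof.
have := ceil_divP s p; move: (ceil_div s p) => c /= hc.
case: Z.leb_spec => h1; case: Z.leb_spec => h2 //; nia.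
Qed.

Lemma ceil_div_lt s p u : (p + nZ * u <? s)%Z = (u <? ceil_div s p)%Z.
Proof. by rewrite !Z.ltb_antisym ceil_div_le. Qed.

Lemma ceil_strip s p y : (0 < y + IZR s * A < A)%R ->
  (0 < y + IZR p * A + IZR (ceil_div s p) * (N * A) < N * A)%R.
Proof.
have := ceil_divP s p; move: (ceil_div s p) => c /= [/IZR_le h1 /IZR_le].
rewrite !minus_IZR !plus_IZR mult_IZR -N_IZR in h1 * => h2 hy; nra.
Qed.

(** The general term of Kronecker's expansion at level [n tau], once the factors from
    [theta_level_char] are absorbed. With [a = p + n u] and [d = q + n v] it depends on [a] and [d]
    only, so all entries are restrictions of one double series to residue classes modulo [n]. *)
Definition R_entry_term (kappa lambda : C) (s1 s2 : Z) (a d : Z) : C :=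
  c0 * (qsign s1 s2 a d * E (IZR a * IZR d * tau / N + IZR d * lambda / N - IZR a * kappa / N)).

Lemma R_entry_series kappa lambda (s1 s2 p q : Z) :
  (0 < Im lambda + IZR s1 * A < A)%R -> (0 < Im (- kappa) + IZR s2 * A < A)%R ->
  let F u := R_entry_term kappa lambda s1 s2 (p + nZ * u.1) (q + nZ * u.2) in
  summable F /\ has_sum F (R_entry kappa lambda (IZR p + IZR q) (IZR q) (IZR p)).
Proof.
move=> hl hk F; have nz := CN_neq0; have nz' := INR_neq0 hn.
pose x := - kappa + IZR q * tau; pose y := lambda + IZR p * tau.
have hx : (0 < Im x + IZR (ceil_div s2 q) * Im ntau < Im ntau)%R.
  by rewrite Im_ntau Im_plus im_scal_l; exact: ceil_strip.
have hy : (0 < Im y + IZR (ceil_div s1 p) * Im ntau < Im ntau)%R.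
  by rewrite Im_ntau Im_plus im_scal_l; exact: ceil_strip.
have [sk hs] := kronecker hntau hx hy.
pose e := E (IZR p * IZR q * tau / N + IZR q * lambda / N - IZR p * kappa / N).
have eF u : F u = e * (c0 * kron_term ntau (ceil_div s1 p) (ceil_div s2 q) x y u).
  case: u => u v; rewrite /F /R_entry_term /kron_term /=.
  have -> : qsign s1 s2 (p + nZ * u) (q + nZ * v) = qsign (ceil_div s1 p) (ceil_div s2 q) u v.
    by rewrite /qsign ceil_div_le ceil_div_lt.
  set S := qsign _ _ _ _.
  have -> : E (IZR (p + nZ * u) * IZR (q + nZ * v) * tau / N + IZR (q + nZ * v) * lambda / N -
     IZR (p + nZ * u) * kappa / N) = e * E (IZR u * IZR v * ntau + IZR u * x + IZR v * y).
    rewrite /e -E_plus /x /y; congr E; Cpush; rewrite -N_IZR; field; exact: nz.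
  ring.
split.
  by apply: summable_ext (summable_scal (e * c0) sk) => u; rewrite eF; ring.
have -> : R_entry kappa lambda (IZR p + IZR q) (IZR q) (IZR p) = e * kron_fun ntau x y.
  rewrite /R_entry -plus_IZR !theta_level_char /kron_fun.
  have Tx : theta (1 / 2) (1 / 2) x ntau <> 0.
    by move=> /(theta_zero_lattice hntau); apply: strip_not_lattice hntau hx.
  have Ty : theta (1 / 2) (1 / 2) y ntau <> 0.
    by move=> /(theta_zero_lattice hntau); apply: strip_not_lattice hntau hy.
  have -> : lambda - kappa + IZR (p + q) * tau = x + y by rewrite /x /y; Cpush; ring.
  rewrite -/x -/y.
  set ex := E (IZR q * _ * _ / _ / _ + _); set ey := E (IZR p * _ * _ / _ / _ + _); set ez := E _.
  have -> : ez = e * ex * ey.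
    rewrite /ez /e /ex /ey -!E_plus; congr E; Cpush; field; exact: nz.
  have nx : ex <> 0 := @E_neq0 _. have ny : ey <> 0 := @E_neq0 _.
  by field.
by apply: has_sum_ext (has_sum_scal e hs) => u; rewrite eF.
Qed.

Lemma Zord_subproof (m : Z) : (Z.to_nat (m mod nZ) < n)%N.
Proof. have := Z.mod_pos_bound m nZ ltac:(lia); lia. Qed.

Definition Zord (m : Z) : 'I_n := Ordinal (Zord_subproof m).

Lemma Zord_val (m : Z) : Z.of_nat (Zord m) = (m mod nZ)%Z.
Proof. have := Z.mod_pos_bound m nZ ltac:(lia); rewrite /=; lia. Qed.

Lemma Zord_eq (m u : Z) (k : 'I_n) : (m = Z.of_nat k + nZ * u)%Z -> Zord m = k /\ (m / nZ)%Z = u.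
Proof.
move=> hm; have hk := ltn_ord k.
have e1 : (m / nZ)%Z = u by symmetry; apply: (Z.div_unique_pos _ _ _ (Z.of_nat k)); lia.
split=> //; apply: val_inj => /=.
have e2 : (m mod nZ)%Z = Z.of_nat k by rewrite Z.mod_eq ?e1; lia.
by rewrite e2; lia.
Qed.

Lemma Zord_div (m : Z) : (m = Z.of_nat (Zord m) + nZ * (m / nZ))%Z.
Proof. rewrite Zord_val; have := Z.div_mod m nZ ltac:(lia); lia. Qed.

End Level.

(** * The two identities for generic imaginary parts *)

Section Main.
Variables (n : nat) (tau : C).
Hypotheses (hn : (1 <= n)%N) (htau : (0 < Im tau)%R).
Notation N := (INR n).
Notation nZ := (Z.of_nat n).
Notation A := (Im tau).
Notation c0 := (- (2 * PI * Ci)).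
Notation o := ((N - 1) / 2)%R.

Definition SU_psi (kappa lambda : C) (i j : 'I_n) (z1 z2 : C) : C :=
  let w := z1 - z2 - (lambda + kappa) / N in
  kron_fun tau w lambda * (psi tau i (z2 + lambda / N) * psi tau j (z1 - lambda / N))
  - kron_fun tau w kappa * (psi tau i (z1 - kappa / N) * psi tau j (z2 + kappa / N)).

(** The condition [i + j = k + l] modulo [n] leaves one [l] for each [k], hence a single sum. *)
Definition SU_expansion (kappa lambda : C) (i j : 'I_n) (z1 z2 : C) : C :=
  Csum (fun k : 'I_n => let i' := Z.of_nat i in let j' := Z.of_nat j in let k' := Z.of_nat k in
    R_entry n tau kappa lambda (IZR (k' - j') + IZR (i' - k')) (IZR (i' - k')) (IZR (k' - j'))
    * (psi tau k z1 * psi tau (Zord hn (i' + j' - k')) z2)).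

Notation Z4 := ((Z * Z) * (Z * Z))%type.

Lemma main_generic kappa lambda i j z1 z2 (s1 s2 r : Z) :
  (0 < Im lambda + IZR s1 * A < A)%R -> (0 < Im kappa + IZR s2 * A < A)%R ->
  (0 < Im (z1 - z2 - (lambda + kappa) / N) + IZR r * A < A)%R ->
  SU_psi kappa lambda i j z1 z2 = SU_expansion kappa lambda i j z1 z2.
Proof.
move=> hl hk hw; rewrite /SU_psi /SU_expansion.
set w := z1 - z2 - _ in hw *; set i' := Z.of_nat i; set j' := Z.of_nat j.
have nz := CN_neq0 hn.
have [sk1 h1] := kronecker htau hw hl. have [sk2 h2] := kronecker htau hw hk.
have sp z a := summable_psi_term hn htau z a.
have hp z (a : 'I_n) : has_sum (fun k => psi_term n tau z (Z.of_nat a + nZ * k)) (psi tau a z).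
  by apply: psi_has_sum => //; rewrite Z.sub_diag Zmod_0_l.
have f1 := has_sum_prod (summable_scal c0 sk1) (summable_prod (sp _ _) (sp _ _)) h1
  (has_sum_prod (sp _ _) (sp _ _) (hp (z2 + lambda / N) i) (hp (z1 - lambda / N) j)).
have f2 := has_sum_prod (summable_scal c0 sk2) (summable_prod (sp _ _) (sp _ _)) h2
  (has_sum_prod (sp _ _) (sp _ _) (hp (z1 - kappa / N) i) (hp (z2 + kappa / N) j)).
(* [dd q / n] is the coefficient of [lambda] in the exponent of the first series. The reindexing [h]
   of the second series is dictated by matching the coefficients of [z1] and [z2] in the two
   exponents. *)
pose dd (q : Z4) := (nZ * q.1.2 - q.1.1 + i' - j' + nZ * (q.2.1 - q.2.2))%Z.
pose h (q : Z4) : Z4 := ((- dd q, q.1.2), (q.2.1 + q.1.2, q.2.2 - q.1.2))%Z.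
pose g (q : Z4) : Z4 :=
  ((q.1.1 + i' - j' + nZ * (q.2.1 - q.2.2 - q.1.2), q.1.2), (q.2.1 - q.1.2, q.2.2 + q.1.2))%Z.
have hg : cancel h g.
  by move=> [[a b] [k1 k2]]; rewrite /h /g /dd /=; congr (_, _, (_, _)); nia.
have gh : cancel g h.
  by move=> [[a b] [k1 k2]]; rewrite /h /g /dd /=; congr (_, _, (_, _)); nia.
have f3 := has_sum_plus f1 (has_sum_scal (- (1)) (has_sum_bij hg gh f2)).
(* The common summand. Its threshold [1 - s2] is the strip index of [- kappa] when [s2] is that of
   [kappa]. *)
pose U (q : Z4) := R_entry_term n tau kappa lambda s1 (1 - s2) q.1.1 (dd q) *
  (psi_term n tau z1 (q.1.1 + j' + nZ * q.2.2) * psi_term n tau z2 (i' + nZ * q.2.1 - q.1.1)).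
have f4 : has_sum U (kron_fun tau w lambda * (psi tau i (z2 + lambda / N) * psi tau j (z1 - lambda / N))
  - kron_fun tau w kappa * (psi tau i (z1 - kappa / N) * psi tau j (z2 + kappa / N))).
  move: f3; set V := (X in has_sum X _); set L := (X in has_sum _ X).
  move=> f3; rewrite (_ : _ - _ = L); last by rewrite /L; ring.
  apply: has_sum_ext f3 => -[[a b] [k1 k2]].
  rewrite /V /U /h /dd /R_entry_term /kron_term /=.
  set d := (nZ * b - a + i' - j' + nZ * (k1 - k2))%Z.
  (* Both terms of the operator carry the same exponential, and the signs subtract. *)
  have -> : qsign s1 (1 - s2) a d = qsign s1 r a b - qsign s2 r (- d) b.
    rewrite /qsign; have -> : (s2 <=? - d)%Z = (d <? 1 - s2)%Z.
      by case: Z.leb_spec => ?; case: Z.ltb_spec => ? //; lia.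
    ring.
  set S1 := qsign s1 _ _ _; set S2 := qsign s2 _ _ _.
  rewrite -/i' -/j' /psi_term.
  set e1 := E (IZR a * _ * _ + _ + _).
  set e2 := E (IZR (- d) * _ * _ + _ + _).
  set e3 := E (_ + IZR d * _ / _ - _).
  set p1 := E _; set p2 := E _; set p3 := E _; set p4 := E _; set p5 := E _; set p6 := E _.
  have e31 : e1 * (p1 * p2) = e3 * (p5 * p6).
    rewrite /e1 /e3 /p1 /p2 /p5 /p6 -!E_plus; congr E; rewrite /w /d; Cpush.
    rewrite -!N_IZR; field; exact: nz.
  have e32 : e2 * (p3 * p4) = e3 * (p5 * p6).
    rewrite /e2 /e3 /p3 /p4 /p5 /p6 -!E_plus; congr E; rewrite /w /d; Cpush.
    rewrite -!N_IZR; field; exact: nz.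
  have -> : c0 * ((S1 - S2) * e3) * (p5 * p6) = c0 * (S1 - S2) * (e3 * (p5 * p6)) by ring.
  have -> : c0 * (S1 * e1) * (p1 * p2) = c0 * S1 * (e1 * (p1 * p2)) by ring.
  have -> : c0 * (S2 * e2) * (p3 * p4) = c0 * S2 * (e2 * (p3 * p4)) by ring.
  by rewrite e31 e32; ring.
(* Here [k] is the class of [a + j'] modulo [n]. The other indices are recombined so that [U]
   factors into an entry term at [(k - j' + n u, i' - k + n v)], a term of [psi k] and a term of
   [psi] at the class of [i + j - k]. *)
pose phi (q : 'I_n * Z4) : Z4 := let k := Z.of_nat q.1 in let u := q.2.1.1 in let v := q.2.1.2 in
  let m1 := q.2.2.1 in let m2 := q.2.2.2 in
  ((k - j' + nZ * u, v - u - m2 + m1), (m2 + u, m1 - u))%Z.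
pose phi' (q : Z4) : 'I_n * Z4 := let u := ((q.1.1 + j') / nZ)%Z in
  (Zord hn (q.1.1 + j'),
   ((u, q.1.2 + u + (q.2.1 - u) - (q.2.2 + u)), (q.2.2 + u, q.2.1 - u)))%Z.
have p1 : cancel phi phi'.
  move=> [k [[u v] [m1 m2]]]; rewrite /phi /phi' /=.
  have [-> ->] : Zord hn (Z.of_nat k - j' + nZ * u + j') = k /\
      ((Z.of_nat k - j' + nZ * u + j') / nZ)%Z = u by apply: Zord_eq; lia.
  by congr (_, (_, _, (_, _))); lia.
have p2 : cancel phi' phi.
  move=> [[a b] [k1 k2]]; rewrite /phi /phi'.
  have := Zord_div hn (a + j'); set u := ((a + j') / nZ)%Z; move: (Zord _ _) => k e.
  by cbn -[Z.mul Z.of_nat]; congr (_, _, (_, _)); lia.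
have f5 := has_sum_bij p1 p2 f4.
pose v (k : 'I_n) := let k' := Z.of_nat k in
    R_entry n tau kappa lambda (IZR (k' - j') + IZR (i' - k')) (IZR (i' - k')) (IZR (k' - j'))
    * (psi tau k z1 * psi tau (Zord hn (i' + j' - k')) z2).
suff f6 : has_sum v (kron_fun tau w lambda * (psi tau i (z2 + lambda / N) * psi tau j (z1 - lambda / N))
  - kron_fun tau w kappa * (psi tau i (z1 - kappa / N) * psi tau j (z2 + kappa / N))).
  exact: has_sum_unique f6 (has_sum_fin v).
apply: (has_sum_fubini f5) => k; rewrite /v; set k' := Z.of_nat k => /=.
have hk' : (0 < Im (- kappa) + IZR (1 - s2) * A < A)%R.
  rewrite minus_IZR (_ : Im (- kappa) = - Im kappa)%R //; lra.
have [sM hM] := R_entry_series hn htau (k' - j') (i' - k') hl hk'.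
have hp2 : has_sum (fun m => psi_term n tau z2 (i' + j' - k' + nZ * m)) (psi tau (Zord hn (i' + j' - k')) z2).
  apply: psi_has_sum => //; rewrite Zord_val //.
  rewrite Zminus_mod Zmod_mod Z.sub_diag; exact: Zmod_0_l.
have := has_sum_prod sM (summable_prod (sp z1 k') (sp z2 (i' + j' - k')%Z)) hM
  (has_sum_prod (sp _ _) (sp _ _) (hp z1 k) hp2).
apply: has_sum_ext => -[[u x] [m1 m2]]; rewrite /U /phi /dd /= -/k'.
congr (_ * (_ * _)).
- by congr R_entry_term; nia.
- by congr psi_term; nia.
- by congr psi_term; nia.
Qed.

(** Entry of the rescaled Belavin matrix with [eta = - kappa / n]: [al2] is the jump [i - k] caused
    by the powers of [T], and [p = k - j] is the exponent in the roots of unity coming from the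
    powers of [S]. *)
Definition belavin_entry (kappa lambda : C) (al2 : 'I_n) (p : Z) : C :=
  C_derive (fun z => theta (1 / 2) (1 / 2) z tau) 0 / theta (1 / 2) (1 / 2) lambda tau *
  Csum (fun al1 : 'I_n => / N * E (INR al1 * (IZR p / N)) *
    (theta (1 / 2 + INR al2 / N) (1 / 2 - INR al1 / N) (lambda - kappa / N) tau /
     theta (1 / 2 + INR al2 / N) (1 / 2 - INR al1 / N) (- kappa / N) tau)).

Lemma weight_neq0 kappa (al1 al2 : 'I_n) : ~ lattice tau kappa ->
  theta (1 / 2 + INR al2 / N) (1 / 2 - INR al1 / N) (- kappa / N) tau <> 0.
Proof.
have nz := CN_neq0 hn; have nz' := INR_neq0 hn.
move=> hk h; apply: hk; rewrite theta_to_half // in h.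
have {}h : theta (1 / 2) (1 / 2) (- kappa / N + (INR al2 / N)%R * tau - (INR al1 / N)%R) tau = 0.
  by apply: NNPP => h'; case: (Cmult_neq_0 _ _ (@E_neq0 _) h' h).
have [p [q e]] := theta_zero_lattice htau h.
exists (- (nZ * p + Z.of_nat al1))%Z, (Z.of_nat al2 - nZ * q)%Z.
rewrite !RtoC_div // in e.
have -> : kappa = INR al2 * tau - INR al1 - N * (- kappa / N + INR al2 / N * tau - INR al1 / N).
  by field.
by rewrite e; Cpush; rewrite -!INR_IZR_INZ; ring.
Qed.

(** Each weight is a Kronecker function at level [tau] with first argument
    [x al1 = (- kappa + al2 tau - al1) / n]. The phase [E (- a al1 / n)] of its expansion, averaged
    against [E (al1 p / n)], keeps the indices [a] congruent to [p]; what survives is the series of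
    [R_entry_term] with [d = al2 + n b]. *)
Lemma belavin_generic kappa lambda (al2 : 'I_n) (p q : Z) (s1 s2 : Z) :
  (0 < Im lambda + IZR s1 * A < A)%R -> (0 < Im (- kappa) + IZR s2 * A < A)%R ->
  (exists t, q = Z.of_nat al2 + nZ * t)%Z ->
  R_entry n tau kappa lambda (IZR p + IZR q) (IZR q) (IZR p) = belavin_entry kappa lambda al2 p.
Proof.
move=> hl hk [t hq]; have nz := CN_neq0 hn; have nz' := INR_neq0 hn.
have N1 := N_ge1 hn.
pose a2 := Z.of_nat al2; pose r := ceil_div n s2 a2.
pose x (al1 : 'I_n) : C := - kappa / N + (INR al2 / N)%R * tau - (INR al1 / N)%R.
have hx al1 : (0 < Im (x al1) + IZR r * A < A)%R.
  have := ceil_strip hn a2 hk; rewrite -/r.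
  have -> : (Im (x al1) = (Im (- kappa) + IZR a2 * A) / N)%R.
    have -> : x al1 = RtoC (/ N)%R * (- kappa + INR al2 * tau - INR al1).
      by rewrite /x !RtoC_div // RtoC_inv //; field.
    rewrite im_scal_l; rewrite /a2 -INR_IZR_INZ.
    have -> : Im (- kappa + INR al2 * tau - INR al1) = (Im (- kappa) + INR al2 * A)%R.
      by rewrite /Cminus !Im_plus im_scal_l -RtoC_opp im_RtoC Rplus_0_r.
    by field.
  move=> [h1 h2]; split.
    apply: (Rmult_lt_reg_l N); first lra.
    rewrite Rmult_0_r; apply: Rlt_le_trans h1 _; right; field; lra.
  apply: (Rmult_lt_reg_l N); first lra.
  apply: Rle_lt_trans h2; right; field; lra.
pose c (al1 : 'I_n) := / N * E (INR al1 * (IZR p / N)) * E ((INR al2 / N)%R * lambda).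
have hs al1 := has_sum_scal (c al1) (proj2 (kronecker htau (hx al1) hl)).
have nT : theta (1 / 2) (1 / 2) lambda tau <> 0.
  by move=> /(theta_zero_lattice htau); apply: strip_not_lattice htau hl.
have nX al1 : theta (1 / 2) (1 / 2) (x al1) tau <> 0.
  by move=> /(theta_zero_lattice htau); apply: strip_not_lattice htau (hx al1).
have eB : psum (fun al1 => c al1 * kron_fun tau (x al1) lambda) (index_enum 'I_n) = belavin_entry kappa lambda al2 p.
  rewrite /belavin_entry /Csum (big_morph (Cmult _) (Cmult_plus_distr_l _) (Cmult_0_r _)).
  apply: eq_bigr => al1 _; rewrite !theta_to_half // /kron_fun /c.
  have -> : lambda - kappa / N + RtoC (INR al2 / N) * tau - RtoC (INR al1 / N) = x al1 + lambda.
    by rewrite /x; field.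
  rewrite -/(x al1); set e1 := E (_ * lambda).
  set e2 := E (_ + _ * (lambda - _ + _ - _)); set e3 := E (_ + _ * (_ / _ + _ - _)).
  have -> : e2 = e1 * e3.
    by rewrite /e1 /e2 /e3 -E_plus; congr E; field.
  have n3 : e3 <> 0 := @E_neq0 _; have nxx := nX al1.
  by field.
have h1 := has_sum_big (index_enum 'I_n) hs.
rewrite eB in h1.
pose F (u : Z * Z) := if ((p - u.1) mod nZ =? 0)%Z
  then R_entry_term n tau kappa lambda s1 s2 u.1 (a2 + nZ * u.2) else 0.
have h2 : has_sum F (belavin_entry kappa lambda al2 p).
  apply: has_sum_ext h1 => -[a b].
  rewrite /F /R_entry_term /kron_term /=.
  have -> : qsign s1 s2 a (a2 + nZ * b) = qsign s1 r a b by rewrite /qsign ceil_div_lt.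
  set S := qsign _ _ _ _; set e := E (_ + _ - _).
  have -> : psum (fun al1 : 'I_n => c al1 * (c0 * (S * E (IZR a * IZR b * tau + IZR a * x al1 + IZR b * lambda))))
      (index_enum 'I_n)
    = (/ N * c0 * S * e) * Csum (fun al1 : 'I_n => E (INR al1 * (IZR (p - a) / N))).
    rewrite /Csum (big_morph (Cmult _) (Cmult_plus_distr_l _) (Cmult_0_r _)).
    apply: eq_bigr => al1 _; rewrite /c.
    set e1 := E (_ * (_ / _)); set e2 := E (_ * lambda); set e3 := E _; set e4 := E _.
    have h : e1 * e2 * e3 = e * e4.
      rewrite /e1 /e2 /e3 /e4 /e -!E_plus; congr E; rewrite /x /a2 !RtoC_div //; Cpush.
      by rewrite -!INR_IZR_INZ; field.
    have -> : / N * e1 * e2 * (c0 * (S * e3)) = / N * c0 * S * (e1 * e2 * e3) by ring.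
    by rewrite h; ring.
  rewrite unity_sum //; case: ifP => _; last ring.
  by field.
pose phi (y : 'I_n * (Z * Z)) : Z * Z := (p + Z.of_nat y.1 + nZ * y.2.1, y.2.2 + t)%Z.
pose phi' (y : Z * Z) : 'I_n * (Z * Z) := (Zord hn (y.1 - p), ((y.1 - p) / nZ, y.2 - t))%Z.
have p1 : cancel phi phi'.
  move=> [k [u v]]; rewrite /phi /phi' /=.
  have [-> ->] : Zord hn (p + Z.of_nat k + nZ * u - p) = k /\
      ((p + Z.of_nat k + nZ * u - p) / nZ)%Z = u by apply: Zord_eq; lia.
  by congr (_, (_, _)); lia.
have p2 : cancel phi' phi.
  move=> [a b]; rewrite /phi /phi'.
  have := Zord_div hn (a - p); set u := ((a - p) / nZ)%Z; move: (Zord _ _) => k e.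
  by cbn -[Z.mul Z.of_nat]; congr (_, _); lia.
have h3 := has_sum_bij p1 p2 h2.
have [sM hM] := R_entry_series hn htau p q hl hk.
pose k0 : 'I_n := Ordinal hn.
(* Summation over the class of [a - p] modulo [n]: only class 0 has a nonzero fibre, and it is the
   series of the entry. *)
have h4 : has_sum (fun k => if k == k0 then R_entry n tau kappa lambda (IZR p + IZR q) (IZR q) (IZR p) else 0)
   (belavin_entry kappa lambda al2 p).
  apply: (has_sum_fubini h3) => k; case: eqP => [->|hk0].
    apply: has_sum_ext hM => -[u v]; rewrite /F /phi /=.
    have -> : ((p - (p + 0 + nZ * u)) mod nZ =? 0)%Z.
      apply/Z.eqb_eq; rewrite (_ : (p - (p + 0 + nZ * u) = (- u) * nZ)%Z); last by lia.
      exact: Z_mod_mult.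
    by congr R_entry_term; rewrite ?hq /a2; lia.
  apply: has_sum_ext (_ : has_sum (fun _ => RtoC 0) 0) => [[u v]|].
    rewrite /F /phi /=; case: Z.eqb_spec => // hm; case: hk0; apply: val_inj => /=.
    have [w hw] : exists w, (p - (p + Z.of_nat k + nZ * u) = w * nZ)%Z.
      by apply/Z.mod_divide => //; lia.
    have := ltn_ord k => hk'.
    have : (Z.of_nat k = nZ * (- u - w))%Z by lia.
    move: (- u - w)%Z => y hy.
    have [y0|[y0|y0]] : (y <= -1 \/ y = 0 \/ 1 <= y)%Z by lia.
    - nia.
    - by rewrite y0 in hy; lia.
    - nia.
  move=> eps he; exists [::] => s _ _; rewrite /psum big1 //.
  by rewrite (_ : 0 - 0 = 0) ?Cmod_0 //; ring.
exact: has_sum_unique (has_sum_single _ _) h4.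
Qed.

End Main.

Lemma lim0_theta (a b : R) tau f l : (0 < Im tau)%R -> lim0 f l ->
  lim0 (fun s => theta a b (f s) tau) (theta a b l tau).
Proof.
by move=> htau; apply: (lim0_comp (g := fun z => theta a b z tau)); exact: theta_ccont.
Qed.

(** * Extension to all parameters off the lattice *)

Section Continuity.
Variables (n : nat) (tau : C).
Hypotheses (hn : (1 <= n)%N) (htau : (0 < Im tau)%R).
Notation N := (INR n).
Notation nZ := (Z.of_nat n).
Notation A := (Im tau).

(** The strip that contains [y] is closed below and open above, so an upward motion enters its
    interior at once, even from the boundary. *)
Lemma strip_exists y v : (0 < v)%R -> exists (s : Z) (d : R), (0 < d)%R /\
  forall t, (0 < t < d)%R -> (0 < y + t * v + IZR s * A < A)%R.
Proof.
move=> hv; have [q [h1 h2]] := floor_ex (y / A).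
have e : y = (y / A * A)%R by field; lra.
have h3 : (IZR q * A <= y)%R by rewrite e; apply: Rmult_le_compat_r; lra.
have h4 : (y < IZR q * A + A)%R.
  by have := Rmult_lt_compat_r A _ _ htau h2; lra.
exists (- q)%Z, ((IZR q * A + A - y) / v)%R; split.
  by apply: Rdiv_lt_0_compat; lra.
move=> t [t0 t1]; rewrite opp_IZR.
have := Rmult_lt_compat_r v _ _ hv t1.
have -> : ((IZR q * A + A - y) / v * v = IZR q * A + A - y)%R by field; lra.
nra.
Qed.

Lemma lim0_psi (a : 'I_n) f l : lim0 f l -> lim0 (fun s => psi tau a (f s)) (psi tau a l).
Proof.
move=> h; rewrite psi_theta //.
apply: (lim0_ext Rlt_0_1 _ (lim0_theta _ _ (hntau hn htau) (lim0_mult (lim0_const N) h))) => s _.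
by rewrite psi_theta.
Qed.

Lemma lim0_kron_fun f g x y : ~ lattice tau x -> ~ lattice tau y -> lim0 f x -> lim0 g y ->
  lim0 (fun s => kron_fun tau (f s) (g s)) (kron_fun tau x y).
Proof.
move=> hx hy hf hg; apply: lim0_div.
- apply: Cmult_neq_0.
    by move=> /(theta_zero_lattice htau).
  by move=> /(theta_zero_lattice htau).
- apply: lim0_mult (lim0_const _) _; apply: lim0_theta => //; exact: lim0_plus.
- by apply: lim0_mult; apply: lim0_theta.
Qed.

Lemma lim0_R_entry kappa lambda f g (x q p : Z) : ~ lattice tau kappa -> ~ lattice tau lambda ->
  lim0 f kappa -> lim0 g lambda ->
  lim0 (fun s => R_entry n tau (f s) (g s) (IZR x) (IZR q) (IZR p))
    (R_entry n tau kappa lambda (IZR x) (IZR q) (IZR p)).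
Proof.
move=> hk hl hf hg; have hN := hntau hn htau; apply: lim0_div.
- apply: Cmult_neq_0; apply: theta_level_neq0 => //.
  by move=> /lattice_opp; rewrite (_ : - - kappa = kappa) //; ring.
- apply: lim0_mult (lim0_const _) _; apply: lim0_theta => //; exact: lim0_minus.
- by apply: lim0_mult; apply: lim0_theta => //; exact: lim0_opp.
Qed.

Lemma Im_line (z : C) (s v : R) : Im (z + s * (v * Ci)) = (Im z + s * v)%R.
Proof. by case: z => a b; rewrite /Cplus /Cmult /Ci /RtoC /Im /=; ring. Qed.

Lemma main_identity kappa lambda (i j : 'I_n) z1 z2 :
  ~ lattice tau kappa -> ~ lattice tau lambda ->
  ~ lattice tau (z1 - z2 - (lambda + kappa) / N) ->
  SU_psi tau kappa lambda i j z1 z2 = SU_expansion tau hn kappa lambda i j z1 z2.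
Proof.
move=> hk hl hw; have nz := CN_neq0 hn; have nz' := INR_neq0 hn; have N1 := N_ge1 hn.
(* [kappa] and [lambda] rise at speed 1 and [z1] at speed 3, so that the first argument of the
   Kronecker functions rises at speed [v = 3 - 2 / n > 0]: all three enter open strips together. *)
pose K s := kappa + s * (1%R * Ci). pose L s := lambda + s * (1%R * Ci).
pose Z1 s := z1 + s * (3%R * Ci).
pose v := (3 - 2 / N)%R.
have v0 : (0 < v)%R.
  have : (/ N <= 1)%R by rewrite -Rinv_1; apply: Rinv_le_contravar; lra.
  rewrite /v /Rdiv; lra.
have ew s : Z1 s - z2 - (L s + K s) / N = z1 - z2 - (lambda + kappa) / N + s * (v * Ci).
  rewrite /Z1 /L /K /v RtoC_minus RtoC_div //; field; exact: nz.
have [s1 [d1 [p1 h1]]] := strip_exists (Im lambda) Rlt_0_1.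
have [s2 [d2 [p2 h2]]] := strip_exists (Im kappa) Rlt_0_1.
have [r [d3 [p3 h3]]] := strip_exists (Im (z1 - z2 - (lambda + kappa) / N)) v0.
pose d := Rmin d1 (Rmin d2 d3).
have d0 : (0 < d)%R by repeat apply: Rmin_pos.
have lK : lim0 K kappa := lim0_line _ _.
have lL : lim0 L lambda := lim0_line _ _.
have lZ : lim0 Z1 z1 := lim0_line _ _.
have c2 := lim0_const z2. have cN := lim0_const N.
have l1 : lim0 (fun s => SU_psi tau (K s) (L s) i j (Z1 s) z2) (SU_psi tau kappa lambda i j z1 z2).
  have lw : lim0 (fun s => Z1 s - z2 - (L s + K s) / N) (z1 - z2 - (lambda + kappa) / N).
    apply: lim0_minus; first exact: lim0_minus.
    by apply: lim0_div => //; exact: lim0_plus.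
  have lq f l : lim0 f l -> lim0 (fun s => f s / N) (l / N) by move=> h; exact: lim0_div.
  apply: lim0_minus; apply: lim0_mult; try exact: lim0_kron_fun.
    by apply: lim0_mult; apply: lim0_psi; [apply: lim0_plus|apply: lim0_minus] => //; exact: lq.
  by apply: lim0_mult; apply: lim0_psi; [apply: lim0_minus|apply: lim0_plus] => //; exact: lq.
have l2 : lim0 (fun s => SU_expansion tau hn (K s) (L s) i j (Z1 s) z2) (SU_expansion tau hn kappa lambda i j z1 z2).
  apply: lim0_Csum => k /=; rewrite -plus_IZR.
  apply: lim0_mult; first exact: lim0_R_entry.
  by apply: lim0_mult; exact: lim0_psi.
apply: (lim0_unique l1); apply: (lim0_ext d0 _ l2) => s hs; symmetry.
have m1 := Rmin_l d1 (Rmin d2 d3); have m2 := Rmin_r d1 (Rmin d2 d3).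
have m3 := Rmin_l d2 d3; have m4 := Rmin_r d2 d3.
apply: (main_generic hn htau i j (s1 := s1) (s2 := s2) (r := r)).
- by rewrite Im_line; apply: h1; rewrite -/d in m1 *; lra.
- by rewrite Im_line; apply: h2; rewrite -/d in m1 m2; lra.
- by rewrite ew Im_line; apply: h3; rewrite -/d in m1 m2; lra.
Qed.

Lemma belavin_identity kappa lambda (al2 : 'I_n) (p q : Z) :
  ~ lattice tau kappa -> ~ lattice tau lambda ->
  (exists t, q = Z.of_nat al2 + nZ * t)%Z ->
  R_entry n tau kappa lambda (IZR p + IZR q) (IZR q) (IZR p) = belavin_entry tau kappa lambda al2 p.
Proof.
move=> hk hl ht; have nz := CN_neq0 hn; have nz' := INR_neq0 hn.
(* [kappa] moves downwards because the generic identity asks for [- kappa] in a strip. *)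
pose K s := kappa + s * ((-1)%R * Ci). pose L s := lambda + s * (1%R * Ci).
have [s1 [d1 [p1 h1]]] := strip_exists (Im lambda) Rlt_0_1.
have [s2 [d2 [p2 h2]]] := strip_exists (Im (- kappa)) Rlt_0_1.
pose d := Rmin d1 d2.
have d0 : (0 < d)%R by apply: Rmin_pos.
have lK : lim0 K kappa := lim0_line _ _.
have lL : lim0 L lambda := lim0_line _ _.
have cN := lim0_const N.
have l1 : lim0 (fun s => R_entry n tau (K s) (L s) (IZR p + IZR q) (IZR q) (IZR p))
    (R_entry n tau kappa lambda (IZR p + IZR q) (IZR q) (IZR p)).
  by rewrite -plus_IZR; exact: lim0_R_entry.
have lq f l : lim0 f l -> lim0 (fun s => f s / N) (l / N) by move=> h; exact: lim0_div.
have l2 : lim0 (fun s => belavin_entry tau (K s) (L s) al2 p) (belavin_entry tau kappa lambda al2 p).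
  apply: lim0_mult.
    apply: lim0_div (lim0_const _) _; first by move=> /(theta_zero_lattice htau).
    exact: lim0_theta.
  apply: lim0_Csum => al1; apply: lim0_mult (lim0_const _) _.
  apply: lim0_div.
  - exact: weight_neq0.
  - by apply: lim0_theta => //; apply: lim0_minus => //; exact: lq.
  - by apply: lim0_theta => //; apply: lq; exact: lim0_opp.
apply: (lim0_unique l1); apply: (lim0_ext d0 _ l2) => s hs; symmetry.
have m1 := Rmin_l d1 d2; have m2 := Rmin_r d1 d2; rewrite -/d in m1 m2.
apply: (belavin_generic hn htau p (s1 := s1) (s2 := s2)) => //.
- by rewrite Im_line; apply: h1; lra.
- rewrite (_ : Im (- K s) = Im (- kappa) + s * 1)%R; first by apply: h2; lra.
  by rewrite (_ : Im (- K s) = - Im (K s))%R // /K Im_line (_ : Im (- kappa) = - Im kappa)%R //; ring.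
Qed.

End Continuity.

(** * Goursat's theorem *)

Definition contR (f : R -> C) := forall t : R,
  continuous (fun t => Re (f t)) t /\ continuous (fun t => Im (f t)) t.

Definition CInt (f : R -> C) (a b : R) : C :=
  (RInt (fun t => Re (f t)) a b, RInt (fun t => Im (f t)) a b).

Lemma contR_eps f : (forall t eps, (0 < eps)%R -> exists2 d : R, (0 < d)%R &
    forall h : R, (Rabs h < d)%R -> (Cmod (f (t + h)%R - f t)%C < eps)%R) -> contR f.
Proof.
move=> hf t.
have key (p : C -> R) : (forall x y : C, p (x - y)%C = p x - p y)%R ->
    (forall x, Rabs (p x) <= Cmod x)%R -> continuous (fun t => p (f t)) t.
  move=> hp hb; apply/filterlim_locally => eps; have [d d0 hd] := hf t eps (cond_pos eps).
  exists (mkposreal d d0) => s; rewrite /ball /= /AbsRing_ball /abs /minus /plus /opp /= => hs.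
  have := hd (s + - t)%R hs; rewrite (_ : (t + (s + - t) = s)%R); last by ring.
  rewrite -[(p (f s) + - p (f t))%R]/(p (f s) - p (f t))%R -hp.
  exact: Rle_lt_trans.
split; apply: key => //; [exact: re_le_Cmod|exact: im_le_Cmod].
Qed.

Lemma ccont_contR (F : C -> C) z v : (forall w, ccont F w) ->
  contR (fun t : R => F (z + t * v)).
Proof.
move=> hF; apply: contR_eps => t eps he.
have [d d0 hd] := hF (z + t * v) eps he.
have p : (0 < Cmod v + 1)%R by have := Cmod_ge_0 v; lra.
exists (d / (Cmod v + 1))%R; first exact: Rdiv_lt_0_compat.
move=> h hh; have := hd (h * v).
have -> : z + t * v + h * v = z + (t + h)%R * v by rewrite RtoC_plus; ring.
apply; rewrite Cmod_mult Cmod_R.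
apply: Rle_lt_trans (_ : _ <= Rabs h * (Cmod v + 1))%R _; first by have := Rabs_pos h; nra.
by apply Rlt_div_r; lra.
Qed.

Lemma contR_ext f g : (forall t, f t = g t) -> contR f -> contR g.
Proof.
move=> e h t; split.
  by apply: (continuous_ext (fun t => Re (f t))) (proj1 (h t)) => s; rewrite e.
by apply: (continuous_ext (fun t => Im (f t))) (proj2 (h t)) => s; rewrite e.
Qed.

Lemma contR_const c : contR (fun _ => c).
Proof. by move=> t; split; exact: continuous_const. Qed.

Lemma contR_id : contR RtoC.
Proof.
move=> t; split; first exact: continuous_id.
exact: continuous_const.
Qed.

Lemma contR_plus f g : contR f -> contR g -> contR (fun t => f t + g t).
Proof.
move=> hf hg t; split.
  exact: (continuous_plus (fun t => Re (f t)) (fun t => Re (g t)) t (proj1 (hf t)) (proj1 (hg t))).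
exact: (continuous_plus (fun t => Im (f t)) (fun t => Im (g t)) t (proj2 (hf t)) (proj2 (hg t))).
Qed.

Lemma contR_mult f g : contR f -> contR g -> contR (fun t => f t * g t).
Proof.
move=> hf hg t; have [f1 f2] := hf t; have [g1 g2] := hg t; split.
  apply: (continuous_ext (fun t => minus (mult (Re (f t)) (Re (g t))) (mult (Im (f t)) (Im (g t))))) => //.
  by apply: continuous_minus; exact: continuous_mult.
apply: (continuous_ext (fun t => plus (mult (Re (f t)) (Im (g t))) (mult (Im (f t)) (Re (g t))))).
  by move=> s; rewrite /plus /mult /=; case: (f s) => a b; case: (g s) => c d /=; ring.
by apply: continuous_plus; exact: continuous_mult.
Qed.

Lemma contR_scal c f : contR f -> contR (fun t => c * f t).
Proof. by move=> h; apply: contR_mult => //; exact: contR_const. Qed.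

Lemma contR_minus f g : contR f -> contR g -> contR (fun t => f t - g t).
Proof.
move=> hf hg; apply: contR_ext (contR_plus hf (contR_scal (- (1)) hg)) => t; ring.
Qed.

Lemma contR_shift f (c : R) : contR f -> contR (fun t => f (t + c)%R).
Proof.
move=> hf t; have [f1 f2] := hf (t + c)%R.
have hc : continuous (fun t : R => (t + c)%R) t.
  by apply: (continuous_plus (fun t => t) (fun _ => c)); [exact: continuous_id|exact: continuous_const].
split; first exact: (continuous_comp (fun t => (t + c)%R) (fun t => Re (f t))).
exact: (continuous_comp (fun t => (t + c)%R) (fun t => Im (f t))).
Qed.

Section CIntLemmas.
Implicit Types (f g : R -> C) (a b c : R).

Lemma contR_ex f a b : contR f ->
  ex_RInt (fun t => Re (f t)) a b /\ ex_RInt (fun t => Im (f t)) a b.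
Proof.
move=> h; split; apply: ex_RInt_continuous => t _; [exact: (proj1 (h t))|exact: (proj2 (h t))].
Qed.

Lemma CInt_ext f g a b : (forall t, f t = g t) -> CInt f a b = CInt g a b.
Proof. by move=> e; rewrite /CInt; congr pair; apply: RInt_ext => t _; rewrite e. Qed.

Lemma CInt_plus f g a b : contR f -> contR g ->
  CInt (fun t => f t + g t) a b = CInt f a b + CInt g a b.
Proof.
move=> /contR_ex hf /contR_ex hg; rewrite /CInt /Cplus /=.
have [f1 f2] := hf a b; have [g1 g2] := hg a b.
by congr pair; [exact: (RInt_plus _ _ _ _ f1 g1)|exact: (RInt_plus _ _ _ _ f2 g2)].
Qed.

Lemma CInt_scal (k : C) f a b : contR f -> CInt (fun t => k * f t) a b = k * CInt f a b.
Proof.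
move=> hc; have [f1 f2] := contR_ex a b hc.
have s (l : R) (u : R -> R) : ex_RInt u a b -> RInt (fun t => l * u t)%R a b = (l * RInt u a b)%R.
  exact: RInt_scal.
have e (l : R) (u : R -> R) : ex_RInt u a b -> ex_RInt (fun t => l * u t)%R a b.
  exact: ex_RInt_scal.
rewrite /CInt /Cmult /=; congr pair; rewrite -!s //.
  exact: (RInt_minus _ _ _ _ (e _ _ f1) (e _ _ f2)).
exact: (RInt_plus _ _ _ _ (e _ _ f2) (e _ _ f1)).
Qed.

Lemma CInt_minus f g a b : contR f -> contR g ->
  CInt (fun t => f t - g t) a b = CInt f a b - CInt g a b.
Proof.
move=> hf hg; rewrite (CInt_ext (g := fun t => f t + - (1) * g t)); last by move=> t; ring.
rewrite CInt_plus ?CInt_scal //; [ring|exact: contR_scal].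
Qed.

Lemma CInt_Chasles f a b c : contR f -> CInt f a b + CInt f b c = CInt f a c.
Proof.
move=> hf; have [f1 f2] := contR_ex a b hf; have [g1 g2] := contR_ex b c hf.
rewrite /CInt /Cplus /=; congr pair; [exact: (RInt_Chasles (fun t => Re (f t)))|].
exact: (RInt_Chasles (fun t => Im (f t))).
Qed.

Lemma CInt_const (k : C) a b : CInt (fun _ => k) a b = (b - a)%R * k.
Proof.
rewrite /CInt !RInt_const /scal /= /mult /=; case: k => x y.
by rewrite /Cmult /RtoC /=; congr pair; ring.
Qed.

Lemma CInt_id a b : CInt RtoC a b = ((b * b - a * a) / 2)%R.
Proof.
rewrite /CInt RInt_const /scal /= /mult /= Rmult_0_r /RtoC; congr pair.
apply: is_RInt_unique.
have -> : ((b * b - a * a) / 2 = minus (b * b / 2) (a * a / 2))%R by rewrite /minus /plus /opp /=; field.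
apply: (is_RInt_derive (fun t => t * t / 2)%R) => t _; last exact: continuous_id.
by auto_derive => //; field.
Qed.

Lemma CInt_shift f a b c : contR f ->
  CInt (fun t => f (t + c)%R) a b = CInt f (a + c) (b + c).
Proof.
move=> hf; have [f1 f2] := contR_ex (1 * a + c) (1 * b + c) hf.
have := RInt_comp_lin (fun t => Re (f t)) 1 c a b f1.
have := RInt_comp_lin (fun t => Im (f t)) 1 c a b f2.
rewrite !Rmult_1_l /CInt => <- <-.
by congr pair; apply: RInt_ext => t _; rewrite /scal /= /mult /= !Rmult_1_l.
Qed.

Lemma CInt_bound f a b M : (a <= b)%R -> contR f ->
  (forall t, (a <= t <= b)%R -> (Cmod (f t) <= M)%R) -> (Cmod (CInt f a b) <= 2 * ((b - a) * M))%R.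
Proof.
move=> ab hf hM; have [f1 f2] := contR_ex a b hf.
apply: Rle_trans (Cmod_components _) _.
have h1 := abs_RInt_le_const _ _ _ M ab f1 (fun t ht => Rle_trans _ _ _ (re_le_Cmod _) (hM t ht)).
have h2 := abs_RInt_le_const _ _ _ M ab f2 (fun t ht => Rle_trans _ _ _ (im_le_Cmod _) (hM t ht)).
rewrite /CInt /=; lra.
Qed.

Lemma CInt_period f c : contR f -> (forall t, f (t + 1)%R = f t) ->
  CInt (fun t => f (t + c)%R) 0 1 = CInt f 0 1.
Proof.
move=> hf per; rewrite CInt_shift // Rplus_0_l.
have e : CInt f 0 c = CInt f 1 (1 + c).
  rewrite -{1}(Rplus_0_l 1) (Rplus_comm 1 c) -CInt_shift //.
  by apply: CInt_ext => t; rewrite per.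
have h1 := CInt_Chasles 0 c (1 + c) hf; have h2 := CInt_Chasles 0 1 (1 + c) hf.
have -> : CInt f c (1 + c) = CInt f 0 (1 + c) - CInt f 0 c by rewrite -h1; ring.
by rewrite -h2 e; ring.
Qed.

End CIntLemmas.


(** The counterclockwise boundary integral: bottom minus top, plus [Ci] times right minus left. Each
    side is parametrised as [z + t * v], the form for which continuity is available. *)
Definition rect_int (F : C -> C) (x y w h : R) : C :=
  CInt (fun t => F (Ci * y + t * 1)) x (x + w) - CInt (fun t => F (Ci * (y + h)%R + t * 1)) x (x + w)
  + Ci * (CInt (fun t => F ((x + w)%R + t * Ci)) y (y + h) - CInt (fun t => F (x + t * Ci)) y (y + h)).

Lemma rect_int_minus (F G : C -> C) x y w h : (forall z, ccont F z) -> (forall z, ccont G z) ->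
  rect_int (fun z => F z - G z) x y w h = rect_int F x y w h - rect_int G x y w h.
Proof.
move=> hF hG; have cF a b := ccont_contR a b hF; have cG a b := ccont_contR a b hG.
by rewrite /rect_int !CInt_minus //; ring.
Qed.

Lemma rect_int_affine (c l : C) x y w h : rect_int (fun z => c + l * z) x y w h = 0.
Proof.
have lin (u v : C) a b : CInt (fun t => c + l * (u + t * v)) a b
    = (b - a)%R * (c + l * u) + l * v * ((b * b - a * a) / 2)%R.
  rewrite (CInt_ext (g := fun t => (c + l * u) + l * v * t)); last by move=> t; ring.
  rewrite CInt_plus ?CInt_const ?CInt_scal ?CInt_id //.
  - exact: contR_id.
  - exact: contR_const.
  - exact: contR_scal contR_id.
by rewrite /rect_int !lin; Cpush; ring.
Qed.

Section Goursat.
Variable F : C -> C.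
Hypothesis hF : forall z, exists l, cderiv F z l.

Lemma entire_ccont z : ccont F z.
Proof. by have [l /cderiv_ccont] := hF z. Qed.

Lemma rect_int_split x y w h : rect_int F x y w h =
  rect_int F x y (w / 2) (h / 2) + rect_int F (x + w / 2) y (w / 2) (h / 2) +
  (rect_int F x (y + h / 2) (w / 2) (h / 2) + rect_int F (x + w / 2) (y + h / 2) (w / 2) (h / 2)).
Proof.
have cF a b := ccont_contR a b entire_ccont.
have e1 : (x + w / 2 + w / 2 = x + w)%R by field.
have e2 : (y + h / 2 + h / 2 = y + h)%R by field.
rewrite /rect_int !e1 !e2.
rewrite -(CInt_Chasles x (x + w / 2) (x + w) (cF (Ci * y) 1)).
rewrite -(CInt_Chasles x (x + w / 2) (x + w) (cF (Ci * (y + h)%R) 1)).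
rewrite -(CInt_Chasles y (y + h / 2) (y + h) (cF ((x + w)%R : C) Ci)).
rewrite -(CInt_Chasles y (y + h / 2) (y + h) (cF (x : C) Ci)).
ring.
Qed.

Lemma rect_int_bound G x y w h M : (0 <= w)%R -> (0 <= h)%R -> (forall z, ccont G z) ->
  (forall s t, (x <= s <= x + w)%R -> (y <= t <= y + h)%R -> (Cmod (G (s + t * Ci)%C) <= M)%R) ->
  (Cmod (rect_int G x y w h) <= 4 * ((w + h) * M))%R.
Proof.
move=> hw hh hG hM; have cG a b := ccont_contR a b hG.
have b1 t : (y <= t <= y + h)%R -> (Cmod (CInt (fun s => G (Ci * t + s * 1)%C) x (x + w)) <= 2 * (w * M))%R.
  move=> ht; have := @CInt_bound (fun s => G (Ci * t + s * 1)) x (x + w) M ltac:(lra) (cG _ _).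
  rewrite (_ : (x + w - x = w)%R); last by ring.
  apply=> s hs; rewrite (_ : Ci * t + s * 1 = s + t * Ci); [exact: hM|ring].
have b2 s : (x <= s <= x + w)%R -> (Cmod (CInt (fun t => G (s + t * Ci)%C) y (y + h)) <= 2 * (h * M))%R.
  move=> hs; have := @CInt_bound (fun t => G (s + t * Ci)) y (y + h) M ltac:(lra) (cG _ _).
  rewrite (_ : (y + h - y = h)%R); last by ring.
  by apply=> t ht; exact: hM.
rewrite /rect_int; apply: Rle_trans (Cmod_triangle _ _) _; rewrite Cmod_mult Cmod_Ci Rmult_1_l.
have := Cmod_triangle (CInt (fun t => G (Ci * y + t * 1)) x (x + w))
  (- CInt (fun t => G (Ci * (y + h)%R + t * 1)) x (x + w)).
have := Cmod_triangle (CInt (fun t => G ((x + w)%R + t * Ci)) y (y + h))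
  (- CInt (fun t => G (x + t * Ci)) y (y + h)).
rewrite !Cmod_opp.
have := b1 y ltac:(lra); have := b1 (y + h)%R ltac:(lra).
have := b2 x ltac:(lra); have := b2 (x + w)%R ltac:(lra).
rewrite /Cminus; lra.
Qed.

Section Bisection.
Variables (x0 y0 w0 h0 : R).

(** Chooses a quarter that carries at least a quarter of the integral in modulus. The last one is
    taken by default; the triangle inequality justifies this when the three tests fail. *)
Definition big_quarter (k : nat) (p : R * R) : R * R :=
  let w := (w0 / 2 ^ k)%R in let h := (h0 / 2 ^ k)%R in
  let J x y := Cmod (rect_int F x y (w / 2) (h / 2)) in
  let m := (Cmod (rect_int F p.1 p.2 w h) / 4)%R in
  if Rle_dec m (J p.1 p.2) then (p.1, p.2) else
  if Rle_dec m (J (p.1 + w / 2)%R p.2) then ((p.1 + w / 2)%R, p.2) else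
  if Rle_dec m (J p.1 (p.2 + h / 2)%R) then (p.1, (p.2 + h / 2)%R) else
  ((p.1 + w / 2)%R, (p.2 + h / 2)%R).

Fixpoint corner (k : nat) : R * R :=
  if k is k'.+1 then big_quarter k' (corner k') else (x0, y0).

Notation wk k := (w0 / 2 ^ k)%R.
Notation hk k := (h0 / 2 ^ k)%R.

Lemma half_pow (u : R) k : (u / 2 ^ k.+1 = u / 2 ^ k / 2)%R.
Proof. by have := pow_lt 2 k ltac:(lra) => p; rewrite /=; field; lra. Qed.

Lemma corner_step k : (0 <= w0)%R -> (0 <= h0)%R ->
  let p := corner k in let q := corner k.+1 in
  (p.1 <= q.1 /\ q.1 + wk k.+1 <= p.1 + wk k /\ p.2 <= q.2 /\ q.2 + hk k.+1 <= p.2 + hk k /\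
  Cmod (rect_int F p.1 p.2 (wk k) (hk k)) / 4 <= Cmod (rect_int F q.1 q.2 (wk k.+1) (hk k.+1)))%R.
Proof.
move=> hw hh p q; rewrite !half_pow.
have pk : (0 < 2 ^ k)%R by apply: pow_lt; lra.
have w1 : (0 <= wk k)%R by apply: Rdiv_le_0_compat.
have h1 : (0 <= hk k)%R by apply: Rdiv_le_0_compat.
rewrite /q /= -/p /big_quarter.
have := rect_int_split p.1 p.2 (wk k) (hk k).
set J0 := rect_int F _ _ (wk k) _; set J1 := rect_int F _ _ _ _; set J2 := rect_int F _ _ _ _.
set J3 := rect_int F _ _ _ _; set J4 := rect_int F _ _ _ _ => eJ.
have tr : (Cmod J0 <= Cmod J1 + Cmod J2 + (Cmod J3 + Cmod J4))%R.
  rewrite eJ; have := Cmod_triangle (J1 + J2) (J3 + J4).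
  have := Cmod_triangle J1 J2; have := Cmod_triangle J3 J4; lra.
case: Rle_dec => [a1|a1] /=; first by rewrite -/J1; repeat split; lra.
case: Rle_dec => [a2|a2] /=; first by rewrite -/J2; repeat split; lra.
case: Rle_dec => [a3|a3] /=; first by rewrite -/J3; repeat split; lra.
by rewrite -/J4; repeat split; lra.
Qed.

End Bisection.

Lemma nested_point (u v : nat -> R) : (forall k, (u k <= u k.+1 /\ v k.+1 <= v k)%R) ->
  (forall k, (u k <= v k)%R) -> exists p, forall k, (u k <= p <= v k)%R.
Proof.
move=> mono uv.
have um j k : (u k <= u (k + j)%N)%R.
  elim: j => [|j IH]; first by rewrite addn0; lra.
  by rewrite addnS; have [a _] := mono (k + j)%N; lra.
have vm j k : (v (k + j)%N <= v k)%R.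
  elim: j => [|j IH]; first by rewrite addn0; lra.
  by rewrite addnS; have [_ a] := mono (k + j)%N; lra.
have cross j k : (u j <= v k)%R.
  by have := um k j; have := vm j k; have := uv (j + k)%N; rewrite (addnC k j); lra.
have [p [ub lub]] := completeness (fun x => exists k, x = u k)
  ltac:(by exists (v 0%N) => x [k ->]) ltac:(by exists (u 0%N), 0%N).
exists p => k; split; first by apply: ub; exists k.
by apply: lub => x [j ->].
Qed.

Lemma goursat x y w h : (0 < w)%R -> (0 < h)%R -> rect_int F x y w h = 0.
Proof.
move=> hw hh.
pose cn := corner x y w h.
have st k := corner_step x y k (Rlt_le _ _ hw) (Rlt_le _ _ hh).
have p2 k : (0 < 2 ^ k)%R by apply: pow_lt; lra.
have wp k : (0 < w / 2 ^ k)%R by apply: Rdiv_lt_0_compat.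
have hp k : (0 < h / 2 ^ k)%R by apply: Rdiv_lt_0_compat.
have [px hx] := @nested_point (fun k => (cn k).1) (fun k => ((cn k).1 + w / 2 ^ k)%R)
  (fun k => ltac:(have := st k; rewrite -/cn; tauto)) (fun k => ltac:(have := wp k; lra)).
have [py hy] := @nested_point (fun k => (cn k).2) (fun k => ((cn k).2 + h / 2 ^ k)%R)
  (fun k => ltac:(have := st k; rewrite -/cn; tauto)) (fun k => ltac:(have := hp k; lra)).
pose Jk k := rect_int F (cn k).1 (cn k).2 (w / 2 ^ k) (h / 2 ^ k).
have big k : (Cmod (rect_int F x y w h) <= 4 ^ k * Cmod (Jk k))%R.
  elim: k => [|k IH].
    by rewrite /Jk /= !Rdiv_1_r Rmult_1_l; lra.
  have [_ [_ [_ [_ hJ]]]] := st k; rewrite -/cn -/(Jk k) -/(Jk k.+1) in hJ.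
  have := pow_lt 4 k ltac:(lra); rewrite /= => p4; nra.
pose p : C := px + py * Ci.
have [l hl] := hF p.
apply: Cmod_eq_0; apply: Rle_antisym; last exact: Cmod_ge_0.
apply: le_epsilon => eps he; rewrite Rplus_0_l.
pose q := (w + h)%R.
have q0 : (0 < q)%R by rewrite /q; lra.
(* At depth [k] the integral is at most [4 * r * (e * r)] with [r = q / 2 ^ k]; multiplied by
   [4 ^ k] this is [4 * q * q * e = eps]. *)
pose e := (eps / (4 * (q * q)))%R.
have e0 : (0 < e)%R by apply: Rdiv_lt_0_compat => //; nra.
have [d d0 hd] := hl e e0.
have [k hk] : exists k, (q / 2 ^ k < d)%R.
  have [k hk] := Pow_x_infinity 2 ltac:(rewrite Rabs_pos_eq; lra) (q / d + 1).
  exists k; have := hk k ltac:(lia); rewrite Rabs_pos_eq; last by have := p2 k; lra.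
  move=> h2; apply: (Rmult_lt_reg_r (2 ^ k)) => //.
  have -> : (q / 2 ^ k * 2 ^ k = q)%R by field; have := p2 k; lra.
  apply: Rlt_le_trans (_ : _ < d * (q / d + 1))%R _; last by apply: Rmult_le_compat_l; lra.
  have -> : (d * (q / d + 1) = q + d)%R by field; lra.
  lra.
(* The affine approximation of [F] at the common point [p]; its boundary integral vanishes, so only
   the differentiability error is left. *)
pose Gr z := (F p - l * p) + l * z.
have cG z : ccont Gr z.
  apply: (cderiv_ccont (l := l)) => eps' he'; exists 1%R; first lra.
  move=> h' _; rewrite /Gr (_ : _ - _ - _ = 0); last by ring.
  by rewrite Cmod_0; have := Cmod_ge_0 h'; nra.
have cFG z : ccont (fun z => F z - Gr z) z.
  have [lz hz] := hF z; apply: (cderiv_ccont (l := lz - l)) => eps' he'.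
  have [d' d0' hd'] := hz eps' he'; exists d' => // h' /hd'.
  rewrite /Gr; have -> // : forall a b c : C,
    a - (F p - l * p + l * (z + h')) - (b - (F p - l * p + l * z)) - h' * (c - l) = a - b - h' * c.
  by move=> *; ring.
have eJ : Jk k = rect_int (fun z => F z - Gr z) (cn k).1 (cn k).2 (w / 2 ^ k) (h / 2 ^ k).
  by rewrite rect_int_minus ?rect_int_affine //; [rewrite /Jk; ring|exact: entire_ccont].
pose r := (q / 2 ^ k)%R.
have r0 : (0 < r)%R by apply: Rdiv_lt_0_compat.
have er : (w / 2 ^ k + h / 2 ^ k = r)%R by rewrite /r /q; field; have := p2 k; lra.
have bJ : (Cmod (Jk k) <= 4 * (r * (e * r)))%R.
  rewrite eJ -{1}er; apply: rect_int_bound => //; try exact: Rlt_le.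
  move=> s t hs ht.
  have hz : (Cmod (s + t * Ci - p)%C <= r)%R.
    have -> : s + t * Ci - p = (s - px)%R + (t - py)%R * Ci by rewrite /p; Cpush; ring.
    apply: Rle_trans (Cmod_triangle _ _) _; rewrite Cmod_mult Cmod_Ci !Cmod_R -er.
    have := hx k; have := hy k; split_Rabs; lra.
  have := hd (s + t * Ci - p) ltac:(rewrite -/r in hk; lra).
  have -> : p + (s + t * Ci - p) = s + t * Ci by ring.
  have -> : F (s + t * Ci) - F p - (s + t * Ci - p) * l = F (s + t * Ci) - Gr (s + t * Ci) by rewrite /Gr; ring.
  move=> h1; apply: Rle_trans h1 _; apply: Rmult_le_compat_l; lra.
apply: Rle_trans (big k) _.
have -> : eps = (4 ^ k * (4 * (r * (e * r))))%R.
  have -> : (4 = 2 * 2)%R by ring.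
  rewrite /r /e Rpow_mult_distr; have := p2 k; move: (2 ^ k)%R => c c0; field; split; lra.
apply: Rmult_le_compat_l => //; apply: pow_le; lra.
Qed.

End Goursat.

(** In a rectangle of width one period the vertical sides cancel, and Goursat equates the horizontal
    ones. Real translations are covered by periodicity of the integrand. *)
Lemma mean_shift (G : C -> C) (z0 z1 : C) : (forall z, exists l, cderiv G z l) ->
  (forall z, G (z + 1) = G z) ->
  CInt (fun t => G (z0 + t)) 0 1 = CInt (fun t => G (z1 + t)) 0 1.
Proof.
move=> hG per.
have cG z : ccont G z by have [l /cderiv_ccont] := hG z.
have cR z : contR (fun t : R => G (z + t)).
  by apply: contR_ext (ccont_contR z 1 cG) => t; rewrite Cmult_1_r.
have realshift (z : C) (c : R) : CInt (fun t => G (z + c + t)) 0 1 = CInt (fun t => G (z + t)) 0 1.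
  rewrite -(CInt_period c (cR z)); last by move=> t; rewrite RtoC_plus Cplus_assoc per.
  by apply: CInt_ext => t; congr G; rewrite RtoC_plus; ring.
have vert (x y h : R) : (0 < h)%R ->
    CInt (fun t => G (Ci * y + t)) 0 1 = CInt (fun t => G (Ci * (y + h)%R + t)) 0 1.
  move=> hh; have := goursat hG 0 y Rlt_0_1 hh; rewrite /rect_int !Rplus_0_l.
  have -> : CInt (fun t => G (1%R + t * Ci)) y (y + h) = CInt (fun t => G (0%R + t * Ci)) y (y + h).
    by apply: CInt_ext => t; rewrite -(per (0%R + _)); congr G; ring.
  move=> e.
  rewrite (CInt_ext (g := fun t => G (Ci * y + t * 1))); last by move=> t; rewrite Cmult_1_r.
  rewrite [RHS](CInt_ext (g := fun t => G (Ci * (y + h)%R + t * 1))); last by move=> t; rewrite Cmult_1_r.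
  apply/Ceq_minus; rewrite -[RHS]e; ring.
have red (z : C) : CInt (fun t => G (z + t)) 0 1 = CInt (fun t => G (Ci * Im z + t)) 0 1.
  rewrite -(realshift (Ci * Im z) (Re z)); apply: CInt_ext => t; congr (G (_ + _)).
  by case: z => a b; rewrite /Cplus /Cmult /Ci /RtoC /=; congr pair; ring.
rewrite (red z0) (red z1).
case: (Rtotal_order (Im z0) (Im z1)) => [h|[->|h]] //.
  rewrite (vert 0 (Im z0) (Im z1 - Im z0))%R; last lra.
  by rewrite (_ : (Im z0 + (Im z1 - Im z0) = Im z1)%R) //; ring.
symmetry; rewrite (vert 0 (Im z1) (Im z0 - Im z1))%R; last lra.
by rewrite (_ : (Im z1 + (Im z0 - Im z1) = Im z0)%R) //; ring.
Qed.

(** * Pointwise Fourier inversion *)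

Lemma ccont_mult f g z : ccont f z -> ccont g z -> ccont (fun w => f w * g w) z.
Proof.
move=> hf hg eps he.
pose K := (Cmod (f z) + Cmod (g z) + 1)%R.
have fz := Cmod_ge_0 (f z); have gz := Cmod_ge_0 (g z).
have K0 : (0 < K)%R by rewrite /K; lra.
pose e := Rmin 1 (eps / K).
have e0 : (0 < e)%R by apply: Rmin_pos; [lra|exact: Rdiv_lt_0_compat].
have e1 : (e <= 1)%R := Rmin_l _ _.
have eK : (e * K <= eps)%R.
  by apply Rle_div_r; [lra|exact: Rmin_r].
have [d1 p1 h1] := hf e e0; have [d2 p2 h2] := hg e e0.
exists (Rmin d1 d2); first exact: Rmin_pos.
move=> h hh; have a1 := h1 h (Rlt_le_trans _ _ _ hh (Rmin_l _ _)).
have a2 := h2 h (Rlt_le_trans _ _ _ hh (Rmin_r _ _)).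
have -> : f (z + h) * g (z + h) - f z * g z = (f (z + h) - f z) * (g (z + h) - g z)
  + (f z * (g (z + h) - g z) + (f (z + h) - f z) * g z) by ring.
apply: Rle_lt_trans (Cmod_triangle _ _) _.
have := Cmod_triangle (f z * (g (z + h) - g z)) ((f (z + h) - f z) * g z).
rewrite !Cmod_mult.
move: (Cmod (f (z + h) - f z)) (Cmod_ge_0 (f (z + h) - f z)) a1 => x x0 a1.
move: (Cmod (g (z + h) - g z)) (Cmod_ge_0 (g (z + h) - g z)) a2 => y y0 a2 t.
apply: Rle_lt_trans (Rplus_le_compat_l _ _ _ t) _.
have : (x * y <= e * y)%R by apply: Rmult_le_compat_r; lra.
have : (x * Cmod (g z) <= e * Cmod (g z))%R by apply: Rmult_le_compat_r; lra.
have : (Cmod (f z) * y <= Cmod (f z) * e)%R by apply: Rmult_le_compat_l; lra.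
rewrite /K in eK; nra.
Qed.

Lemma ccont_inv (f : C -> C) z : f z <> 0 -> ccont f z -> ccont (fun w => / f w) z.
Proof.
move=> nz hf eps he; have [d d0 hd] := Cinv_ccont nz he.
have [d' d0' hd'] := hf d d0; exists d' => // h /hd' /hd.
by have -> : f z + (f (z + h) - f z) = f (z + h) by ring.
Qed.

Lemma ccont_local f g z d : (0 < d)%R -> (forall h, (Cmod h < d)%R -> f (z + h) = g (z + h)) ->
  ccont f z -> ccont g z.
Proof.
move=> hd e hf eps he; have [d' d0' hd'] := hf eps he.
exists (Rmin d d'); first exact: Rmin_pos.
move=> h hh; have e0 := e 0; rewrite Cplus_0_r Cmod_0 in e0.
rewrite -(e0 hd) -e; last exact: Rlt_le_trans hh (Rmin_l _ _).
apply: hd'; exact: Rlt_le_trans hh (Rmin_r _ _).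
Qed.

Lemma cderiv_mult f g z l m : cderiv f z l -> cderiv g z m ->
  cderiv (fun w => f w * g w) z (l * g z + f z * m).
Proof.
move=> hf hg eps he.
have cg := cderiv_ccont hg.
pose K := (Cmod l + Cmod (f z) + Cmod (g z) + 1)%R.
have fz := Cmod_ge_0 (f z); have gz := Cmod_ge_0 (g z); have l0 := Cmod_ge_0 l.
have K0 : (0 < K)%R by rewrite /K; lra.
pose e := Rmin 1 (eps / K).
have e0 : (0 < e)%R by apply: Rmin_pos; [lra|exact: Rdiv_lt_0_compat].
have e1 : (e <= 1)%R := Rmin_l _ _.
have eK : (e * K <= eps)%R.
  by apply Rle_div_r; [lra|exact: Rmin_r].
have [d1 p1 h1] := hf e e0; have [d2 p2 h2] := hg e e0; have [d3 p3 h3] := cg e e0.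
exists (Rmin d1 (Rmin d2 d3)); first by repeat apply: Rmin_pos.
move=> h hh; have m1 := Rmin_l d1 (Rmin d2 d3); have m2 := Rmin_r d1 (Rmin d2 d3).
have m3 := Rmin_l d2 d3; have m4 := Rmin_r d2 d3.
have {h1}a1 := h1 h ltac:(lra); have {h2}a2 := h2 h ltac:(lra); have {h3}a3 := h3 h ltac:(lra).
have -> : f (z + h) * g (z + h) - f z * g z - h * (l * g z + f z * m) =
  ((f (z + h) - f z - h * l) * (g (z + h) - g z) + (f (z + h) - f z - h * l) * g z)
  + (h * l * (g (z + h) - g z) + f z * (g (z + h) - g z - h * m)) by ring.
apply: Rle_trans (Cmod_triangle _ _) _.
apply: Rle_trans (Rplus_le_compat _ _ _ _ (Cmod_triangle _ _) (Cmod_triangle _ _)) _.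
rewrite !Cmod_mult.
move: (Cmod _) (Cmod_ge_0 (f (z + h) - f z - h * l)) a1 => x x0 a1.
move: (Cmod (g (z + h) - g z)) (Cmod_ge_0 (g (z + h) - g z)) a3 => y y0 a3.
move: (Cmod (g _ - _ - _)) a2 => w a2.
have h0 := Cmod_ge_0 h; move: (Cmod h) h0 a1 a2 {hh} => H H0 a1 a2.
have : (x * y <= e * H)%R by nra.
have : (x * Cmod (g z) <= e * H * Cmod (g z))%R by apply: Rmult_le_compat_r.
have : (H * Cmod l * y <= H * Cmod l * e)%R by apply: Rmult_le_compat_l; [nra|lra].
have : (Cmod (f z) * w <= Cmod (f z) * (e * H))%R by apply: Rmult_le_compat_l.
have : (e * K * H <= eps * H)%R by apply: Rmult_le_compat_r.
rewrite /K; nra.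
Qed.

Lemma cderiv_scale f (c z z0 l : C) : cderiv f (z0 + c * z) l ->
  cderiv (fun w => f (z0 + c * w)) z (c * l).
Proof.
move=> hf eps he; have p : (0 < Cmod c + 1)%R by have := Cmod_ge_0 c; lra.
have [d d0 hd] := hf (eps / (Cmod c + 1))%R (Rdiv_lt_0_compat _ _ he p).
exists (d / (Cmod c + 1))%R; first exact: Rdiv_lt_0_compat.
move=> h hh.
have small : (Cmod (c * h) < d)%R.
  rewrite Cmod_mult; apply: Rle_lt_trans (_ : _ <= (Cmod c + 1) * Cmod h)%R _.
    by have := Cmod_ge_0 h; nra.
  have -> : d = ((Cmod c + 1) * (d / (Cmod c + 1)))%R by field; lra.
  exact: Rmult_lt_compat_l.
have := hd _ small.
have -> : z0 + c * z + c * h = z0 + c * (z + h) by ring.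
have -> : h * (c * l) = c * h * l by ring.
move=> b; apply: Rle_trans b _; rewrite Cmod_mult.
have c0 := Cmod_ge_0 c; have h0 := Cmod_ge_0 h.
apply: Rle_trans (_ : _ <= eps / (Cmod c + 1) * ((Cmod c + 1) * Cmod h))%R _.
  apply: Rmult_le_compat_l; last nra.
  exact/Rlt_le/Rdiv_lt_0_compat.
by right; field; lra.
Qed.

Lemma continuity_pt_of (f : R -> R) t : continuous f t -> continuity_pt f t.
Proof. by move=> h; apply/continuity_pt_filterlim. Qed.

Lemma contR_E (m : Z) : contR (fun t => E (- (IZR m * t))).
Proof.
apply: contR_ext (ccont_contR 0 (- IZR m) E_ccont) => t; congr E; ring.
Qed.

Lemma E_half_shift (m : Z) (t : R) : m <> 0%Z ->
  E (- (IZR m * (t + / (2 * IZR m))%R)) = - E (- (IZR m * t)).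
Proof.
move=> hm; have mz : IZR m <> 0%R by apply: not_0_IZR.
have -> : - (IZR m * (t + / (2 * IZR m))%R) = - (IZR m * t) + 1 / 2 + IZR (- 1).
  rewrite RtoC_plus RtoC_inv; last by lra.
  by rewrite RtoC_mult; field; exact: RtoC_neq0.
by rewrite E_periodic E_plus E_half; ring.
Qed.

Lemma E_int_period (m : Z) (t : R) : E (- (IZR m * (t + 1)%R)) = E (- (IZR m * t)).
Proof.
rewrite -[RHS](E_periodic _ (- m)); congr E; rewrite RtoC_plus opp_IZR RtoC_opp; ring.
Qed.

(** Translation by [h = 1 / (2 m)] changes the sign of the exponential, so twice the integral equals
    that of [q t - q (t + h)] against the exponential. Uniform continuity makes it small once
    [Rabs h < d], which the choice of [K] ensures. *)
Lemma riemann_lebesgue (q : R -> C) : contR q -> (forall t, q (t + 1)%R = q t) ->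
  forall eps : R, (0 < eps)%R -> exists K : Z, forall m : Z, (K <= Z.abs m)%Z ->
  (Cmod (CInt (fun t => q t * E (- (IZR m * t)))%C 0 1) < eps)%R.
Proof.
move=> hq per eps he; have e8 : (0 < eps / 8)%R by lra.
have [[d1 p1] /= h1] := @Heine_cor2 (fun t => Re (q t)) (-1) 2
  (fun t _ => continuity_pt_of (proj1 (hq t))) (mkposreal _ e8).
have [[d2 p2] /= h2] := @Heine_cor2 (fun t => Im (q t)) (-1) 2
  (fun t _ => continuity_pt_of (proj2 (hq t))) (mkposreal _ e8).
pose d := Rmin d1 d2; have d0 : (0 < d)%R by apply: Rmin_pos.
have [K hK] : exists K : Z, (1 <= K)%Z /\ (/ d < IZR K)%R.
  have [hk _] := archimed (/ d); exists (Z.max 1 (up (/ d))); split; first lia.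
  by apply: Rlt_le_trans hk _; apply: IZR_le; lia.
exists K => m hm.
have m0 : m <> 0%Z by lia.
have mz : IZR m <> 0%R by apply: not_0_IZR.
pose h := (/ (2 * IZR m))%R.
have am : (IZR K <= Rabs (IZR m))%R by rewrite -abs_IZR; apply: IZR_le.
have K1 : (1 <= IZR K)%R by apply: (IZR_le 1); lia.
have hh : (Rabs h < d /\ Rabs h <= 1)%R.
  rewrite /h Rabs_inv Rabs_mult (Rabs_pos_eq 2); last lra.
  have i0 := Rinv_0_lt_compat _ d0.
  split; last by rewrite -Rinv_1; apply: Rinv_le_contravar; lra.
  rewrite -(Rinv_inv d); apply: Rinv_lt_contravar; last lra.
  by apply: Rmult_lt_0_compat; lra.
pose u t := q t * E (- (IZR m * t)).
have cu : contR u by apply: contR_mult => //; exact: contR_E.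
have pu t : u (t + 1)%R = u t by rewrite /u per E_int_period.
have cqh : contR (fun t => q (t + h)%R) := contR_shift h hq.
have e2 : 2 * CInt u 0 1 = CInt (fun t => (q t - q (t + h)%R) * E (- (IZR m * t))) 0 1.
  have -> : 2 * CInt u 0 1 = CInt u 0 1 + CInt (fun t => u (t + h)%R) 0 1.
    rewrite CInt_period //; ring.
  rewrite -CInt_plus //; last exact: contR_shift.
  by apply: CInt_ext => t; rewrite /u E_half_shift //; ring.
have bd := @CInt_bound (fun t => (q t - q (t + h)%R) * E (- (IZR m * t))) 0 1 (eps / 4) ltac:(lra) _ _.
have {bd} : (Cmod (2 * CInt u 0 1)%C <= 2 * ((1 - 0) * (eps / 4)))%R.
  rewrite e2; apply: bd; first by apply: contR_mult; [exact: contR_minus|exact: contR_E].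
  move=> t ht; rewrite Cmod_mult.
  have -> : Cmod (E (- (IZR m * t))) = 1%R.
    rewrite Cmod_E -exp_0; congr exp.
    by rewrite -RtoC_mult -RtoC_opp im_RtoC; ring.
  rewrite Rmult_1_r; apply: Rle_trans (Cmod_components _) _.
  have a : (Rabs (t - (t + h)) < d)%R by rewrite (_ : (t - (t + h) = - h)%R) ?Rabs_Ropp; [tauto|ring].
  have r1 : (-1 <= t + h <= 2)%R by move: hh => [_]; split_Rabs; lra.
  have := h1 t (t + h)%R ltac:(lra) r1 (Rlt_le_trans _ _ _ a (Rmin_l _ _)).
  have := h2 t (t + h)%R ltac:(lra) r1 (Rlt_le_trans _ _ _ a (Rmin_r _ _)).
  have -> : Re (q t - q (t + h)%R) = (Re (q t) - Re (q (t + h)%R))%R by [].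
  have -> : Im (q t - q (t + h)%R) = (Im (q t) - Im (q (t + h)%R))%R by [].
  lra.
rewrite Cmod_mult Cmod_R Rabs_pos_eq; last lra.
rewrite -/u; lra.
Qed.

(** For [m <> 0] the half-period shift turns the integral into its opposite. *)
Lemma CInt_E (m : Z) : CInt (fun t => E (- (IZR m * t))) 0 1 = if (m =? 0)%Z then RtoC 1 else 0.
Proof.
case: Z.eqb_spec => [->|hm].
  rewrite (CInt_ext (g := fun _ => RtoC 1)); last first.
    by move=> t; rewrite Cmult_0_l (_ : - 0 = 0) ?E_0 //; ring.
  by rewrite CInt_const; rewrite Rminus_0_r; ring.
have h := CInt_period (/ (2 * IZR m)) (contR_E m) (E_int_period m).
rewrite (CInt_ext (g := fun t => - (1) * E (- (IZR m * t)))) in h; last first.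
  by move=> t; rewrite E_half_shift //; ring.
rewrite CInt_scal in h; last exact: contR_E.
move: (CInt _ _ _) h => x h.
have -> : x = (x - - (1) * x) / 2 by field.
by rewrite h; field.
Qed.

(* Writing [Phi = Phi 0 + (E - 1) Q] with [Q] continuous makes the Fourier
   series of [Phi] at 0 telescope (Chernoff). *)
Lemma fourier_telescope (Phi : C -> C) : (forall z, exists l, cderiv Phi z l) ->
  (forall z, Phi (z + 1) = Phi z) ->
  exists U : Z -> C,
    (forall m, CInt (fun t => Phi t * E (- (IZR m * t))) 0 1 =
       (if (m =? 0)%Z then Phi 0 else 0) + (U (m - 1)%Z - U m)) /\
    forall eps : R, (0 < eps)%R -> exists K : Z, forall m : Z, (K <= Z.abs m)%Z ->
      (Cmod (U m) < eps)%R.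
Proof.
move=> hPhi per.
have perZ z (k : Z) : Phi (z + IZR k) = Phi z.
  elim/Z.peano_ind: k z => [|k IH|k IH] z; first by rewrite Cplus_0_r.
    by rewrite succ_IZR RtoC_plus Cplus_assoc per IH.
  rewrite -(per (z + _)) -Z.sub_1_r minus_IZR RtoC_minus.
  by rewrite (_ : z + (IZR k - 1) + 1 = z + IZR k) ?IH //; ring.
have cPhi z : ccont Phi z by have [l /cderiv_ccont] := hPhi z.
have [l hl] := hPhi 0.
have hE := @E_cderiv 0; rewrite E_0 Cmult_1_l in hE.
pose c : C := 2 * PI * Ci.
have c0 : c <> 0.
  apply: Cmult_neq_0; last exact: Ci_nz.
  by rewrite -RtoC_mult; apply: RtoC_neq0; have := PI_RGT_0; lra.
pose quo (f : C -> C) (m h : C) := if excluded_middle_informative (h = 0) then m else (f h - f 0) / h.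
have quo0 f m : quo f m 0 = m by rewrite /quo; case: excluded_middle_informative => [a|a] //=.
have quoN f m (h : C) : h <> 0 -> quo f m h = (f h - f 0) / h.
  by move=> nz; rewrite /quo; case: excluded_middle_informative => [a|a] //=.
have quo_cont f m : cderiv f 0 m -> ccont (quo f m) 0.
  move=> hf eps he; have [d d0 hd] := hf (eps / 2)%R ltac:(lra).
  exists d => // h hh; rewrite Cplus_0_l quo0.
  case: (classic (h = 0)) => [->|nz].
    by rewrite quo0 (_ : m - m = 0) ?Cmod_0 //; ring.
  rewrite quoN //.
  have := hd h hh; rewrite Cplus_0_l => b.
  have -> : (f h - f 0) / h - m = / h * (f h - f 0 - h * m) by field.
  have h0 := proj1 (Cmod_gt_0 h) nz.
  rewrite Cmod_mult Cmod_inv //; apply: (Rmult_lt_reg_l (Cmod h)) => //.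
  rewrite -Rmult_assoc Rinv_r; last lra.
  nra.
(* At the zeros of [E - 1], which are the integers, the value is the limit [l / c] of the quotient,
   with [l] and [c] the derivatives of [Phi] and [E] at 0. *)
pose Q (z : C) := if excluded_middle_informative (E z = 1) then l / c else (Phi z - Phi 0) / (E z - 1).
have Q1 z : E z = 1 -> Q z = l / c by move=> e; rewrite /Q; case: excluded_middle_informative => [a|a] //=.
have QN z : E z <> 1 -> Q z = (Phi z - Phi 0) / (E z - 1).
  by move=> e; rewrite /Q; case: excluded_middle_informative => [a|a] //=.
have Qper z (k : Z) : Q (z + IZR k) = Q z by rewrite /Q E_periodic perZ.
have cQ z : ccont Q z.
  case: (classic (E z = 1)) => hz; last first.
    have nz : E z - 1 <> 0 by move=> e; apply: hz; apply/Ceq_minus.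
    have cE : ccont (fun w => E w - 1) z.
      move=> eps he; have [d d0 hd] := @E_ccont z eps he; exists d => // h /hd.
      by rewrite (_ : E (z + h) - 1 - (E z - 1) = E (z + h) - E z) //; ring.
    have cN : ccont (fun w => Phi w - Phi 0) z.
      move=> eps he; have [d d0 hd] := cPhi z eps he; exists d => // h /hd.
      by rewrite (_ : Phi (z + h) - Phi 0 - (Phi z - Phi 0) = Phi (z + h) - Phi z) //; ring.
    have [d d0 hd] := cE (Cmod (E z - 1)) (proj1 (Cmod_gt_0 _) nz).
    have cq := ccont_mult cN (ccont_inv (f := fun w => E w - 1) nz cE).
    apply: (ccont_local d0 _ cq) => h /hd hh.
    rewrite QN // => e; move: hh; rewrite e.
    have -> : 1 - 1 - (E z - 1) = - (E z - 1) by ring.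
    by rewrite Cmod_opp => /Rlt_irrefl.
  have [k hk] := E_eq1 hz.
  (* Near 0 the function [Q] is a quotient of two difference quotients, each continuous at 0; the
     other integers follow by periodicity. Radius 1 excludes them from the neighbourhood of 0. *)
  have D0 : ccont (fun h => quo Phi l h * / quo E c h) 0.
    apply: ccont_mult; first exact: quo_cont.
    apply: ccont_inv; last exact: quo_cont.
    by rewrite quo0.
  have Q0 : ccont Q 0.
    have half : (0 < 1)%R by lra.
    apply: (ccont_local half _ D0) => h hh; rewrite Cplus_0_l.
    case: (classic (h = 0)) => [->|nz]; first by rewrite !quo0 Q1 ?E_0.
    rewrite !quoN //; case: (classic (E h = 1)) => [e|ne].
      have [k' hk'] := E_eq1 e; case: nz; rewrite hk' Cmod_R -abs_IZR in hh *.
      have : (Z.abs k' < 1)%Z by apply: lt_IZR.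
      by move=> ?; have -> : k' = 0%Z by lia.
    have ne' : E h - 1 <> 0 by move=> e; apply: ne; apply/Ceq_minus.
    by rewrite QN // E_0; field.
  move=> eps he; have [d d0 hd] := Q0 eps he; exists d => // h /hd.
  have -> : Q z = Q 0 by rewrite hk -(Cplus_0_l (IZR k)) Qper.
  by rewrite Cplus_0_l hk Cplus_comm Qper.
have qR : contR (fun t : R => Q t).
  by apply: contR_ext (ccont_contR 0 1 cQ) => t; congr Q; ring.
have qper (t : R) : Q (t + 1)%R = Q t by rewrite RtoC_plus (Qper t 1%Z).
exists (fun m => CInt (fun t => Q t * E (- (IZR m * t))) 0 1); split; last first.
  exact: riemann_lebesgue.
move=> m.
have ePhi z : Phi z = Phi 0 + (E z - 1) * Q z.
  case: (classic (E z = 1)) => [e|ne].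
    have [k ->] := E_eq1 e; rewrite -{1}(Cplus_0_l (IZR k)) perZ E_Z; ring.
  have ne' : E z - 1 <> 0 by move=> e; apply: ne; apply/Ceq_minus.
  by rewrite QN //; field.
have -> : (if (m =? 0)%Z then Phi 0 else 0) = Phi 0 * CInt (fun t => E (- (IZR m * t))) 0 1.
  by rewrite CInt_E; case: Z.eqb => //; ring.
rewrite -CInt_scal ?contR_E //; last exact: contR_E.
rewrite -CInt_minus; first last.
- by apply: contR_mult => //; exact: contR_E.
- by apply: contR_mult => //; exact: contR_E.
rewrite -CInt_plus; first last.
- by apply: contR_minus; apply: contR_mult => //; exact: contR_E.
- by apply: contR_scal; exact: contR_E.
apply: CInt_ext => t; rewrite {1}ePhi.
have -> : E (- (IZR (m - 1) * t)) = E (- (IZR m * t)) * E t.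
  by rewrite -E_plus; congr E; Cpush; ring.
ring.
Qed.

(** Convergence is already known, so the value of [S - p] can be read on windows from [- K] to
    [K - 1], where the sum is [U (- K) - U K] and hence small. *)
Lemma telescoping_sum (b U : Z -> C) (S p : C) : has_sum b S ->
  (forall k, b k = (if k == 0%Z then p else 0) + (U k - U (k + 1)%Z)) ->
  (forall eps : R, (0 < eps)%R -> exists K : Z, forall m : Z, (K <= Z.abs m)%Z ->
      (Cmod (U m) < eps)%R) -> S = p.
Proof.
move=> hb eb hU.
have h0 := has_sum_plus hb (has_sum_scal (- (1)) (has_sum_single 0%Z p)).
have {}h0 : has_sum (fun k => U k - U (k + 1)%Z) (S + - (1) * p).
  by apply: has_sum_ext h0 => k; rewrite eb; ring.
have -> : S = S + - (1) * p + p by ring.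
suff -> : S + - (1) * p = 0 by ring.
move: (S + _) h0 => L h0 {S hb}.
apply: Cmod_eq_0; apply: Rle_antisym; last exact: Cmod_ge_0.
apply: le_epsilon => eps he; rewrite Rplus_0_l.
have [s0 hs] := h0 (eps / 2)%R ltac:(lra).
have [K1 hK] := hU (eps / 4)%R ltac:(lra).
pose K := (Z.abs_nat K1 + foldr maxn 0%N (map Z.abs_nat s0) + 1)%N.
pose f (i : nat) := (Z.of_nat i - Z.of_nat K)%Z.
have tel j : psum (fun k => U k - U (k + 1)%Z) (map f (iota 0 j)) = U (f 0%N) - U (f j).
  elim: j => [|j IH]; first by rewrite /psum big_nil; ring.
  rewrite -addn1 iotaD map_cat /psum big_cat /= -/(psum _ _) IH big_seq1 add0n.
  have -> : (f j + 1)%Z = f (j + 1)%N by rewrite /f; lia.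
  ring.
have := hs (map f (iota 0 (K + K))) _ _.
have u : uniq (map f (iota 0 (K + K))).
  by rewrite map_inj_uniq ?iota_uniq // => a b'; rewrite /f; lia.
move=> /(_ u) {}hs.
have {}hs : (Cmod (psum (fun k => U k - U (k + 1)%Z)%C (map f (iota 0 (K + K))) - L)%C < eps / 2)%R.
  apply: hs => i hi.
  have b' : (Z.abs_nat i < K)%N.
    rewrite /K addn1 ltnS; apply: leq_trans (leq_addl _ _).
    by elim: (s0) hi => //= a s IH; rewrite inE => /orP[/eqP->|/IH]; lia.
  apply/mapP; exists (Z.to_nat (i + Z.of_nat K)); first by rewrite mem_iota; lia.
  by rewrite /f; lia.
rewrite tel in hs.
have b1 := hK (f 0%N) ltac:(rewrite /f /K; lia).
have b2 := hK (f (K + K)%N) ltac:(rewrite /f /K; lia).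
have -> : L = (U (f 0%N) - U (f (K + K)%N)) - (U (f 0%N) - U (f (K + K)%N) - L) by ring.
apply: Rle_trans (Cmod_triangle _ _) _; rewrite Cmod_opp.
have := Cmod_triangle (U (f 0%N)) (- U (f (K + K)%N)); rewrite Cmod_opp.
rewrite /Cminus in hs *; lra.
Qed.

(** * The space of theta functions *)

Lemma Csum_ext (I : finType) (F G : I -> C) : (forall i, F i = G i) -> Csum F = Csum G.
Proof. by move=> e; apply: eq_bigr => i _. Qed.

Lemma Csum_scal (I : finType) c (F : I -> C) : c * Csum F = Csum (fun i => c * F i).
Proof. exact: (big_morph (Cmult c) (Cmult_plus_distr_l _) (Cmult_0_r _)). Qed.

Lemma Csum_exchange (I J : finType) (F : I -> J -> C) :
  Csum (fun i => Csum (fun j => F i j)) = Csum (fun j => Csum (fun i => F i j)).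
Proof. exact: exchange_big. Qed.

Lemma Csum_single (I : finType) (i0 : I) (F : I -> C) :
  (forall i, i != i0 -> F i = 0) -> Csum F = F i0.
Proof.
move=> h; rewrite /Csum (bigD1 i0) //= big1 ?Cplus_0_r //.
Qed.

Lemma Csum_pair (I J : finType) (F : I -> J -> C) :
  Csum (fun i => Csum (fun j => F i j)) = Csum (fun ij : I * J => F ij.1 ij.2).
Proof. by rewrite /Csum pair_big. Qed.

(** * The functions psi form a basis *)

Section Basis.
Variables (n : nat) (tau : C).
Hypotheses (hn : (1 <= n)%N) (htau : (0 < Im tau)%R).
Notation N := (INR n).
Notation nZ := (Z.of_nat n).
Notation A := (Im tau).
Notation o := ((N - 1) / 2)%R.
Notation V := (Ve n tau).

Lemma E_offset : E o = Cpow (- 1%R) n.-1.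
Proof.
have -> : RtoC o = INR n.-1 * (1 / 2).
  rewrite RtoC_div; last lra.
  have -> : INR n.-1 = (N - 1)%R by rewrite -(prednK hn) S_INR /=; ring.
  by Cpush; field.
by rewrite E_pow E_half.
Qed.

Lemma Cpow_m1_sq k : Cpow (- 1%R) k * Cpow (- 1%R) k = 1.
Proof.
elim: k => [|k IH] /=; first by ring.
have -> : forall a b : C, - a * b * (- a * b) = a * a * (b * b) by move=> *; ring.
by rewrite IH; ring.
Qed.

Lemma E_opp_offset : E (- RtoC o) = Cpow (- 1%R) n.-1.
Proof.
have h := Cpow_m1_sq n.-1; rewrite E_opp E_offset; move: (Cpow _ _) h => x h.
have nz : x <> 0 by move=> e; rewrite e Cmult_0_l in h; move: h => /RtoC_inj; lra.
by rewrite -[RHS]Cmult_1_r -(Cinv_r x nz) Cmult_assoc h; ring.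
Qed.

Lemma Ve_tau_factor z :
  Cexp (- (PI * Ci * N * tau) - 2%R * PI * Ci * N * z) = E (- (N * tau / 2) - N * z).
Proof. by rewrite E_Cexp; congr Cexp; field. Qed.

Lemma psi_sum (a : 'I_n) z :
  has_sum (fun k => psi_term n tau z (Z.of_nat a + nZ * k)) (psi tau a z).
Proof. by apply: psi_has_sum => //; rewrite Z.sub_diag Zmod_0_l. Qed.

Lemma psi_shift (a : 'I_n) z (j : nat) :
  psi tau a (z + INR j / N) = E (INR j * (IZR (Z.of_nat a) / N)) * E (- (INR j / N * o)) * psi tau a z.
Proof.
have nz := CN_neq0 hn.
apply: (has_sum_unique (psi_sum a _)).
apply: has_sum_ext (has_sum_scal _ (psi_sum a z)) => k.
rewrite /psi_term -!E_plus -(E_periodic _ (Z.of_nat j * k)); congr E.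
have half : RtoC o = (N - 1) / 2 by rewrite RtoC_div ?RtoC_minus //; lra.
rewrite !RtoC_minus half; Cpush; rewrite -!INR_IZR_INZ; field; exact: nz.
Qed.

Lemma psi_entire (a : 'I_n) z : exists l, cderiv (psi tau a) z l.
Proof.
pose F w := theta ((IZR (Z.of_nat a) - o) / N) 0 w (N * tau).
have [l hl] : exists l, cderiv F (0 + N * z) l by exact: (theta_cderiv (hntau hn htau)).
exists (N * l) => eps he; have [d d0 hd] := cderiv_scale hl he; exists d => // h /hd.
by rewrite !psi_theta // /F !Cplus_0_l.
Qed.

Lemma psi_Ve (a : 'I_n) : V (psi tau a).
Proof.
have nz := CN_neq0 hn.
split=> z.
- by have [l hl] := psi_entire a z; exists l; exact: cderiv_is_derive.
- rewrite -E_opp_offset; apply: (has_sum_unique (psi_sum a _)).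
  apply: has_sum_ext (has_sum_scal _ (psi_sum a z)) => k.
  rewrite /psi_term -!E_plus -(E_periodic _ (Z.of_nat a + nZ * k)); congr E.
  by Cpush; ring.
- rewrite Ve_tau_factor; apply: (has_sum_unique (psi_sum a _)).
  apply: has_sum_ext (has_sum_Zshift 1 (has_sum_scal _ (psi_sum a z))) => k.
  rewrite /psi_term -!E_plus; congr E.
  have half : RtoC o = (N - 1) / 2 by rewrite RtoC_div ?RtoC_minus //; lra.
  rewrite !RtoC_minus half; Cpush; rewrite -!INR_IZR_INZ; field; exact: nz.
Qed.

Lemma psi_nonzero (a : 'I_n) : exists z, psi tau a z <> 0.
Proof.
have nz := CN_neq0 hn; have hN := hntau hn htau.
pose c := ((IZR (Z.of_nat a) - o) / N)%R.
(* Chosen so that, after reduction to the odd theta function at level [n tau], the argument is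
   [n tau / 2], in the middle of the strip free of zeros. *)
pose z := (N * tau / 2 - (c - 1 / 2)%R * (N * tau) + 1 / 2) / N.
exists z; rewrite psi_theta // -/c.
have -> : c = (1 / 2 + (c - 1 / 2))%R by ring.
rewrite (theta_char hN _ _ _ (1 / 2)); apply: Cmult_neq_0; first exact: E_neq0.
have -> : N * z + RtoC (c - 1 / 2) * (N * tau) + (RtoC 0 - RtoC (1 / 2)) = N * tau / 2.
  by rewrite /z; Cpush; field.
apply: (theta_half_neq0_strip hN).
have -> : N * tau / 2 = RtoC (/ 2) * (N * tau) by rewrite RtoC_inv; [field|lra].
by rewrite im_scal_l; lra.
Qed.

(* Translating by [j / n] multiplies [psi_a] by [omega^(j a)] up to a common
   factor, so averaging over [j] isolates one coefficient. *)
Lemma psi_indep (c : 'I_n -> C) : (forall z, Csum (fun a => c a * psi tau a z) = 0) ->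
  forall a, c a = 0.
Proof.
move=> h a0; have nz := CN_neq0 hn; have [z hz] := psi_nonzero a0.
pose w (j : 'I_n) := / N * E (- (INR j * (IZR (Z.of_nat a0) / N))) * E (INR j / N * o).
have e : Csum (fun j => w j * Csum (fun a => c a * psi tau a (z + INR j / N))) = c a0 * psi tau a0 z.
  rewrite (Csum_ext (G := fun j => Csum (fun a => w j * (c a * psi tau a (z + INR j / N))))); last first.
    by move=> j; rewrite Csum_scal.
  rewrite Csum_exchange.
  have key a : Csum (fun j => w j * (c a * psi tau a (z + INR j / N)))
      = / N * (c a * psi tau a z) * Csum (fun j : 'I_n => E (INR j * (IZR (Z.of_nat a - Z.of_nat a0) / N))).
    rewrite Csum_scal; apply: Csum_ext => j; rewrite psi_shift /w.
    have -> : E (INR j * (IZR (Z.of_nat a - Z.of_nat a0) / N)) =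
       E (- (INR j * (IZR (Z.of_nat a0) / N))) * E (INR j / N * o) *
       (E (INR j * (IZR (Z.of_nat a) / N)) * E (- (INR j / N * o))).
      by rewrite -!E_plus; congr E; Cpush; field.
    by ring.
  rewrite (Csum_ext key) (Csum_single (i0 := a0)).
    by rewrite unity_sum // Z.sub_diag Zmod_0_l /=; field.
  move=> a ha; rewrite unity_sum //; case: Z.eqb_spec => hm; last by ring.
  have [q hq] : exists q, (Z.of_nat a - Z.of_nat a0 = q * nZ)%Z by apply/Z.mod_divide; lia.
  have la := ltn_ord a; have la0 := ltn_ord a0.
  case/eqP: ha; apply: val_inj => /=.
  have [y0|[y0|y0]] : (q <= -1 \/ q = 0 \/ 1 <= q)%Z by lia.
  - nia.
  - by rewrite y0 in hq; lia.
  - nia.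
have e0 : c a0 * psi tau a0 z = 0.
  rewrite -e (Csum_ext (G := fun _ => RtoC 0)); last by move=> j; rewrite h; ring.
  by rewrite Csum_const; ring.
by apply: NNPP => hc; apply: (Cmult_neq_0 _ _ hc hz).
Qed.

Section Span.
Variable f : C -> C.
Hypothesis hf : V f.

Let f_entire z : exists l, cderiv f z l.
Proof. by case: hf => h _ _; have [l hl] := h z; exists l; exact: is_derive_cderiv. Qed.

Let f_shift1 z : f (z + 1) = E (- RtoC o) * f z.
Proof. by case: hf => _ h _; rewrite E_opp_offset -h. Qed.

Let f_shift_tau z : f (z + tau) = E (- (N * tau / 2) - N * z) * f z.
Proof. by case: hf => _ _ h; rewrite -Ve_tau_factor h. Qed.

(** The offset in the frequency compensates the sign [(-1)^(n-1)] of [f (z + 1)], so the mode has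
    period 1. *)
Definition fourier_mode (m : Z) (z : C) : C := f z * E (- (IZR m - o)%R * z).

Lemma E_lin_cderiv (k z : C) : exists l, cderiv (fun w => E (k * w)) z l.
Proof.
have [l hl] : exists l, cderiv E (0 + k * z) l by eexists; exact: E_cderiv.
exists (k * l) => eps he; have [d d0 hd] := cderiv_scale hl he; exists d => // h /hd.
by rewrite !Cplus_0_l.
Qed.

Lemma fourier_mode_entire m z : exists l, cderiv (fourier_mode m) z l.
Proof.
have [l hl] := f_entire z; have [k hk] := E_lin_cderiv (- (IZR m - o)%R) z.
by eexists; exact: cderiv_mult hl hk.
Qed.

Lemma fourier_mode_1 m z : fourier_mode m (z + 1) = fourier_mode m z.
Proof.
rewrite /fourier_mode f_shift1.
have -> : E (- (IZR m - o)%R * (z + 1)) = E (- (IZR m - o)%R * z) * E o.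
  by rewrite -E_plus -[RHS](E_periodic _ (- m)); congr E; Cpush; ring.
have := @E_neq0 o; rewrite E_opp => nz; field; exact: nz.
Qed.

Definition fourier_coef (m : Z) : C := CInt (fun t => fourier_mode m (0 + t)) 0 1.

Lemma fourier_mode_contR m : contR (fun t => fourier_mode m (0 + t)).
Proof.
have cG z : ccont (fourier_mode m) z by have [l /cderiv_ccont] := fourier_mode_entire m z.
by apply: contR_ext (ccont_contR 0 1 cG) => t; rewrite Cmult_1_r.
Qed.

(** The coefficient is computed on the line through [tau] instead of the real axis; there
    quasi-periodicity raises the frequency by [n]. *)
Lemma fourier_coef_rec m : fourier_coef m = E (- (N * tau / 2) - (IZR m - o)%R * tau) * fourier_coef (m + nZ).
Proof.
rewrite /fourier_coef (mean_shift 0 tau (fourier_mode_entire m) (fourier_mode_1 m)) -CInt_scal.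
  2: exact: fourier_mode_contR.
apply: CInt_ext => t; rewrite /fourier_mode Cplus_0_l (Cplus_comm tau) f_shift_tau.
rewrite (Cmult_comm _ (f t)) -!Cmult_assoc (Cmult_comm _ (f t * _)) -!Cmult_assoc; congr Cmult.
by rewrite -!E_plus; congr E; Cpush; rewrite -INR_IZR_INZ; ring.
Qed.

(** The Fourier coefficient stripped of the Gaussian factor of [psi_term]. The recursion says
    exactly that it depends on [m] modulo [n], so [n] numbers determine [f]. *)
Definition reduced_coef (m : Z) : C :=
  fourier_coef m * E (- ((IZR m - o)%R * (IZR m - o)%R * tau / N / 2)).

Lemma reduced_coef_mod (a k : Z) : reduced_coef (a + nZ * k) = reduced_coef a.
Proof.
have nz := CN_neq0 hn.
have step m : reduced_coef (m + nZ) = reduced_coef m.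
  rewrite /reduced_coef (fourier_coef_rec m); set e1 := E _; set e2 := E _; set e3 := E _.
  have -> : e1 = e2 * e3; last by ring.
  rewrite /e1 /e2 /e3 -E_plus; congr E.
  have half : RtoC o = (N - 1) / 2 by rewrite RtoC_div ?RtoC_minus //; lra.
  rewrite !RtoC_minus half; Cpush; rewrite -!INR_IZR_INZ; field; exact: nz.
elim/Z.peano_ind: k => [|k IH|k IH].
- by rewrite Z.mul_0_r Z.add_0_r.
- by rewrite -IH -[RHS]step; congr reduced_coef; lia.
- by rewrite -IH -[LHS]step; congr reduced_coef; lia.
Qed.

(** Fourier inversion at each point [z0]: the periodic function [Phi] has value [f z0] at 0, and its
    coefficient of index [m] is [reduced_coef m * psi_term n tau z0 m]. Adding up the classes modulo
    [n] gives the combination of the [psi]. *)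
Lemma Ve_span : exists c : 'I_n -> C, forall z, f z = Csum (fun a => c a * psi tau a z).
Proof.
have nz := CN_neq0 hn.
exists (fun a => reduced_coef (Z.of_nat a)) => z0.
pose Phi z := f (z0 + 1 * z) * E (o * z).
have dPhi z : exists l, cderiv Phi z l.
  have [l hl] := f_entire (z0 + 1 * z); have [k hk] := E_lin_cderiv o z.
  by eexists; exact: cderiv_mult (cderiv_scale hl) hk.
have pPhi z : Phi (z + 1) = Phi z.
  rewrite /Phi (_ : z0 + 1 * (z + 1) = z0 + 1 * z + 1); last by ring.
  rewrite f_shift1 Cmult_plus_distr_l Cmult_1_r (E_plus (o * z)) E_opp.
  have := @E_neq0 o => no; field; exact: no.
have [U [hU limU]] := fourier_telescope dPhi pPhi.
have coef m : CInt (fun t => Phi t * E (- (IZR m * t))) 0 1 = reduced_coef m * psi_term n tau z0 m.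
  have -> : reduced_coef m * psi_term n tau z0 m = E ((IZR m - o)%R * z0) * fourier_coef m.
    rewrite /reduced_coef /psi_term; set e1 := E _; set e2 := E _; set e3 := E _.
    have -> : e3 = e1 * e2; last by ring.
    by rewrite /e1 /e2 /e3 -E_plus; congr E; field.
  rewrite /fourier_coef (mean_shift 0 z0 (fourier_mode_entire m) (fourier_mode_1 m)) -CInt_scal; last first.
    have cG z : ccont (fourier_mode m) z by have [l /cderiv_ccont] := fourier_mode_entire m z.
    by apply: contR_ext (ccont_contR z0 1 cG) => t; rewrite Cmult_1_r.
  apply: CInt_ext => t; rewrite /Phi /fourier_mode Cmult_1_l -Cmult_assoc.
  rewrite (Cmult_comm (E ((IZR m - o)%R * z0))) -Cmult_assoc; congr Cmult.
  by rewrite -!E_plus; congr E; Cpush; ring.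
(* One block of [n] consecutive modes. The telescoping differences of [U] collapse inside a block,
   leaving those of [W] at its ends. *)
pose b k := Csum (fun a : 'I_n => reduced_coef (Z.of_nat a) * psi_term n tau z0 (Z.of_nat a + nZ * k)).
have hb : has_sum b (Csum (fun a : 'I_n => reduced_coef (Z.of_nat a) * psi tau a z0)).
  exact: (has_sum_big (index_enum 'I_n) (fun a => has_sum_scal (reduced_coef (Z.of_nat a)) (psi_sum a z0))).
pose W k := U (nZ * k - 1)%Z.
have eb k : b k = (if k == 0%Z then Phi 0 else 0) + (W k - W (k + 1)%Z).
  have -> : b k = Csum (fun a : 'I_n => (if (Z.of_nat a + nZ * k =? 0)%Z then Phi 0 else 0) +
      (U (Z.of_nat a + nZ * k - 1)%Z - U (Z.of_nat a + nZ * k)%Z)).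
    by apply: Csum_ext => a; rewrite -hU coef reduced_coef_mod.
  rewrite /Csum big_split; congr Cplus.
    pose a0 : 'I_n := Ordinal hn.
    rewrite [LHS](Csum_single (i0 := a0)).
      rewrite /= ; case: eqP => [->|hk]; first by rewrite Z.mul_0_r.
      by case: Z.eqb_spec => // h; case: hk; nia.
    move=> a ha; case: Z.eqb_spec => // h; have la := ltn_ord a.
    case/eqP: ha; apply: val_inj => /=.
    have [y0|[y0|y0]] : (k <= -1 \/ k = 0 \/ 1 <= k)%Z by lia.
    - nia.
    - by rewrite y0 in h; lia.
    - nia.
  have tel m : \big[Cplus/RtoC 0]_(a < m) (U (Z.of_nat a + nZ * k - 1)%Z - U (Z.of_nat a + nZ * k)%Z)
      = W k - U (Z.of_nat m + nZ * k - 1)%Z.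
    elim: m => [|m IH]; first by rewrite big_ord0 /W /=; ring.
    rewrite big_ord_recr /= IH.
    rewrite (_ : (Z.pos (Pos.of_succ_nat m) + nZ * k - 1 = Z.of_nat m + nZ * k)%Z); last by lia.
    by ring.
  by rewrite tel /W; congr (_ - U _); lia.
have limW eps : (0 < eps)%R -> exists K : Z, forall m : Z, (K <= Z.abs m)%Z -> (Cmod (W m) < eps)%R.
  move=> he; have [K hK] := limU eps he; exists (Z.abs K + 1)%Z => m hm; apply: hK.
  have : (Z.abs m <= Z.abs (nZ * m))%Z by rewrite Z.abs_mul; nia.
  lia.
rewrite (telescoping_sum hb eb limW) /Phi !Cmult_0_r E_0 Cmult_1_r.
by congr f; ring.
Qed.

End Span.

Lemma psi_basis : is_basis V (@psi n tau).
Proof. by split; [exact: psi_Ve|exact: Ve_span|exact: psi_indep]. Qed.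

(** Both factors of each product are expanded to span. For independence, freezing [z2] turns a
    relation between products into one between the [psi], so that [psi_indep] is used twice. *)
Lemma psi2_basis :
  is_basis (tensor_square V) (fun ab : 'I_n * 'I_n => tensor (psi tau ab.1) (psi tau ab.2)).
Proof.
split.
- move=> [a b]; exists 1%N, (fun _ => psi tau a), (fun _ => psi tau b); split.
    by move=> _; split; exact: psi_Ve.
  by move=> z; rewrite /Csum big_ord1.
- move=> F [m [f [g [hfg eF]]]].
  have key (k : 'I_m) : exists c : 'I_n * 'I_n -> C, forall z,
      tensor (f k) (g k) z = Csum (fun ab => c ab * tensor (psi tau ab.1) (psi tau ab.2) z).
    have [/Ve_span [c hc] /Ve_span [d hd]] := hfg k.
    exists (fun ab => c ab.1 * d ab.2) => z; rewrite /tensor hc hd.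
    rewrite Cmult_comm Csum_scal.
    rewrite (Csum_ext (G := fun a => Csum (fun b => c a * d b * (psi tau a z.1 * psi tau b z.2)))).
      by rewrite Csum_pair.
    move=> a; rewrite Cmult_comm Csum_scal; apply: Csum_ext => b; ring.
  have [c hc] : exists c : 'I_m -> 'I_n * 'I_n -> C, forall k z,
      tensor (f k) (g k) z = Csum (fun ab => c k ab * tensor (psi tau ab.1) (psi tau ab.2) z).
    exists (fun k => proj1_sig (constructive_indefinite_description _ (key k))) => k.
    exact: proj2_sig (constructive_indefinite_description _ (key k)).
  exists (fun ab => Csum (fun k => c k ab)) => z; rewrite eF.
  rewrite (Csum_ext (G := fun k => Csum (fun ab => c k ab * tensor (psi tau ab.1) (psi tau ab.2) z))) //.
  rewrite Csum_exchange; apply: Csum_ext => ab.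
  by rewrite Cmult_comm Csum_scal; apply: Csum_ext => k; exact: Cmult_comm.
- move=> c h [a b].
  apply: (psi_indep (c := fun b => c (a, b))) => z2.
  apply: (psi_indep (c := fun a => Csum (fun b => c (a, b) * psi tau b z2))) => z1.
  have := h (z1, z2); rewrite /tensor /= => {}h; rewrite -[RHS]h.
  rewrite (Csum_ext (G := fun a => Csum (fun b => c (a, b) * (psi tau a z1 * psi tau b z2)))).
    by rewrite Csum_pair; apply: Csum_ext => -[].
  move=> a'; rewrite Cmult_comm Csum_scal; apply: Csum_ext => b'.
  by rewrite !Cmult_assoc (Cmult_comm (psi tau a' z1)).
Qed.

End Basis.

(** * Invariance, matrix coefficients and the Belavin form *)

Lemma Csum_reindex (I J : finType) (h : J -> I) (F : I -> C) : bijective h ->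
  Csum F = Csum (fun j => F (h j)).
Proof. by move=> hb; rewrite /Csum (reindex h) //; exact: onW_bij. Qed.

Lemma G_kron_fun tau x y : (0 < Im tau)%R -> G tau x y = kron_fun tau x y.
Proof.
move=> htau; have [l hl] := theta_cderiv htau (1 / 2) (1 / 2) 0.
have hd : C_derive (vartheta1 tau) 0 = - C_derive (fun z => theta (1 / 2) (1 / 2) z tau) 0.
  rewrite (cderiv_Cderive hl); apply: cderiv_Cderive => eps he.
  have [d d0 h] := hl eps he; exists d => // k /h.
  rewrite -Cmod_opp /vartheta1.
  by have -> : forall a b : C, - (a - b - k * l) = - a - - b - k * - l by move=> *; ring.
rewrite /G /kron_fun hd /vartheta1.
have -> : forall a b : C, - a * - b = a * b by move=> *; ring.
by have -> : forall a b : C, - a * - b = a * b by move=> *; ring.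
Qed.

(** * Linear combinations of theta functions *)

Section Ve_space.
Variables (n : nat) (tau : C).
Notation V := (Ve n tau).

Lemma Ve_lin (c : C) f g : V f -> V g -> V (fun z => c * f z + g z).
Proof.
move=> [f1 f2 f3] [g1 g2 g3]; split=> z.
- have [l /is_derive_cderiv hl] := f1 z; have [m /is_derive_cderiv hm] := g1 z.
  exists (c * l + m); apply: cderiv_is_derive => eps he.
  have p : (0 < Cmod c + 1)%R by have := Cmod_ge_0 c; lra.
  have [d1 p1 h1] := hl (eps / 2 / (Cmod c + 1))%R ltac:(apply: Rdiv_lt_0_compat; lra).
  have [d2 p2 h2] := hm (eps / 2)%R ltac:(lra).
  exists (Rmin d1 d2); first exact: Rmin_pos.
  move=> h hh; have {h1}a1 := h1 h (Rlt_le_trans _ _ _ hh (Rmin_l _ _)).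
  have {h2}a2 := h2 h (Rlt_le_trans _ _ _ hh (Rmin_r _ _)).
  have -> : c * f (z + h) + g (z + h) - (c * f z + g z) - h * (c * l + m) =
    c * (f (z + h) - f z - h * l) + (g (z + h) - g z - h * m) by ring.
  apply: Rle_trans (Cmod_triangle _ _) _; rewrite Cmod_mult.
  have : (Cmod c * Cmod (f (z + h) - f z - h * l)%C <= (Cmod c + 1) * (eps / 2 / (Cmod c + 1) * Cmod h))%R.
    apply: Rmult_le_compat => //; [exact: Cmod_ge_0|exact: Cmod_ge_0|lra].
  have -> : ((Cmod c + 1) * (eps / 2 / (Cmod c + 1) * Cmod h) = eps / 2 * Cmod h)%R by field; lra.
  lra.
- by rewrite f2 g2; ring.
- by rewrite f3 g3; ring.
Qed.

Lemma Ve_0 : V (fun _ => 0).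
Proof.
split=> z; try by rewrite Cmult_0_r.
exists (RtoC 0); apply: cderiv_is_derive => eps he; exists 1%R; first lra.
move=> h _; rewrite (_ : _ - _ - _ = 0) ?Cmod_0; last by ring.
by have := Cmod_ge_0 h; nra.
Qed.

Lemma Ve_Csum (I : finType) (c : I -> C) (f : I -> C -> C) : (forall i, V (f i)) ->
  V (fun z => Csum (fun i => c i * f i z)).
Proof.
move=> hf; rewrite /Csum; elim: (index_enum I) => [|i r IH].
  case: Ve_0 => a b d; split=> z; rewrite ?big_nil ?Cmult_0_r //.
  have [l hl] := a z; exists l; apply: is_derive_ext hl => w; by rewrite big_nil.
case: (Ve_lin (c i) (hf i) IH) => a b d; split=> z.
- have [l hl] := a z; exists l; apply: is_derive_ext hl => w; by rewrite big_cons.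
- by rewrite !big_cons b.
- by rewrite !big_cons d.
Qed.

End Ve_space.

Section Final.
Variables (n : nat) (tau kappa : C).
Hypotheses (hn : (1 <= n)%N) (htau : (0 < Im tau)%R) (hkappa : ~ lattice tau kappa).
Notation N := (INR n).
Notation nZ := (Z.of_nat n).
Notation V := (Ve n tau).
Notation Zord_n := (Zord hn).
Notation SUop := (SU tau kappa (1%R / (2%R * N)) (kappa / (2%R * N))).
Notation psi2 := (fun ab : 'I_n * 'I_n => tensor (psi tau ab.1) (psi tau ab.2)).

Lemma Zord_spec m : exists t, (Z.of_nat (Zord_n m) = m + nZ * t)%Z.
Proof. exists (- (m / nZ))%Z; have := Zord_div hn m; lia. Qed.

Lemma Zord_cong m m' t : (m = m' + nZ * t)%Z -> Zord_n m = Zord_n m'.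
Proof.
move=> h; have e := Zord_div hn m'.
by apply: (proj1 (@Zord_eq n hn m (m' / nZ + t)%Z (Zord_n m') _)); lia.
Qed.

Lemma Zord_id (a : 'I_n) : Zord_n (Z.of_nat a) = a.
Proof. by apply: (proj1 (@Zord_eq n hn _ 0 a _)); lia. Qed.

Lemma SU_shift (lambda : C) : 2%R * (1%R / (2%R * N) * lambda + kappa / (2%R * N)) = (lambda + kappa) / N.
Proof. by field; exact: CN_neq0. Qed.

Lemma SU_Csum lambda (I : finType) (c : I -> C) (f : I -> C * C -> C) F z :
  (forall z, F z = Csum (fun i => c i * f i z)) ->
  SUop lambda F z = Csum (fun i => c i * SUop lambda (f i) z).
Proof.
move=> e; rewrite /SU !e; set A := G tau _ lambda; set B := G tau _ kappa.
rewrite (_ : forall x y : C, A * x - B * y = A * x + - B * y); last by move=> *; ring.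
rewrite !Csum_scal /Csum -big_split; apply: eq_bigr => i _ /=; ring.
Qed.

Lemma SU_psi2 lambda (i j : 'I_n) z : ~ lattice tau lambda ->
  ~ lattice tau (z.1 - z.2 - 2%R * (1%R / (2%R * N) * lambda + kappa / (2%R * N))) ->
  SUop lambda (psi2 (i, j)) z = SU_expansion tau hn kappa lambda i j z.1 z.2.
Proof.
move=> hl hw; have nz := CN_neq0 hn; rewrite SU_shift in hw.
rewrite -main_identity // /SU_psi /SU SU_shift !G_kron_fun // /tensor /=.
have -> : 2%R * (1%R / (2%R * N)) * lambda = lambda / N by field.
by have -> : 2%R * (kappa / (2%R * N)) = kappa / N by field.
Qed.

Definition Rcoef (lambda : C) (i j k l : 'I_n) : C :=
  if i + j == k + l %[mod n] then
     C_derive (fun x => theta (1 / 2) (1 / 2) x (N * tau)) 0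
     * theta ((INR i - INR j) / N + 1 / 2) (1 / 2) (lambda - kappa) (N * tau)
     / (theta ((INR i - INR k) / N + 1 / 2) (1 / 2) (- kappa) (N * tau)
        * theta ((INR k - INR j) / N + 1 / 2) (1 / 2) lambda (N * tau))
  else RtoC 0.

Lemma mod_Zord (i j k l : 'I_n) :
  (i + j == k + l %[mod n]) = (l == Zord_n (Z.of_nat i + Z.of_nat j - Z.of_nat k)).
Proof.
apply/eqP/eqP => [h|->].
  rewrite -{1}(Zord_id l).
  have h1 := divn_eq (i + j) n; have h2 := divn_eq (k + l) n; rewrite h in h1.
  apply: (Zord_cong (t := (Z.of_nat ((k + l) %/ n) - Z.of_nat ((i + j) %/ n))%Z)).
  nia.
have [t ht] := Zord_spec (Z.of_nat i + Z.of_nat j - Z.of_nat k).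
have [h|h] : (0 <= t \/ t <= 0)%Z by lia.
  have -> : (k + Zord_n (Z.of_nat i + Z.of_nat j - Z.of_nat k) = Z.to_nat t * n + (i + j))%N by nia.
  by rewrite modnMDl.
have -> : (i + j = Z.to_nat (- t) * n + (k + Zord_n (Z.of_nat i + Z.of_nat j - Z.of_nat k)))%N by nia.
by rewrite modnMDl.
Qed.

Lemma SU_expansion_Rcoef lambda (i j : 'I_n) z : SU_expansion tau hn kappa lambda i j z.1 z.2 =
  Csum (fun kl : 'I_n * 'I_n => Rcoef lambda i j kl.1 kl.2 * psi2 kl z).
Proof.
rewrite -(Csum_pair (fun k l => Rcoef lambda i j k l * psi2 (k, l) z)) /SU_expansion.
apply: Csum_ext => k /=.
rewrite (Csum_single (i0 := Zord_n (Z.of_nat i + Z.of_nat j - Z.of_nat k))); last first.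
  by move=> l /negPf hl; rewrite /Rcoef mod_Zord hl; ring.
rewrite /Rcoef mod_Zord eqxx /tensor /=; congr Cmult; rewrite /R_entry.
rewrite !minus_IZR -!INR_IZR_INZ.
by have -> : (INR k - INR j + (INR i - INR k) = INR i - INR j)%R by ring.
Qed.

Lemma tensor_square_comb (d : 'I_n * 'I_n -> C) :
  tensor_square V (fun z => Csum (fun ab => d ab * psi2 ab z)).
Proof.
(* The scalar goes into the first factor, and the [+ 0] gives it the shape treated by [Ve_lin]. *)
exists #|{: 'I_n * 'I_n}|, (fun k z => d (enum_val k) * psi tau (enum_val k).1 z + 0),
  (fun k => psi tau (enum_val k).2); split.
  move=> k; split; last exact: psi_Ve.
  by apply: Ve_lin (Ve_0 n tau); exact: psi_Ve.
move=> z; rewrite (Csum_reindex (h := fun k : 'I_#|{: 'I_n * 'I_n}| => enum_val k)).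
  by apply: Csum_ext => k; rewrite /tensor /= Cplus_0_r Cmult_assoc.
by exists enum_rank; [exact: enum_valK|exact: enum_rankK].
Qed.

Lemma SU_comb lambda (c : 'I_n * 'I_n -> C) F : ~ lattice tau lambda ->
  (forall z, F z = Csum (fun ab => c ab * psi2 ab z)) ->
  SU_maps tau kappa (1%R / (2%R * N)) (kappa / (2%R * N)) lambda F
    (fun z => Csum (fun ab => c ab * SU_expansion tau hn kappa lambda ab.1 ab.2 z.1 z.2)).
Proof.
move=> hl eF z hw; rewrite (SU_Csum _ _ eF); apply: Csum_ext => -[a b].
by rewrite SU_psi2.
Qed.

Lemma iter_S_op k (u : vec n) a : iter k (@S_op n) u a = Cpow (Cpow (omega n) a) k * u a.
Proof. by elim: k => [|k IH] /=; [ring|rewrite /S_op IH; ring]. Qed.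

Lemma iter_S_inv k (u : vec n) a : iter k (@S_inv n) u a = Cpow (/ Cpow (omega n) a) k * u a.
Proof. by elim: k => [|k IH] /=; [ring|rewrite /S_inv IH; ring]. Qed.

Lemma ordS_Zord m : ordS (Zord_n m) = Zord_n (m + 1).
Proof.
have [t ht] := Zord_spec m; rewrite -(Zord_id (ordS _)).
have h := divn_eq (Zord_n m).+1 n.
apply: (Zord_cong (t := (t - Z.of_nat ((Zord_n m).+1 %/ n))%Z)).
change (nat_of_ord (ordS (Zord_n m))) with ((Zord_n m).+1 %% n)%N.
move: (nat_of_ord (Zord_n m)) ht h => x ht h; move: (x.+1 %/ n)%N (x.+1 %% n)%N h => q r h; nia.
Qed.

Lemma ord_pred_Zord m : ord_pred (Zord_n m) = Zord_n (m - 1).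
Proof.
have [t ht] := Zord_spec m; rewrite -(Zord_id (ord_pred _)).
have h := divn_eq (Zord_n m + n).-1 n.
apply: (Zord_cong (t := (t + 1 - Z.of_nat ((Zord_n m + n).-1 %/ n))%Z)).
change (nat_of_ord (ord_pred (Zord_n m))) with ((Zord_n m + n).-1 %% n)%N.
move: (nat_of_ord (Zord_n m)) ht h => x ht h.
move: ((x + n).-1 %/ n)%N ((x + n).-1 %% n)%N h => q r h; nia.
Qed.

Lemma iter_T_op k (u : vec n) m : iter k (@T_op n) u (Zord_n m) = u (Zord_n (m + Z.of_nat k)).
Proof.
elim: k m => [|k IH] m; first by rewrite /= Z.add_0_r.
by rewrite iterS {1}/T_op ordS_Zord IH; congr (u (Zord_n _)); lia.
Qed.

Lemma iter_T_inv k (u : vec n) m : iter k (@T_inv n) u (Zord_n m) = u (Zord_n (m - Z.of_nat k)).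
Proof.
elim: k m => [|k IH] m; first by rewrite /= Z.sub_0_r.
by rewrite iterS {1}/T_inv ord_pred_Zord IH; congr (u (Zord_n _)); lia.
Qed.

Lemma omega_E (a b : nat) : Cpow (Cpow (omega n) a) b = E (INR b * (INR a / N)).
Proof.
rewrite E_pow; congr Cpow.
have -> : omega n = E (1 / N) by rewrite /omega E_Cexp; congr Cexp; field; exact: CN_neq0.
by rewrite -E_pow; congr E; field; exact: CN_neq0.
Qed.

(** In [I_op] the powers of [S] act last, so their phase is read at [k]; in [I_inv] the powers of
    [T] act last, so the inverse phase is read at the shifted index [j]. Together they give the
    difference [k - j]. *)
Lemma op_tensor_I (al : 'I_n * 'I_n) (w : vec2 n) (k l : 'I_n) :
  let i := Zord_n (Z.of_nat k + Z.of_nat al.2) in let j := Zord_n (Z.of_nat l - Z.of_nat al.2) in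
  op_tensor (I_op al) (I_inv al) w k l =
  E (INR al.1 * (IZR (Z.of_nat k - Z.of_nat j) / N)) * w i j.
Proof.
move=> i j; have nz := CN_neq0 hn.
rewrite /op_tensor /I_op iter_S_op -{2}(Zord_id k) iter_T_op -/i.
rewrite /I_inv -{1}(Zord_id l) iter_T_inv -/j iter_S_inv.
rewrite Cpow_inv ?omega_E; last first.
  have := omega_E j 1; rewrite /= Cmult_1_r => ->; exact: E_neq0.
rewrite Cmult_assoc -E_opp -E_plus; congr (E _ * _).
by Cpush; rewrite -!INR_IZR_INZ; field.
Qed.

(** The intertwiner sends [e_a] to [psi_a]; no further change of basis separates the operator from
    the Belavin matrix. *)
Definition psi_map (u : vec n) (z : C) : C := Csum (fun a => u a * psi tau a z).

Lemma psi_map_e a z : psi_map (e_ a) z = psi tau a z.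
Proof.
rewrite /psi_map (Csum_single (i0 := a)); first by rewrite /e_ eqxx; ring.
by move=> b /negPf hb; rewrite /e_ hb; ring.
Qed.

Lemma psi_map_iso : linear_iso V psi_map.
Proof.
split.
- move=> u v z; rewrite /psi_map /Csum -big_split; apply: eq_bigr => a _ /=; ring.
- move=> c u z; rewrite /psi_map Csum_scal; apply: Csum_ext => a; ring.
- by move=> u; apply: Ve_Csum => a; exact: psi_Ve.
- by move=> u; exact: psi_indep.
- by move=> f hf; have [c hc] := Ve_span hn htau hf; exists c => z; rewrite hc.
Qed.

Lemma map_tensor_psi_map (w : vec2 n) z :
  map_tensor psi_map w z = Csum (fun ab : 'I_n * 'I_n => w ab.1 ab.2 * psi2 ab z).
Proof. by apply: Csum_ext => -[a b]; rewrite /tensor !psi_map_e. Qed.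

Lemma belavin_theta_eq (al : 'I_n * 'I_n) z : belavin_theta tau al z =
  theta (1 / 2 + INR al.2 / N) (1 / 2 - INR al.1 / N) z tau.
Proof. by []. Qed.

Lemma eta_admissible : belavin_admissible n tau (- kappa / N).
Proof. move=> al; rewrite belavin_theta_eq; exact: weight_neq0. Qed.

Definition scale_fun (lambda : C) : C :=
  C_derive (fun z => theta (1 / 2) (1 / 2) z tau) 0 / theta (1 / 2) (1 / 2) lambda tau.

Lemma scale_neq0 lambda : ~ lattice tau lambda -> scale_fun lambda <> 0.
Proof.
move=> hl; have nT : theta (1 / 2) (1 / 2) lambda tau <> 0.
  by move=> /(theta_zero_lattice htau).
move=> h; apply: (theta_half_deriv_neq0 htau).
have -> : C_derive (fun z => theta (1 / 2) (1 / 2) z tau) 0 = scale_fun lambda * theta (1 / 2) (1 / 2) lambda tau.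
  by rewrite /scale_fun; field.
by rewrite h; ring.
Qed.

Lemma belavin_coef lambda (w : vec2 n) (k l : 'I_n) : ~ lattice tau lambda ->
  scale_fun lambda * belavin tau (- kappa / N) lambda w k l =
  Csum (fun al2 : 'I_n => let j := Zord_n (Z.of_nat l - Z.of_nat al2) in
    belavin_entry tau kappa lambda al2 (Z.of_nat k - Z.of_nat j)
    * w (Zord_n (Z.of_nat k + Z.of_nat al2)) j).
Proof.
move=> hl; have nz := CN_neq0 hn; rewrite /belavin Csum_scal.
rewrite -(Csum_pair (fun a1 a2 => scale_fun lambda * (belavin_weight tau (- kappa / N) (a1, a2) lambda *
   op_tensor (I_op (a1, a2)) (I_inv (a1, a2)) w k l))) Csum_exchange.
apply: Csum_ext => a2 /=; rewrite /belavin_entry Cmult_comm !Csum_scal.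
apply: Csum_ext => a1; rewrite op_tensor_I /= /belavin_weight !belavin_theta_eq /=.
have -> : lambda + - kappa / N = lambda - kappa / N by field.
have nw := weight_neq0 hn htau (al1 := a1) (al2 := a2) hkappa.
rewrite /scale_fun.
have nT : theta (1 / 2) (1 / 2) lambda tau <> 0 by move=> /(theta_zero_lattice htau).
by field.
Qed.

(** For fixed [k] the substitutions [i = k + al2] (the map [h]) and [j = l - al2] (the map [g])
    match the two summations, and [belavin_identity] then equates the coefficients entry by
    entry. *)
Lemma SU_belavin lambda (w : vec2 n) z : ~ lattice tau lambda ->
  Csum (fun ab : 'I_n * 'I_n => w ab.1 ab.2 * SU_expansion tau hn kappa lambda ab.1 ab.2 z.1 z.2) =
  scale_fun lambda * map_tensor psi_map (belavin tau (- kappa / N) lambda w) z.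
Proof.
move=> hl; rewrite map_tensor_psi_map Csum_scal.
have eR : Csum (fun kl : 'I_n * 'I_n => scale_fun lambda * (belavin tau (- kappa / N) lambda w kl.1 kl.2 * psi2 kl z))
  = Csum (fun k : 'I_n => Csum (fun a2 : 'I_n => Csum (fun l : 'I_n => let j := Zord_n (Z.of_nat l - Z.of_nat a2) in
    belavin_entry tau kappa lambda a2 (Z.of_nat k - Z.of_nat j)
    * w (Zord_n (Z.of_nat k + Z.of_nat a2)) j * psi2 (k, l) z))).
  rewrite -(Csum_pair (fun k l => scale_fun lambda * (belavin tau (- kappa / N) lambda w k l * psi2 (k, l) z))).
  apply: Csum_ext => k; rewrite [RHS]Csum_exchange; apply: Csum_ext => l.
  by rewrite Cmult_assoc belavin_coef // Cmult_comm Csum_scal; apply: Csum_ext => a2; rewrite Cmult_comm.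
rewrite eR -(Csum_pair (fun a b => w a b * SU_expansion tau hn kappa lambda a b z.1 z.2)).
pose X (i j k : 'I_n) := R_entry n tau kappa lambda
    (IZR (Z.of_nat k - Z.of_nat j) + IZR (Z.of_nat i - Z.of_nat k))
    (IZR (Z.of_nat i - Z.of_nat k)) (IZR (Z.of_nat k - Z.of_nat j))
  * w i j * (psi tau k z.1 * psi tau (Zord_n (Z.of_nat i + Z.of_nat j - Z.of_nat k)) z.2).
have -> : Csum (fun i => Csum (fun j => w i j * SU_expansion tau hn kappa lambda i j z.1 z.2)) =
    Csum (fun k => Csum (fun i => Csum (fun j => X i j k))).
  rewrite [RHS]Csum_exchange; apply: Csum_ext => i.
  rewrite [RHS]Csum_exchange; apply: Csum_ext => j.
  rewrite /SU_expansion Csum_scal; apply: Csum_ext => k; rewrite /X /=; ring.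
apply: Csum_ext => k.
pose h (a : 'I_n) := Zord_n (Z.of_nat k + Z.of_nat a).
pose h' (i : 'I_n) := Zord_n (Z.of_nat i - Z.of_nat k).
have hb : bijective h.
  exists h' => a; rewrite /h /h' -[RHS]Zord_id.
    have [t ht] := Zord_spec (Z.of_nat k + Z.of_nat a); apply: (Zord_cong (t := t)); lia.
  have [t ht] := Zord_spec (Z.of_nat a - Z.of_nat k); apply: (Zord_cong (t := t)); lia.
rewrite (Csum_reindex _ hb); apply: Csum_ext => a2.
pose g (l : 'I_n) := Zord_n (Z.of_nat l - Z.of_nat a2).
pose g' (j : 'I_n) := Zord_n (Z.of_nat j + Z.of_nat a2).
have gb : bijective g.
  exists g' => a; rewrite /g /g' -[RHS]Zord_id.
    have [t ht] := Zord_spec (Z.of_nat a - Z.of_nat a2); apply: (Zord_cong (t := t)); lia.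
  have [t ht] := Zord_spec (Z.of_nat a + Z.of_nat a2); apply: (Zord_cong (t := t)); lia.
rewrite (Csum_reindex _ gb); apply: Csum_ext => l /=.
have [t ht] := Zord_spec (Z.of_nat k + Z.of_nat a2).
have [t' ht'] := Zord_spec (Z.of_nat l - Z.of_nat a2).
have el : Zord_n (Z.of_nat (h a2) + Z.of_nat (g l) - Z.of_nat k) = l.
  rewrite -[RHS]Zord_id /h /g; apply: (Zord_cong (t := (t + t')%Z)); lia.
rewrite /X el /tensor /=; congr (_ * _ * _).
apply: (belavin_identity hn htau) => //.
have e : (Z.of_nat (h a2) - Z.of_nat k = Z.of_nat a2 + nZ * t)%Z by rewrite /h; lia.
by exists t.
Qed.

End Final.

Theorem theorem4p2 (n : nat) (tau kappa : C)
    (hn : (1 <= n)%N) (htau : (0 < Im tau)%R) (hkappa : ~ lattice tau kappa) :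
  let V := Ve n tau in
  let dom := fun lambda : C => ~ lattice tau lambda in
  let R_maps := SU_maps tau kappa (1%R / (2%R * INR n)) (kappa / (2%R * INR n)) in
  let psi2 := fun ab : 'I_n * 'I_n => tensor (psi tau ab.1) (psi tau ab.2) in
  is_basis V (@psi n tau) /\
  is_basis (tensor_square V) psi2 /\
  (forall lambda, dom lambda -> forall F, tensor_square V F ->
     exists H, tensor_square V H /\ R_maps lambda F H) /\
  (exists eta : C, belavin_admissible n tau eta /\
     equivalent dom V R_maps (@belavin n tau eta)) /\
  (forall lambda, dom lambda -> forall i j : 'I_n,
     R_maps lambda (psi2 (i, j))
       (fun z => Csum (fun kl : 'I_n * 'I_n => let (k, l) := kl in
          (if i + j == k + l %[mod n] then
             C_derive (fun x => theta (1 / 2) (1 / 2) x (INR n * tau)) 0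
             * theta ((INR i - INR j) / INR n + 1 / 2) (1 / 2)
                 (lambda - kappa) (INR n * tau)
             / (theta ((INR i - INR k) / INR n + 1 / 2) (1 / 2)
                  (- kappa) (INR n * tau)
                * theta ((INR k - INR j) / INR n + 1 / 2) (1 / 2)
                    lambda (INR n * tau))
           else RtoC 0)
          * psi2 (k, l) z))).
Proof.
move=> V dom R_maps psi2.
split; first exact: psi_basis.
split; first exact: psi2_basis.
split.
  move=> lambda hl F hF.
  have [_ span _] := psi2_basis hn htau; have [c hc] := span F hF.
  exists (fun z => Csum (fun ab => c ab * SU_expansion tau hn kappa lambda ab.1 ab.2 z.1 z.2)).
  split; last exact: SU_comb.
  have [m [f [g [hfg e]]]] := tensor_square_comb hn htau
    (fun kl => Csum (fun ab => c ab * Rcoef tau kappa lambda ab.1 ab.2 kl.1 kl.2)).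
  exists m, f, g; split=> // z; rewrite -e.
  rewrite (Csum_ext (G := fun ab : 'I_n * 'I_n => Csum (fun kl => c ab *
     (Rcoef tau kappa lambda ab.1 ab.2 kl.1 kl.2 * psi2 kl z)))); last first.
    by move=> ab; rewrite SU_expansion_Rcoef Csum_scal.
  rewrite Csum_exchange; apply: Csum_ext => kl.
  rewrite Cmult_comm Csum_scal; apply: Csum_ext => ab.
  by rewrite Cmult_assoc Cmult_comm.
split.
  exists (- kappa / INR n); split; first exact: eta_admissible.
  exists (@psi_map n tau), (scale_fun tau); split.
  - exact: psi_map_iso.
  - by move=> lambda; exact: scale_neq0.
  - move=> lambda hl w z hw; rewrite -(SU_belavin hn htau) //.
    apply: (SU_comb hn htau hkappa hl) hw => z'; exact: map_tensor_psi_map.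
move=> lambda hl i j z hw; rewrite /psi2 (SU_psi2 hn htau) // SU_expansion_Rcoef.
by apply: Csum_ext => -[k l].
Qed.
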